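(* Let $0<\alpha<n$ and $1<p<n/\alpha$, and define $q$ by $\frac1p-\frac1q=\frac{\alpha}{n}$. Put $s(p)=1+\frac{q}{p'}$ and $s(q')=1+\frac{p'}{q}$, and let $\Phi(t)=1+\log(t)$. If $w$ is a weight on $\mathbb{R}^n$ with $w^q\in A_{s(p)}$, then $$\|I_\alpha\|_{L^p(w^p)\to L^{q,\infty}(w^q)}\lesssim \Phi\big([w^q]_{A_{s(p)}}\big)^{\frac1{p'}}\,[w^q]_{(A_{s(p)})^{\frac1q}(A^M_\infty)^{\frac1{p'}}}$$ and $$\|I_\alpha\|_{L^p(w^p)\to L^{q}(w^q)}\lesssim \Phi\big([w^q]_{A_{s(p)}}\big)^{\frac1{p'}}\,[w^q]_{(A_{s(p)})^{\frac1q}(A^M_\infty)^{\frac1{p'}}}+\Phi\big([w^{-p'}]_{A_{s(q')}}\big)^{\frac1q}\,[w^{-p'}]_{(A_{s(q')})^{\frac1{p'}}(A^M_\infty)^{\frac1q}}.$$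
   Context: A weight is a non-negative locally integrable function on $\mathbb{R}^n$; $r'=r/(r-1)$. All cubes have sides parallel to the axes, and all suprema $\sup_Q$ are over all cubes $Q$. The Riesz potential is $I_\alpha f(x)=\int_{\mathbb{R}^n}\frac{f(y)}{|x-y|^{n-\alpha}}\,dy$, and $M f(x)=\sup_{Q\ni x}\frac1{|Q|}\int_Q|f|\,dy$ is the Hardy–Littlewood maximal operator. For $1<r<\infty$ and a weight $v$, $A_r(v,Q)=\left(\frac1{|Q|}\int_Q v\,dx\right)\left(\frac1{|Q|}\int_Q v^{1-r'}\,dx\right)^{r-1}$, $[v]_{A_r}=\sup_Q A_r(v,Q)$, and $v\in A_r$ means $[v]_{A_r}<\infty$. Also $A^M_\infty(v,Q)=\frac1{v(Q)}\int_Q M(v\chi_Q)\,dx$ with $v(E)=\int_E v\,dx$, and for $\beta,\gamma>0$, $$[v]_{(A_r)^\beta(A^M_\infty)^\gamma}=\sup_Q A_r(v,Q)^\beta A^M_\infty(v,Q)^\gamma .$$ $\|f\|_{L^p(w^p)}=(\int|f|^p w^p\,dx)^{1/p}$ and $\|g\|_{L^{q,\infty}(v)}=\sup_{t>0}t\,v(\{|g|>t\})^{1/q}$. $\|I_\alpha\|_{L^p(w^p)\to L^q(w^q)}$ is the smallest constant $K\in[0,\infty]$ such that $\|I_\alpha f\|_{L^q(w^q)}\le K\|f\|_{L^p(w^p)}$ for all $f\in L^p(w^p)$, and similarly for $L^{q,\infty}(w^q)$. $A\lesssim B$ means $A\le cB$ with $c$ depending only on $n,\alpha,p,q$. *)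

(* Defs.v *)
From HB Require Import structures.
From mathcomp Require Import all_boot all_order all_algebra.
From mathcomp Require Import all_classical all_reals all_analysis.

Set Implicit Arguments.
Unset Strict Implicit.
Unset Printing Implicit Defensive.

Import Order.TTheory GRing.Theory Num.Theory.
Import numFieldNormedType.Exports.

Local Open Scope classical_set_scope.
Local Open Scope ring_scope.

(* R^n, with the product (Borel) sigma-algebra that the library puts on
   tuples. *)
Notation Rn R n := (n.-tuple (measurableTypeR R)).

Section lebesgue_cons.
Local Open Scope ereal_scope.
Context (R : realType) (n : nat).
Variable mu : {sigma_finite_measure set (Rn R n) -> \bar R}.

Definition consR (z : measurableTypeR R * Rn R n) : Rn R n.+1 :=
  [the n.+1.-tuple (measurableTypeR R) of z.1 :: z.2].

Lemma measurable_consR : measurable_fun setT consR.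
Proof. exact: (measurable_cons measurable_fst measurable_snd). Qed.

(* The product of the Lebesgue measure on R and of mu, carried to R^(n+1). *)
Definition lebesgue_cons : set (Rn R n.+1) -> \bar R :=
  pushforward (lebesgue_measure \x mu) consR.

Let lebesgue_cons0 : lebesgue_cons set0 = 0.
Proof. by rewrite /lebesgue_cons /pushforward preimage_set0 measure0. Qed.

Let lebesgue_cons_ge0 A : 0 <= lebesgue_cons A.
Proof. by apply: integral_ge0 => // x _; exact: measure_ge0. Qed.

Let lebesgue_cons_sigma_additive : semi_sigma_additive lebesgue_cons.
Proof.
have mc A : measurable A -> measurable (consR @^-1` A).
  by move=> mA; rewrite -[X in measurable X]setTI; exact: measurable_consR.
move=> F mF tF mUF; rewrite /lebesgue_cons /pushforward preimage_bigcup.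
apply: measure_semi_sigma_additive.
- by move=> i; exact: mc.
- apply/trivIsetP => /= i j _ _ ij; rewrite -preimage_setI.
  by move/trivIsetP : tF => /(_ _ _ _ _ ij) ->//; rewrite preimage_set0.
- by rewrite -preimage_bigcup; exact: mc.
Qed.

HB.instance Definition _ := isMeasure.Build _ _ _ lebesgue_cons
  lebesgue_cons0 lebesgue_cons_ge0 lebesgue_cons_sigma_additive.

Let lebesgue_cons_sigma_finite : sigma_finite setT lebesgue_cons.
Proof.
have [F UF Foo] : sigma_finite setT (lebesgue_measure \x mu).
  have /sigma_finiteP[F [TF ndF Foo]] := sigma_finiteT (@lebesgue_measure R).
  have /sigma_finiteP[G [TG ndG Goo]] := sigma_finiteT mu.
  exists (fun k => F k `*` G k).
    apply/seteqP; split => // -[x y] _.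
    have [i _ Fx] : (\bigcup_k F k) x by rewrite -TF.
    have [j _ Gy] : (\bigcup_k G k) y by rewrite -TG.
    exists (maxn i j) => //; split => /=.
      by move: x Fx; exact/subsetPset/ndF/leq_maxl.
    by move: y Gy; exact/subsetPset/ndG/leq_maxr.
  move=> k; have [? ?] := Foo k; have [? ?] := Goo k.
  split; first exact: measurableX.
  by rewrite product_measure1E// lte_mul_pinfty// ge0_fin_numE.
pose g (t : Rn R n.+1) : measurableTypeR R * Rn R n :=
  (tnth t ord0, [tuple of behead t]).
have mg : measurable_fun setT g.
  apply/measurable_fun_pairP; split.
    exact: measurable_tnth.
  exact: measurable_behead.
have gK z : g (consR z) = z.
  by case: z => x t; rewrite /g; congr (_, _); exact: val_inj.
exists (fun k => g @^-1` F k).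
  by rewrite -preimage_bigcup -UF preimage_setT.
move=> k; have [mF Fk] := Foo k; split.
  by rewrite -[X in measurable X]setTI; exact: mg.
rewrite /lebesgue_cons /pushforward -comp_preimage.
by rewrite (_ : g \o consR = id)//; apply/funext => z /=; rewrite gK.
Qed.

HB.instance Definition _ := Measure_isSigmaFinite.Build _ _ _ lebesgue_cons
  lebesgue_cons_sigma_finite.

End lebesgue_cons.

Fixpoint lebesgue_Rn (R : realType) (n : nat) :
    {sigma_finite_measure set (Rn R n) -> \bar R} :=
  if n is m.+1 then lebesgue_cons (lebesgue_Rn R m)
  else \d_([tuple] : Rn R 0).

Lemma lebesgue_Rn_box (R : realType) (n : nat)
    (A : 'I_n -> set (measurableTypeR R)) : (forall i, measurable (A i)) ->
  lebesgue_Rn R n [set x | forall i, A i (tnth x i)] =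
    (\prod_(i < n) lebesgue_measure (A i))%E.
Proof.
elim: n => [|n IH] in A *.
  move=> _; rewrite big_ord0 /= diracE mem_set//= => -[]//.
move=> mA; rewrite big_ord_recl -IH//.
pose B : set (Rn R n) := [set x | forall i, A (lift ord0 i) (tnth x i)].
have mB : measurable B.
  rewrite (_ : B = \bigcap_(i in [set: 'I_n])
      ((@tnth n _ ^~ i) @^-1` A (lift ord0 i))).
    apply: fin_bigcap_measurable => // i _.
    by rewrite -[X in measurable X]setTI; exact: measurable_tnth.
  by apply/seteqP; split => [x Bx i _|x Bx i]; [exact: Bx|exact: (Bx i)].
rewrite -product_measure1E//= /lebesgue_cons /pushforward.
congr (product_measure1 _ _ _); apply/seteqP; split => -[x t] /= Axt.
  split; first exact: (Axt ord0).
  by move=> i; have := Axt (lift ord0 i); rewrite /consR tnthS.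
case: Axt => Ax At i; case: (unliftP ord0 i) => [j|] ->.
  by rewrite /consR tnthS; exact: At.
exact: Ax.
Qed.

Section definitions.
Context (R : realType) (n : nat).
Local Notation E := (Rn R n).
Local Notation mu := (lebesgue_Rn R n).
Implicit Types (x y a : E) (f w : E -> R) (v : E -> \bar R) (Q : set E).

(* Lebesgue (rather than Borel) measurability.  The library's integral of a
   nonnegative function is a supremum over the simple Borel functions below it;
   it ignores null sets, so it has the usual value on such functions too. *)
Definition Lmeasurable f :=
  exists2 g : E -> R, measurable_fun setT g & {ae mu, forall x, f x = g x}.

Definition cube a (l : R) : set E :=
  [set x | forall i, tnth a i <= tnth x i <= tnth a i + l].

Definition cubes : set (set E) :=
  [set Q | exists a (l : R), 0 < l /\ Q = cube a l].

Local Open Scope ereal_scope.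

(* Integrability on cubes is local integrability: every compact set lies in a
   cube. *)
Definition weight w :=
  [/\ Lmeasurable w, (forall x, 0 <= w x)%R &
      forall Q, cubes Q -> \int[mu]_(x in Q) (w x)%:E < +oo].

(* x `^ r on [0, +oo], with 0 `^ r = +oo and +oo `^ r = 0 for r < 0; the
   library's power function is 0 at 0 and +oo at +oo for such r. *)
Definition epow (x : \bar R) (r : R) : \bar R :=
  if (r < 0)%R then (x `^ (- r))^-1 else x `^ r.

Definition wpow w (r : R) : E -> \bar R := fun x => epow (w x)%:E r.

Definition avg v Q : \bar R := (\int[mu]_(x in Q) v x) / mu Q.

Definition maximal v x : \bar R :=
  ereal_sup [set avg (abse \o v) Q | Q in [set Q | cubes Q /\ Q x]].

Definition conj_exp (r : R) : R := (r / (r - 1))%R.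

Definition A_loc (r : R) v Q : \bar R :=
  avg v Q * epow (avg (fun x => epow (v x) (1 - conj_exp r)) Q) (r - 1).

Definition A_const (r : R) v : \bar R := ereal_sup [set A_loc r v Q | Q in cubes].

Definition wmeas v (A : set E) : \bar R := \int[mu]_(x in A) v x.

Definition AMinf_loc v Q : \bar R :=
  (wmeas v Q)^-1 * \int[mu]_(x in Q) maximal (v \_ Q) x.

Definition mixed_const (r beta gamma : R) v : \bar R :=
  ereal_sup [set epow (A_loc r v Q) beta * epow (AMinf_loc v Q) gamma
            | Q in cubes].

Definition edist x y : R :=
  Num.sqrt (\sum_(i < n) (tnth x i - tnth y i) ^+ 2)%R.

(* Where the integral is not defined, i.e., where its positive and negative
   parts are both infinite, the value is -oo, hence of infinite modulus.  The
   kernel takes the value 0 instead of +oo at y = x, a null set for n > 0. *)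
Definition riesz (alpha : R) f x : \bar R :=
  \int[mu]_y (f y / edist x y `^ (n%:R - alpha))%:E.

Definition strong_norm (p : R) v (g : E -> \bar R) : \bar R :=
  epow (\int[mu]_x (epow `|g x| p * v x)) p^-1.

Definition weak_norm (q : R) v (g : E -> \bar R) : \bar R :=
  ereal_sup [set t%:E * epow (wmeas v [set x | t%:E < `|g x|]) q^-1
            | t in [set t : R | (0 < t)%R]].

Definition in_Lp (p : R) v f :=
  Lmeasurable f /\ strong_norm p v (EFin \o f) < +oo.

(* The smallest K in [0, +oo] such that N (riesz f) <= K * ||f|| for all f in
   L^p(v), where N is the quasi-norm of the target space. *)
Definition riesz_norm (alpha p : R) v (N : (E -> \bar R) -> \bar R) : \bar R :=
  ereal_inf [set K | 0 <= K /\ forall f, in_Lp p v f ->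
    N (riesz alpha f) <= K * strong_norm p v (EFin \o f)].

Definition Phi (t : \bar R) : \bar R := 1 + lne t.

End definitions.

(* Main.v *)
From HB Require Import structures.
Require Import Defs.
From mathcomp Require Import all_boot all_order all_algebra.
From mathcomp Require Import all_classical all_reals all_analysis.
From mathcomp Require Import measurable_realfun.
From mathcomp Require Import ring lra.

Set Implicit Arguments.
Unset Strict Implicit.
Unset Printing Implicit Defensive.

Import Order.TTheory GRing.Theory Num.Theory.
Import numFieldNormedType.Exports.

Local Open Scope ring_scope.

(** Write v = w^q, sigma = w^-p', a = alpha/n and r = p', so that
    1 - a = 1/q + 1/r, and let A_Q denote A_(1+q/r)(v, Q).

    Reduction to a finite problem.  Any two points lie in a dyadic cube of size
    comparable to their distance, in one of 2^n grids that depend only on the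
    scale of truncation ([common_cube]).  Hence the kernel |x-y|^(alpha-n) is at
    most a constant times a sum over 2^n grids of finite dyadic kernels
    ([kernel_le], [potential_le]), and by the lemma of Fatou it suffices to bound,
    uniformly in the truncation, the operators
      T f = sum_P |P|^(a-1) (int_P f) 1_P,
    where P runs over the finitely many cubes of one truncated grid.  These live on a
    finite set, the set of smallest cubes, and all that is used of the cubes is
    that they form a laminar family in which volumes at least double from a
    cube to a strictly larger one.

    Testing, and the origin of the logarithm ([testing]).  Let T_Q and M_Q be the
    operator and the maximal function restricted to the cubes inside Q.  Splitting the
    sum at the right scale gives T_Q v <= C v(Q)^a (M_Q v)^(1-a) ([hedberg]); as
    (1-a) r = 1 + r/q, one has to bound the integral of (M_Q v)^(1+r/q)
    against sigma.  Sort the cubes by the integer part k of log A_P.  The identity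
    <v>_P^(r/q) sigma(P) = A_P^(r/q) |P| replaces sigma by Lebesgue measure at
    the price of a factor e^(kr/q), which is A_G^(r/q) up to a constant for every
    maximal cube G of level k.  Thus the cubes of level k inside G contribute at
    most C A_G^(r/q) int_G M(v 1_G) <= C B^r v(G), where B is the mixed constant.
    The maximal cubes of one level are disjoint, and there are at most
    1 + log [v] levels.

    From testing to norms.  A good-lambda argument on the level sets of T f gives
    the weak type bound from the testing condition above ([weak_type]).  For
    the strong type bound, dualise and split the cubes P according to which of
    <f>_P^p sigma(P) and <g>_P^(q') v(P) is larger; each half is controlled by one of the
    two testing conditions through the principal cubes of the larger function
    ([upper_bound], [strong_type]).  The second testing condition is the first one
    for the weight sigma, with q and r exchanged.

    Degenerate weights.  If w^q is in A_s then w vanishes almost everywhere, in which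
    case the target norms are zero, or is positive almost everywhere
    ([weight_dichotomy]). *)


(** * Geometric sums and principal sets of a laminar family *)

Lemma le_of_eq d (T : porderType d) (x y : T) : x = y -> (x <= y)%O.
Proof. by move=> ->. Qed.

Section numeric.
Context {R : realType}.
Implicit Types (x y s M : R).

Lemma powR_le x y s : 0 <= s -> 0 <= x -> x <= y -> x `^ s <= y `^ s.
Proof.
move=> s0 x0 xy; apply: ge0_ler_powR => //; rewrite nnegrE//.
exact: le_trans xy.
Qed.

(** The sum of the geometric series of ratio 2^-s. *)
Definition geo (s : R) : R := (1 - 2 `^ (- s))^-1.

Lemma geo_gt0 s : 0 < s -> 0 < geo s.
Proof.
move=> s0; rewrite /geo invr_gt0 subr_gt0 powRN invf_lt1 ?powR_gt0//.
have : 1 `^ s < 2 `^ s by apply: gt0_ltr_powR; rewrite ?nnegrE; lra.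
by rewrite powR1.
Qed.

(** Numbers in ]0, M] that are separated by factors of 2 are at most M, M/2, M/4
    and so on, so that their powers are dominated by a geometric series. *)
Lemma sum_separated (I : finType) (X : {set I}) (y : I -> R) M s : 0 < s ->
  (forall i, i \in X -> 0 < y i <= M) ->
  (forall i j, i \in X -> j \in X -> i != j -> 2 * y i <= y j \/ 2 * y j <= y i) ->
  0 <= M -> \sum_(i in X) y i `^ s <= geo s * M `^ s.
Proof.
move=> s0; have g0 := geo_gt0 s0.
have [k] := ubnP #|X|; elim: k => // k IH in X M * => Xk yM sep M0.
have [->|[i0 i0X]] := set_0Vmem X.
  by rewrite big_set0 mulr_ge0 ?powR_ge0// ltW.
case: (@Order.TotalTheory.arg_maxP _ _ I i0 (mem X) y i0X) => i iX' imax.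
have iX : i \in X by exact: iX'.
rewrite (big_setD1 i)//=.
have {}IH : \sum_(j in X :\ i) y j `^ s <= geo s * (M / 2) `^ s.
  apply: IH.
  - by move: Xk; rewrite (cardsD1 i) iX.
  - move=> j; rewrite !inE => /andP[ji jX].
    have /andP[yj0 _] := yM _ jX; have /andP[_ yiM] := yM _ iX.
    have jmax : y j <= y i by exact: imax.
    by rewrite yj0/=; have [] := sep _ _ jX iX ji; lra.
  - by move=> a b; rewrite !inE => /andP[_ ?] /andP[_ ?]; exact: sep.
  - by lra.
apply: le_trans (lerD (lexx _) IH) _.
have /andP[yi0 yiM] := yM _ iX.
apply: le_trans (lerD (powR_le (ltW s0) (ltW yi0) yiM) (lexx _)) _.
rewrite powRM ?invr_ge0// -powR_inv1// -powRrM mulN1r.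
have e : geo s * 2 `^ (- s) = geo s - 1.
  rewrite /geo; field.
  by apply: lt0r_neq0; rewrite -invr_gt0; exact: g0.
suff -> : geo s * (M `^ s * 2 `^ (- s)) = geo s * M `^ s - M `^ s by lra.
by rewrite mulrCA mulrA -mulrA e mulrBr mulr1 mulrC.
Qed.

End numeric.

Section laminar_families.
Context {R : realType} {T : finType}.
Implicit Types (m : T -> R) (P Q F G : {set T}) (D : {set {set T}}) (phi : {set T} -> R).

Definition mass m P : R := \sum_(x in P) m x.

Definition laminar D := forall P Q x, P \in D -> Q \in D ->
  x \in P -> x \in Q -> P \subset Q \/ Q \subset P.

Lemma laminar_sub D D' : D' \subset D -> laminar D -> laminar D'.
Proof. by move=> /fintype.subsetP D'D lD P Q x /D'D ? /D'D ?; exact: lD. Qed.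

(** Principal sets are selected with the factor e instead of the usual factor 2, so
    that comparing values up to this factor becomes comparing integers. *)
Definition level phi P : int := Num.floor (ln (phi P)).

(** The usual stopping-time cubes, without recursion: the level of a principal set
    exceeds that of all its supersets. *)
Definition principal phi D : {set {set T}} :=
  [set F in D | [forall G in D, (F \proper G) ==> (level phi G < level phi F)]].

(** P is charged to F.  This is a relation rather than a function because the sums
    over all F only enter through upper bounds. *)
Definition stopped phi D P F :=
  [&& F \in principal phi D, P \subset F &
      [forall G in D, (P \subset G) ==> (level phi G <= level phi F)]].

Lemma principalP phi D F : reflect
  (F \in D /\ forall G, G \in D -> F \proper G -> level phi G < level phi F)
  (F \in principal phi D).
Proof.
rewrite inE; apply: (iffP andP) => -[FD]; split=> //.
  by move=> G GD FG; move/forallP/(_ G)/implyP/(_ GD)/implyP: b; exact.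
by apply/forallP => G; apply/implyP => GD; apply/implyP => FG; exact: b.
Qed.

Lemma principal_sub phi D : principal phi D \subset D.
Proof. by apply/fintype.subsetP => F /principalP[]. Qed.

(** Among the sets containing P of greatest level, one of greatest
    cardinality is principal. *)
Lemma stopped_exists phi D P : P \in D -> exists F, stopped phi D P F.
Proof.
move=> PD.
pose A := [set G in D | P \subset G].
have PA : P \in A by rewrite inE PD subxx.
case: (@Order.TotalTheory.arg_maxP _ _ _ P (mem A) (level phi) PA) => H HA0 Hmax.
have HA : H \in A by exact: HA0.
pose A' := [set G in A | level phi G == level phi H].
have HA' : H \in A' by rewrite inE HA eqxx.
case: (@arg_maxnP _ H (mem A') (fun G => #|G|) HA') => F FA0 Fmax.
have FA' : F \in A' by exact: FA0.
have /[!inE]/andP[/andP[FD PF] /eqP levF] := FA'.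
exists F; apply/and3P; split => //.
  apply/principalP; split => // G GD FG.
  have GA : G \in A by rewrite inE GD (fintype.subset_trans PF)// proper_sub.
  have GH : level phi G <= level phi H by exact: Hmax.
  rewrite levF lt_neqAle GH andbT; apply: contraTN (proper_card FG) => e.
  by rewrite -leqNgt; apply: Fmax; rewrite /= inE GA.
apply/forallP => G; apply/implyP => GD; apply/implyP => PG.
have GA : G \in A by rewrite inE GD.
by rewrite levF; exact: Hmax.
Qed.

Lemma level_bounds phi P : 0 < phi P ->
  expR (level phi P)%:~R <= phi P < expR 1 * expR (level phi P)%:~R.
Proof.
move=> p0; have /andP[h1 h2] := floor_itv (ln (phi P)).
rewrite -expRD -{1 2}(lnK p0) ler_expR ltr_expR /level h1/= addrC.
by move: h2; rewrite intrD.
Qed.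

Lemma expR1_ge2 : 2 <= expR 1 :> R.
Proof. by have := @expR_ge1Dx R 1; lra. Qed.

Lemma stopped_le phi D P F : P \in D -> (forall G, G \in D -> 0 < phi G) ->
  stopped phi D P F -> phi P <= expR 1 * phi F.
Proof.
move=> PD p0 /and3P[/principalP[FD _] _ /forallP/(_ P)].
rewrite PD subxx/= => PF.
have /andP[_ /ltW h1] := level_bounds (p0 _ PD).
have /andP[h2 _] := level_bounds (p0 _ FD).
apply: le_trans h1 _; rewrite ler_pM2l ?expR_gt0//; apply: le_trans h2.
by rewrite ler_expR ler_int.
Qed.

Lemma principal_level_neq phi D F G x : laminar D -> F \in principal phi D ->
  G \in principal phi D -> x \in F -> x \in G -> F != G -> level phi F != level phi G.
Proof.
move=> lD /principalP[FD Fp] /principalP[GD Gp] xF xG FG.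
have [FsG|GsF] := lD _ _ _ FD GD xF xG.
  by rewrite gt_eqF// Fp// finset.properEneq FG.
by rewrite lt_eqF// Gp// finset.properEneq eq_sym FG.
Qed.

(** The principal sets through x form a chain on which the levels are distinct. *)
Lemma principal_sum phi D x s M : laminar D -> (forall G, G \in D -> 0 < phi G) ->
  0 < s -> 0 <= M -> (forall G, G \in D -> x \in G -> phi G <= M) ->
  \sum_(F in principal phi D | x \in F) phi F `^ s <=
    expR 1 `^ s * geo s * M `^ s.
Proof.
move=> lD p0 s0 M0 pM.
pose X := [set F in principal phi D | x \in F].
have Xin F : (F \in X) = (F \in principal phi D) && (x \in F) by rewrite inE.
rewrite -(eq_bigl _ _ Xin).
have XD F : F \in X -> F \in D.
  by rewrite Xin => /andP[/(fintype.subsetP (principal_sub _ _))].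
pose y F := expR (level phi F)%:~R : R.
apply: (@le_trans _ _ (\sum_(F in X) expR 1 `^ s * y F `^ s)).
  apply: ler_sum => F /XD FD; have /andP[_ /ltW h] := level_bounds (p0 _ FD).
  by rewrite -powRM ?expR_ge0//; apply: powR_le => //; apply/ltW => //; exact: p0.
rewrite -big_distrr/= -mulrA ler_pM2l ?powR_gt0 ?expR_gt0//.
apply: sum_separated => //.
  move=> F FX; rewrite expR_gt0/=; have FD := XD _ FX.
  have /andP[h _] := level_bounds (p0 _ FD); apply: le_trans h _; apply: pM => //.
  by move: FX; rewrite Xin => /andP[].
move=> F G; rewrite !Xin => /andP[Fp xF] /andP[Gp xG] FG.
have sep (a b : int) : a < b -> 2 * expR a%:~R <= expR b%:~R :> R.
  move=> ab; apply: (@le_trans _ _ (expR 1 * expR a%:~R)).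
    by rewrite ler_pM2r ?expR_gt0// expR1_ge2.
  by rewrite -expRD ler_expR -[1]/(1%:~R) -intrD ler_int addrC lezD1.
have := principal_level_neq lD Fp Gp xF xG FG.
by rewrite neq_lt => /orP[|] /sep; [left|right].
Qed.

Lemma sum_mass (D : {set {set T}}) (c : {set T} -> R) m :
  \sum_(P in D) c P * mass m P = \sum_x m x * \sum_(P in D | x \in P) c P.
Proof.
under eq_bigr => P _ do rewrite /mass big_distrr/=.
under [RHS]eq_bigr => x _ do rewrite big_distrr/=.
rewrite (exchange_big_dep predT)//=; apply: eq_bigr => x _.
by apply: eq_bigr => P _; rewrite mulrC.
Qed.

End laminar_families.

(** * Dyadic maximal function and Carleson embedding *)

Section numeric.
Context {R : realType}.
Implicit Types (x y s M a b p r eps : R).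

(** The parameter allows to absorb the second term. *)
Lemma young_eps a b p r eps : 0 <= a -> 0 <= b -> 1 < p -> 1 < r ->
  p^-1 + r^-1 = 1 -> 0 < eps ->
  a * b <= eps `^ (- p) * a `^ p + eps `^ r * b `^ r.
Proof.
move=> a0 b0 p1 r1 pr e0.
have -> : a * b = (eps^-1 * a) * (eps * b) by field; exact: lt0r_neq0.
have ei : 0 <= eps^-1 by rewrite invr_ge0 ltW.
have := @conjugate_powR _ (eps^-1 * a) (eps * b) p r.
move=> /(_ (mulr_ge0 ei a0) (mulr_ge0 (ltW e0) b0)).
move=> /(_ ltac:(lra) ltac:(lra) pr) /le_trans; apply.
rewrite !powRM ?(ltW e0)//.
have le1 (c t : R) : 0 <= c -> 1 < t -> c / t <= c.
  move=> c0 t1; rewrite ler_pdivrMr; last by lra.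
  by rewrite ler_peMr// ltW.
rewrite -[X in X `^ p * _]powR_inv1 ?(ltW e0)// -powRrM mulN1r.
by apply: lerD; apply: le1 => //; rewrite mulr_ge0 ?powR_ge0.
Qed.

Lemma powRD_gt0 x s t : 0 < x -> x `^ (s + t) = x `^ s * x `^ t.
Proof. by move=> x0; rewrite powRD// (gt_eqF x0) implybT. Qed.

End numeric.

Section maximal_function.
Context {R : realType} {T : finType}.
Implicit Types (m mu sg f : T -> R) (P Q F G : {set T}) (D : {set {set T}}).
Implicit Types (phi : {set T} -> R).

Definition dmax phi D x : R := \big[Num.max/0]_(P in D | x \in P) phi P.

Lemma dmax_ge0 phi D x : 0 <= dmax phi D x.
Proof.
rewrite /dmax; elim/big_rec: _ => // P y _ y0.
by rewrite le_max y0 orbT.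
Qed.

Lemma le_dmax phi D x P : P \in D -> x \in P -> phi P <= dmax phi D x.
Proof.
by move=> PD xP; rewrite /dmax (bigD1 P) ?PD//= le_max lexx.
Qed.

Lemma dmax_le phi D x M : 0 <= M -> (forall P, P \in D -> x \in P -> phi P <= M) ->
  dmax phi D x <= M.
Proof.
move=> M0 h; rewrite /dmax; elim/big_ind: _ => //.
  by move=> a b a0 b0; rewrite ge_max a0.
by move=> P /andP[? ?]; exact: h.
Qed.

Lemma dmax_attained phi D x : dmax phi D x = 0 \/
  exists P, [/\ P \in D, x \in P & dmax phi D x = phi P].
Proof.
rewrite /dmax; elim/big_ind: _ => [|a b Ha Hb|P /andP[PD xP]].
- by left.
- by rewrite /Num.max; case: ifP.
- by right; exists P.
Qed.

(** The maximal value is attained at some set, and is at most e times the value at the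
    principal set to which that set is charged. *)
Lemma dmax_pow_le phi D x s : (forall G, G \in D -> 0 < phi G) -> 0 < s ->
  dmax phi D x `^ s <=
    expR 1 `^ s * \sum_(F in principal phi D | x \in F) phi F `^ s.
Proof.
move=> p0 s0; have [->|[P [PD xP ->]]] := dmax_attained phi D x.
  rewrite powR0 ?gt_eqF// mulr_ge0 ?powR_ge0// sumr_ge0// => F _.
  exact: powR_ge0.
have [F sF] := stopped_exists phi PD.
have := stopped_le PD p0 sF.
move/(powR_le (ltW s0) (ltW (p0 _ PD))) => /le_trans; apply.
have /and3P[Fp PF _] := sF.
have FD : F \in D by apply: (fintype.subsetP (principal_sub phi D)).
rewrite powRM ?expR_ge0 ?(ltW (p0 _ FD))// ler_pM2l ?powR_gt0 ?expR_gt0//.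
rewrite (bigD1 F)/=; last by rewrite Fp; exact: (fintype.subsetP PF).
by rewrite lerDl sumr_ge0// => G _; exact: powR_ge0.
Qed.

Lemma principal_sum_dmax phi D x s : laminar D -> (forall G, G \in D -> 0 < phi G) ->
  0 < s -> \sum_(F in principal phi D | x \in F) phi F `^ s <=
    expR 1 `^ s * geo s * dmax phi D x `^ s.
Proof.
move=> lD p0 s0; apply: principal_sum => //; first exact: dmax_ge0.
by move=> G GD xG; exact: le_dmax.
Qed.

Definition dmax_const (rho : R) := expR 1 `^ (1 + rho) * (expR 1 `^ 1 * geo 1).

(** Through the principal sets, (M phi)^(1+rho) splits into M phi and
    phi^rho, and the latter turns sg into mu one set at a time. *)
Lemma sum_dmax_le phi D mu sg rho K : laminar D ->
  (forall G, G \in D -> 0 < phi G) -> 0 < rho -> 0 <= K ->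
  (forall x, 0 <= mu x) -> (forall x, 0 <= sg x) ->
  (forall P, P \in D -> phi P `^ rho * mass sg P <= K * mass mu P) ->
  \sum_x sg x * dmax phi D x `^ (1 + rho) <=
    dmax_const rho * K * \sum_x mu x * dmax phi D x.
Proof.
move=> lD p0 rho0 K0 mu0 sg0 h.
have s0 : 0 < 1 + rho by lra.
apply: (@le_trans _ _ (expR 1 `^ (1 + rho) *
    \sum_(F in principal phi D) phi F `^ (1 + rho) * mass sg F)).
  rewrite sum_mass big_distrr/=; apply: ler_sum => x _.
  rewrite mulrCA ler_wpM2l//; exact: dmax_pow_le.
rewrite /dmax_const -!mulrA ler_pM2l ?powR_gt0 ?expR_gt0//.
apply: (@le_trans _ _ (K * \sum_(F in principal phi D) phi F `^ 1 * mass mu F)).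
  rewrite big_distrr/=; apply: ler_sum => F /(fintype.subsetP (principal_sub _ _)) FD.
  rewrite powRD_gt0 ?p0// -mulrA [leRHS]mulrCA ler_wpM2l ?powR_ge0//; exact: h.
rewrite sum_mass.
rewrite (_ : expR 1 `^ 1 * (geo 1 * _) = K * (expR 1 `^ 1 * (geo 1 *
  (\sum_x mu x * dmax phi D x)))); last by ring.
rewrite ler_wpM2l// mulrA big_distrr/=; apply: ler_sum => x _.
rewrite mulrCA ler_wpM2l//; apply: le_trans (principal_sum_dmax _ lD p0 ltr01) _.
by rewrite (powRr1 (dmax_ge0 _ _ _)).
Qed.

Definition density f sg P := mass (fun x => f x * sg x) P / mass sg P.

(** [carleson_pre] comes from [principal_sum_dmax]; [carleson_eps] is the parameter
    for which the absorbed term of [young_eps] gets the factor 1/2. *)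
Definition carleson_pre (p : R) : R := expR 1 `^ (p - 1) * geo (p - 1).
Definition carleson_eps (p : R) : R :=
  (2 * carleson_pre p * expR 1 `^ p) `^ (- (1 - p^-1)).
Definition carleson_const (p : R) : R := 2 * (carleson_pre p * carleson_eps p `^ (- p)).

(** With phi = <f>, the left-hand side X is the sum of phi(F)^(p-1) int_F f sg, hence
    at most a constant times int f (M phi)^(p-1) sg by [principal_sum_dmax]; the Young
    inequality bounds this by int f^p sg plus a small multiple of
    int (M phi)^p sg, which is itself at most a multiple of X. *)
Lemma carleson f sg D p : laminar D -> (forall x, 0 <= f x) ->
  (forall x, 0 <= sg x) -> (forall P, P \in D -> 0 < mass sg P) ->
  (forall P, P \in D -> 0 < density f sg P) -> 1 < p ->
  \sum_(F in principal (density f sg) D) density f sg F `^ p * mass sg F <=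
    carleson_const p * \sum_x f x `^ p * sg x.
Proof.
move=> lD f0 sg0 msg0 p0 p1; set phi := density f sg; set X := \sum_(F in _) _.
have pm0 : 0 < p - 1 by lra.
have carle0 : 0 < carleson_pre p by rewrite /carleson_pre mulr_gt0 ?powR_gt0 ?expR_gt0 ?geo_gt0.
have ep0 : 0 < expR 1 `^ p :> R by apply: powR_gt0; exact: expR_gt0.
have b0 : 0 < 2 * carleson_pre p * expR 1 `^ p by rewrite mulr_gt0// mulr_gt0.
have eps0 : 0 < carleson_eps p by rewrite /carleson_eps powR_gt0.
set r := p / (p - 1).
have r1 : 1 < r by rewrite /r ltr_pdivlMr//; lra.
have pr : p^-1 + r^-1 = 1 by rewrite /r; field; apply/andP; split; lra.
have pr1 : (p - 1) * r = p by rewrite /r; field; rewrite gt_eqF.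
have epsr : carleson_pre p * expR 1 `^ p * carleson_eps p `^ r = 2^-1.
  rewrite /carleson_eps -powRrM.
  have -> : - (1 - p^-1) * r = -1 by rewrite /r; field; apply/andP; split; lra.
  rewrite powR_inv1 ?(ltW b0)//; field.
  by apply/andP; split; exact: lt0r_neq0.
set Y := \sum_(F in principal phi D) phi F `^ (p - 1) *
  mass (fun x => f x * sg x) F.
have XY : X = Y.
  apply: eq_bigr => F /(fintype.subsetP (principal_sub _ _)) FD.
  rewrite -{1}(subrK 1 p) powRD_gt0 ?p0// powRr1 ?(ltW (p0 _ FD))//.
  by rewrite -mulrA; congr (_ * _); rewrite /phi /density divfK// lt0r_neq0// msg0.
set Nf := \sum_x _.
rewrite XY; suff : Y <= carleson_pre p * carleson_eps p `^ (- p) * Nf + 2^-1 * Y.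
  by rewrite /carleson_const => h; lra.
rewrite {1}/Y sum_mass.
have mxX : \sum_x sg x * dmax phi D x `^ p <= expR 1 `^ p * Y.
  rewrite -XY /X sum_mass big_distrr/=; apply: ler_sum => x _.
  by rewrite mulrCA ler_wpM2l//; apply: dmax_pow_le => //; lra.
apply: (@le_trans _ _ (\sum_x carleson_pre p * (carleson_eps p `^ (- p) * (f x `^ p * sg x)
    + carleson_eps p `^ r * (sg x * dmax phi D x `^ p)))).
  apply: ler_sum => x _.
  have h := @young_eps _ (f x) (dmax phi D x `^ (p - 1)) p r _ (f0 x)
    (powR_ge0 _ _) p1 r1 pr eps0.
  have e : (dmax phi D x `^ (p - 1)) `^ r = dmax phi D x `^ p.
    by rewrite -powRrM pr1.
  rewrite e in h.
  have h2 := principal_sum_dmax x lD p0 pm0.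
  apply: (@le_trans _ _ (sg x * carleson_pre p * (f x * dmax phi D x `^ (p - 1)))).
    rewrite (_ : sg x * carleson_pre p * _ = f x * sg x * (carleson_pre p * dmax phi D x `^ (p - 1))).
      by rewrite ler_wpM2l ?mulr_ge0.
    by ring.
  rewrite (_ : carleson_pre p * _ = sg x * carleson_pre p * (carleson_eps p `^ (- p) * f x `^ p +
      carleson_eps p `^ r * dmax phi D x `^ p)); last by ring.
  by rewrite ler_wpM2l// mulr_ge0// ltW.
rewrite -big_distrr/= big_split/= -!big_distrr/= -/Nf mulrDr mulrA lerD2l.
apply: (@le_trans _ _ (carleson_pre p * (carleson_eps p `^ r * (expR 1 `^ p * Y)))).
  by rewrite ler_pM2l// ler_pM2l ?powR_gt0.
rewrite -epsr; apply: le_of_eq; ring.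
Qed.

End maximal_function.

Lemma carleson_const_gt0 (R : realType) (p : R) : 1 < p -> 0 < carleson_const p.
Proof.
move=> p1; have p0 : 0 < p - 1 by rewrite subr_gt0.
have h : 0 < carleson_pre p by rewrite /carleson_pre mulr_gt0 ?powR_gt0 ?expR_gt0 ?geo_gt0.
rewrite /carleson_const mulr_gt0// mulr_gt0// powR_gt0// /carleson_eps powR_gt0//.
by rewrite mulr_gt0 ?powR_gt0 ?expR_gt0// mulr_gt0.
Qed.

(** * The finite model operator and the inequality of Hedberg *)

Section tops.
Context {R : realType} {T : finType}.
Implicit Types (P Q F G : {set T}) (D : {set {set T}}).

Definition tops D := [set G in D | [forall H in D, ~~ (G \proper H)]].

Lemma topsP D G : reflect (G \in D /\ forall H, H \in D -> ~~ (G \proper H))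
  (G \in tops D).
Proof.
rewrite inE; apply: (iffP andP) => -[GD]; split=> //.
  by move=> H HD; move/forallP/(_ H)/implyP: b; exact.
by apply/forallP => H; apply/implyP => HD; exact: b.
Qed.

Lemma tops_sub D G : G \in tops D -> G \in D.
Proof. by case/topsP. Qed.

Lemma tops_exists D P : P \in D -> exists2 G, G \in tops D & P \subset G.
Proof.
move=> PD; pose A := [set G in D | P \subset G].
have PA : P \in A by rewrite inE PD subxx.
case: (@arg_maxnP _ P (mem A) (fun G => #|G|) PA) => G GA0 Gmax.
have /[!inE]/andP[GD PG] : G \in A by exact: GA0.
exists G => //; apply/topsP; split => // H HD; apply/negP => GH.
have HA : H \in A by rewrite inE HD (fintype.subset_trans PG)// proper_sub.
have : (#|H| <= #|G|)%N by exact: Gmax.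
by rewrite leqNgt (proper_card GH).
Qed.

Lemma tops_eq D G H x : laminar D -> G \in tops D -> H \in tops D ->
  x \in G -> x \in H -> G = H.
Proof.
move=> lD /topsP[GD Gp] /topsP[HD Hp] xG xH; apply/eqP/negPn/negP => GH.
have [GsH|HsG] := lD _ _ _ GD HD xG xH.
  by have := Gp _ HD; rewrite finset.properEneq GH GsH.
by have := Hp _ GD; rewrite finset.properEneq eq_sym GH HsG.
Qed.

Lemma tops_sum D (F : T -> R) : laminar D ->
  \sum_(G in tops D) \sum_(x in G) F x = \sum_(x in finset.cover D) F x.
Proof.
move=> lD; have -> : finset.cover D = finset.cover (tops D).
  apply/setP => x; apply/finset.bigcupP/finset.bigcupP => -[P PD xP].
    have [G Gt PG] := tops_exists PD; exists G => //.
    exact: (fintype.subsetP PG).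
  by exists P => //; exact: tops_sub.
rewrite finset.big_trivIset//; apply/finset.trivIsetP => A B At Bt AB.
rewrite -finset.setI_eq0; apply/eqP/setP => x; rewrite !inE; apply/negbTE/negP.
by move=> /andP[xA xB]; move/eqP: AB; apply; exact: (tops_eq lD At Bt xA xB).
Qed.

End tops.

Section operators.
Context {R : realType} {T : finType}.
Implicit Types (m mu sg v h : T -> R) (P Q F G : {set T}) (D S : {set {set T}}).

Definition below S Q := [set P in S | P \subset Q].

Lemma below_sub S Q P : P \in below S Q -> P \in S /\ P \subset Q.
Proof. by rewrite inE => /andP. Qed.

Lemma laminar_below S Q : laminar S -> laminar (below S Q).
Proof. by apply: laminar_sub; apply/fintype.subsetP => P /below_sub[]. Qed.

Definition doubling mu S := forall P Q, P \in S -> Q \in S -> P \proper Q ->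
  2 * mass mu P <= mass mu Q.

Definition dyadic_op S (t : {set T} -> R) h x : R :=
  \sum_(P in S | x \in P) t P * mass h P.

(** The coefficients of the dyadic Riesz potential of order a times the
    dimension. *)
Definition riesz_coef a mu P : R := mass mu P `^ (a - 1).

Definition mean_val mu h P := mass h P / mass mu P.

Lemma mass_ge0 m P : (forall x, 0 <= m x) -> 0 <= mass m P.
Proof. by move=> m0; exact: sumr_ge0. Qed.

Lemma mass_gt0 m P x : (forall x, 0 < m x) -> x \in P -> 0 < mass m P.
Proof.
move=> m0 xP; rewrite /mass (bigD1 x)//= ltr_pwDl// sumr_ge0// => y _.
exact: ltW.
Qed.

Lemma mass_le m P Q : (forall x, 0 <= m x) -> P \subset Q ->
  mass m P <= mass m Q.
Proof.
move=> m0 PQ; rewrite /mass [leRHS](big_setID P)/=.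
by rewrite (finset.setIidPr PQ) lerDl sumr_ge0.
Qed.

Definition hedberg_const (a : R) := geo a + geo (1 - a).

(** The chain of sets P through x is cut at mu(P) = s = v(Q) / M v(x).  Below s use
    v(P) <= M v(x) mu(P), above s use v(P) <= v(Q); both sums are geometric since
    mu doubles along the chain, and s balances them. *)
Lemma hedberg S a mu v Q x : laminar S -> doubling mu S ->
  (forall x, 0 < mu x) -> (forall x, 0 < v x) -> 0 < a < 1 ->
  dyadic_op (below S Q) (riesz_coef a mu) v x <=
   hedberg_const a * (mass v Q `^ a * dmax (mean_val mu v) (below S Q) x `^ (1 - a)).
Proof.
move=> lS dS mu0 v0 /andP[a0 a1].
have mu0' y : 0 <= mu y by exact: ltW.
have v0' y : 0 <= v y by exact: ltW.
have b0 : 0 < 1 - a by lra.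
have hc0 : 0 <= hedberg_const a by rewrite addr_ge0// ltW// geo_gt0.
pose X := [set P in below S Q | x \in P].
have [X0|[P0]] := set_0Vmem X.
  rewrite /dyadic_op /riesz_coef big1 ?mulr_ge0 ?powR_ge0// => P PX.
  have : P \in X by rewrite inE.
  by rewrite X0 inE.
rewrite inE => /andP[P0S xP0].
have Xin P : P \in X -> [/\ P \in S, P \subset Q & x \in P].
  by rewrite inE => /andP[/below_sub[]].
have [P0S' P0Q] := below_sub P0S.
set M := dmax _ _ _; set V := mass v Q.
have V0 : 0 < V by apply: (mass_gt0 v0 (fintype.subsetP P0Q _ xP0)).
have M0 : 0 < M.
  apply: lt_le_trans (le_dmax _ P0S xP0).
  by rewrite divr_gt0//; apply: mass_gt0 xP0.
pose s := V / M; have s0 : 0 < s by rewrite divr_gt0.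
have mP0 P : P \in X -> 0 < mass mu P.
  by case/Xin => _ _; exact: mass_gt0.
have sep P P' : P \in X -> P' \in X -> P != P' ->
    2 * mass mu P <= mass mu P' \/ 2 * mass mu P' <= mass mu P.
  move=> /Xin[PS _ xP] /Xin[P'S _ xP'] PP'.
  have [h|h] := lS _ _ _ PS P'S xP xP'; [left|right]; apply: dS => //.
    by rewrite finset.properEneq PP'.
  by rewrite finset.properEneq eq_sym PP'.
rewrite /dyadic_op /riesz_coef (eq_bigl (fun P => P \in X)); last by move=> P; rewrite !inE.
rewrite (big_setID [set P | mass mu P <= s])/= /hedberg_const mulrDl; apply: lerD.
  apply: (@le_trans _ _ (\sum_(P in X :&: [set P | mass mu P <= s])
      M * mass mu P `^ a)).
    apply: ler_sum => P; rewrite finset.in_setI => /andP[PX _].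
    have [PS PQ xP] := Xin _ PX.
    have h : mass v P <= M * mass mu P.
      rewrite -ler_pdivrMr ?mP0//; apply: (@le_dmax _ _ (mean_val mu v)) => //.
      by rewrite inE PS.
    rewrite mulrC; apply: le_trans (ler_wpM2r (powR_ge0 _ _) h) _.
    rewrite -mulrA ler_pM2l// -{1}(powRr1 (ltW (mP0 _ PX))) -powRD_gt0 ?mP0//.
    by rewrite addrCA subrr addr0.
  rewrite -big_distrr/=.
  have h : \sum_(P in X :&: [set P | mass mu P <= s]) mass mu P `^ a
      <= geo a * s `^ a.
    apply: sum_separated => //; last exact: ltW.
      by move=> P; rewrite finset.in_setI => /andP[PX]; rewrite inE mP0.
    by move=> P P'; rewrite !finset.in_setI => /andP[PX _] /andP[PX' _]; exact: sep.
  apply: le_trans (ler_wpM2l (ltW M0) h) _.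
  rewrite mulrCA ler_pM2l ?geo_gt0// /s.
  rewrite powRM; [|exact: ltW|by rewrite invr_ge0 ltW].
  rewrite -(powR_inv1 (ltW M0)) -powRrM mulN1r (powRD_gt0 _ _ M0).
  by rewrite (powRr1 (ltW M0)) mulrCA.
apply: (@le_trans _ _ (\sum_(P in X :\: [set P | mass mu P <= s])
    V * (mass mu P)^-1 `^ (1 - a))).
  apply: ler_sum => P; rewrite finset.in_setD => /andP[_ PX].
  have [PS PQ xP] := Xin _ PX.
  rewrite -powR_inv1 ?(ltW (mP0 _ PX))// -powRrM mulrC.
  have -> : -1 * (1 - a) = a - 1 by ring.
  by rewrite ler_wpM2r ?powR_ge0//; exact: mass_le.
rewrite -big_distrr/=.
have h : \sum_(P in X :\: [set P | mass mu P <= s]) (mass mu P)^-1 `^ (1 - a)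
    <= geo (1 - a) * s^-1 `^ (1 - a).
  apply: sum_separated => //.
  - move=> P; rewrite finset.in_setD inE -ltNge => /andP[sP PX].
    by rewrite invr_gt0 mP0//= lef_pV2 ?posrE ?mP0// ltW.
  - move=> P P'; rewrite !finset.in_setD => /andP[_ PX] /andP[_ PX'] PP'.
    have i2 A B : A \in X -> B \in X -> 2 * mass mu A <= mass mu B ->
        2 * (mass mu B)^-1 <= (mass mu A)^-1.
      move=> AX BX AB.
      by rewrite ler_pdivrMr ?mP0// mulrC ler_pdivlMr ?mP0.
    by have [/i2|/i2] := sep _ _ PX PX' PP'; [right|left]; auto.
  - by rewrite invr_ge0 ltW.
apply: le_trans (ler_wpM2l (ltW V0) h) _.
rewrite mulrCA ler_pM2l ?geo_gt0// /s invf_div.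
rewrite powRM; [|exact: ltW|by rewrite invr_ge0 ltW].
rewrite -(powR_inv1 (ltW V0)) -powRrM mulrCA mulrC -{1}(powRr1 (ltW V0)).
by rewrite -powRD_gt0//; have -> : 1 + -1 * (1 - a) = a by ring.
Qed.

End operators.

(** * Testing condition with the logarithm *)

Section testing.
Context {R : realType} {T : finType}.
Variables (mu sg v : T -> R) (S : {set {set T}}) (a q r Ab Br : R).
Hypotheses (lS : laminar S) (dS : doubling mu S).
Hypotheses (mu0 : forall x, 0 < mu x) (sg0 : forall x, 0 < sg x).
Hypotheses (v0 : forall x, 0 < v x) (S0 : forall P, P \in S -> exists x, x \in P).
Hypotheses (a01 : 0 < a < 1) (q0 : 0 < q) (r0 : 0 < r).
Hypothesis (aqr : 1 - a = q^-1 + r^-1).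

(** The quantity A_(1+q/r)(v, P) when sg is the dual weight of v. *)
Definition muckenhoupt P : R := mean_val mu v P * mean_val mu sg P `^ (q / r).

Hypothesis (muckA : forall P, P \in S -> 1 <= muckenhoupt P <= Ab).
Hypothesis (muckB : forall P, P \in S -> muckenhoupt P `^ (r / q) *
  (\sum_(x in P) mu x * dmax (mean_val mu v) (below S P) x) <= Br * mass v P).

Let mu0' x : 0 <= mu x. Proof. exact: ltW. Qed.
Let sg0' x : 0 <= sg x. Proof. exact: ltW. Qed.
Let v0' x : 0 <= v x. Proof. exact: ltW. Qed.
Let rho := r / q.
Let rho0 : 0 < rho. Proof. exact: divr_gt0. Qed.
Let phi := mean_val mu v.

Let mass0 (m : T -> R) P : (forall x, 0 < m x) -> P \in S -> 0 < mass m P.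
Proof. by move=> m0 /S0[x]; exact: mass_gt0. Qed.

Let phi0 P : P \in S -> 0 < phi P.
Proof. by move=> PS; rewrite divr_gt0// mass0. Qed.

(* Trading sg for mu costs a power of the Muckenhoupt quotient. *)
Let muckE P : P \in S -> phi P `^ rho * mass sg P = muckenhoupt P `^ rho * mass mu P.
Proof.
move=> PS; have m0 := mass0 mu0 PS; have s0 := mass0 sg0 PS.
have h0 : 0 < mean_val mu sg P by rewrite divr_gt0.
rewrite /muckenhoupt powRM ?powR_ge0 ?(ltW (phi0 PS))// -powRrM /rho.
have -> : q / r * (r / q) = 1 by field; apply/andP; split; exact: lt0r_neq0.
by rewrite powRr1 ?(ltW h0)// -mulrA /mean_val divfK// lt0r_neq0.
Qed.

(* The quotients lie in [1, Ab], so that there are at most 1 + ln Ab levels: this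
   is where the logarithm of the theorem comes from. *)
Let lvl P : nat := Num.truncn (ln (muckenhoupt P)).

Let lvl_bounds P : P \in S ->
  expR (lvl P)%:R <= muckenhoupt P <= expR 1 * expR (lvl P)%:R.
Proof.
move=> PS; have /andP[A1 _] := muckA PS.
have l0 : 0 <= ln (muckenhoupt P) by exact: ln_ge0.
have /andP[h1 h2] := truncn_itv l0.
have m0 : muckenhoupt P \is Num.pos by rewrite posrE; lra.
rewrite -expRD -{1 2}(lnK m0) !ler_expR /lvl h1/=.
by move: h2; rewrite -natr1 addrC => /ltW.
Qed.

Let lvl_le P : P \in S -> (lvl P < (Num.truncn (ln Ab)).+1)%N.
Proof.
move=> PS; have /andP[A1 A2] := muckA PS.
by rewrite ltnS; apply: le_truncn; rewrite ler_ln ?posrE//; lra.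
Qed.

Section top_cube.
Variable (Q : {set T}).

Let D k := [set P in below S Q | lvl P == k].

Let D_sub k P : P \in D k -> [/\ P \in S, P \subset Q & lvl P = k].
Proof. by rewrite inE => /andP[/below_sub[? ?] /eqP]. Qed.

Let lD k : laminar (D k).
Proof.
by apply: laminar_sub lS; apply/fintype.subsetP => P /D_sub[].
Qed.

Let DG k G := below (D k) G.

(* Inside a cube G of level k, all the quotients are comparable to that of G. *)
Let stack k G : G \in D k ->
  \sum_x sg x * dmax phi (DG k G) x `^ (1 + rho) <=
   dmax_const rho * expR 1 `^ rho * (Br * mass v G).
Proof.
move=> GD; have [GS GQ lG] := D_sub GD.
have DGD P : P \in DG k G -> [/\ P \in S, P \subset G & lvl P = k].
  by move=> /below_sub[/D_sub[]].
have e0 : 0 <= expR 1 `^ rho * muckenhoupt G `^ rho by rewrite mulr_ge0 ?powR_ge0.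
apply: le_trans (sum_dmax_le (K := expR 1 `^ rho * muckenhoupt G `^ rho) _ _ _ _ mu0' _ _) _ => //.
- by apply: laminar_below; exact: lD.
- by move=> P /DGD[PS _ _]; exact: phi0.
- move=> P /DGD[PS _ lP]; rewrite muckE// ler_pM2r ?mass0//.
  have /andP[hG _] := lvl_bounds GS; have /andP[_ hP] := lvl_bounds PS.
  have /andP[P1 _] := muckA PS; have /andP[G1 _] := muckA GS.
  rewrite -powRM ?expR_ge0//; last exact: le_trans ler01 G1.
  apply: powR_le; [exact: ltW|exact: le_trans ler01 P1|].
  rewrite lP -lG in hP; apply: le_trans hP _.
  rewrite ler_pM2l; [exact: hG|exact: expR_gt0].
have m0 : 0 < dmax_const rho.
  by rewrite /dmax_const !mulr_gt0 ?powR_gt0 ?expR_gt0 ?geo_gt0.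
move: (dmax_const rho) m0 => cm m0; rewrite -!mulrA (ler_pM2l m0) ler_pM2l ?powR_gt0 ?expR_gt0//.
apply: le_trans _ (muckB GS); rewrite ler_wpM2l ?powR_ge0//.
rewrite (bigID (fun x => x \in G))/= [X in _ + X]big1 ?addr0.
  apply: ler_sum => x xG; rewrite ler_wpM2l//.
  apply: dmax_le; first exact: dmax_ge0.
  by move=> P /DGD[PS PG _] xP; apply: le_dmax => //; rewrite inE PS.
move=> x xG; rewrite (_ : dmax _ _ _ = 0) ?mulr0//.
have [//|[P [/DGD[_ PG _] xP _]]] := dmax_attained phi (DG k G) x.
by move: xG; rewrite (fintype.subsetP PG).
Qed.

Definition testing_const : R := hedberg_const a `^ r * (dmax_const rho * expR 1 `^ rho).

Hypothesis (QS : Q \in S).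

(** After [hedberg], each point where M_Q v is attained at a cube of level k is charged
    to the maximal cube of level k above it; [stack] applies to that cube, the maximal
    cubes of one level are disjoint, and the levels are counted. *)
Lemma testing : \sum_(x in Q) sg x * dyadic_op (below S Q) (riesz_coef a mu) v x `^ r <=
  testing_const * (1 + ln Ab) * Br * mass v Q `^ (1 + a * r).
Proof.
have vQ0 : 0 < mass v Q by exact: mass0.
have Br0 : 0 <= Br.
  rewrite -(pmulr_lge0 _ vQ0); apply: le_trans (muckB QS).
  rewrite mulr_ge0 ?powR_ge0// sumr_ge0// => x _.
  by rewrite mulr_ge0// dmax_ge0.
have a0 : 0 < a by case/andP: a01.
have br : 1 + rho = (1 - a) * r.
  rewrite aqr /rho; field; apply/andP; split; exact: lt0r_neq0.
have s0 : 0 < 1 + rho by rewrite addr_gt0.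
have hc0 : 0 <= hedberg_const a.
  by case/andP: a01 => ? ?; rewrite addr_ge0// ltW// geo_gt0//; lra.
have c0 : 0 <= dmax_const rho * expR 1 `^ rho.
  by rewrite /dmax_const ltW// !mulr_gt0 ?powR_gt0 ?expR_gt0 ?geo_gt0.
have testE : testing_const = hedberg_const a `^ r * (dmax_const rho * expR 1 `^ rho) by [].
move: testing_const testE => tc testE.
set cm := dmax_const rho * expR 1 `^ rho in c0 testE *.
have stack' k G : G \in D k -> \sum_x sg x * dmax phi (DG k G) x `^ (1 + rho) <=
   cm * (Br * mass v G) by exact: stack.
move: cm c0 testE stack' => cm c0 testE stack'.
pose K := (Num.truncn (ln Ab)).+1.
have main : \sum_(x in Q) sg x * dmax phi (below S Q) x `^ (1 + rho) <=
    K%:R * (cm * (Br * mass v Q)).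
  pose F k G x := sg x * dmax phi (DG k G) x `^ (1 + rho).
  have F0 k G x : 0 <= F k G x by rewrite mulr_ge0 ?powR_ge0.
  apply: (@le_trans _ _ (\sum_(x in Q) \sum_(k < K) \sum_(G in tops (D k)) F k G x)).
    apply: ler_sum => x xQ.
    have [->|[P [PS xP ->]]] := dmax_attained phi (below S Q) x.
      rewrite powR0 ?gt_eqF// mulr0 sumr_ge0// => k _; apply: sumr_ge0 => G _.
      exact: F0.
    have [PS' PQ] := below_sub PS.
    have kK := lvl_le PS'.
    have PD : P \in D (lvl P) by rewrite inE PS eqxx.
    have [G Gt PG] := tops_exists PD.
    rewrite (bigD1 (Ordinal kK))//= (bigD1 G)//= -addrA.
    apply: ler_wpDr.
      rewrite addr_ge0// sumr_ge0// => k _; apply: sumr_ge0 => H _; exact: F0.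
    rewrite ler_wpM2l//; apply: powR_le; [exact: ltW|exact/ltW/phi0|].
    by apply: le_dmax => //; rewrite inE PD.
  rewrite exchange_big/=.
  apply: (@le_trans _ _ (\sum_(k < K) cm * (Br * mass v Q))).
    apply: ler_sum => k _; rewrite exchange_big/=.
    apply: (@le_trans _ _ (\sum_(G in tops (D k))
        cm * (Br * mass v G))).
      apply: ler_sum => G /tops_sub GD; apply: le_trans _ (stack' _ _ GD).
      rewrite [leRHS](bigID (fun x => x \in Q))/= lerDl.
      by apply: sumr_ge0 => x _; exact: F0.
    rewrite -!big_distrr/= ler_wpM2l// ler_wpM2l// tops_sum//.
    apply: mass_le => //; apply/fintype.subsetP => x /finset.bigcupP[P].
    by move=> /D_sub[_ /fintype.subsetP PQ _]; exact: PQ.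
  by rewrite sumr_const card_ord mulr_natl.
have KA : K%:R <= 1 + ln Ab.
  rewrite /K -natr1 addrC lerD2l truncn_le; apply: ln_ge0.
  by have /andP[] := muckA QS; exact: le_trans.
apply: (@le_trans _ _ (\sum_(x in Q) hedberg_const a `^ r * mass v Q `^ (a * r) *
    (sg x * dmax phi (below S Q) x `^ (1 + rho)))).
  apply: ler_sum => x xQ.
  have dy0 : 0 <= dyadic_op (below S Q) (riesz_coef a mu) v x.
    rewrite sumr_ge0// => P _; rewrite mulr_ge0 ?powR_ge0//; exact: mass_ge0.
  have := hedberg Q x lS dS mu0 v0 a01.
  move/(powR_le (ltW r0) dy0) => /(ler_wpM2l (sg0' x)) /le_trans; apply.
  rewrite (powRM _ hc0) ?mulr_ge0 ?powR_ge0// powRM ?powR_ge0//.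
  by rewrite -!powRrM br; apply: le_of_eq; ring.
rewrite -big_distrr/=; apply: le_trans (ler_wpM2l _ main) _.
  by rewrite mulr_ge0 ?powR_ge0.
rewrite testE powRD_gt0// powRr1 ?(ltW vQ0)//.
set X := (X in X <= _).
have -> : X = hedberg_const a `^ r * mass v Q `^ (a * r) * cm *
  (Br * mass v Q) * K%:R by rewrite /X; ring.
rewrite [leRHS](_ : _ = hedberg_const a `^ r * mass v Q `^ (a * r) * cm *
  (Br * mass v Q) * (1 + ln Ab)); last by ring.
rewrite ler_wpM2l//; apply: mulr_ge0; last by apply: mulr_ge0 => //; exact: ltW.
by apply: mulr_ge0 => //; apply: mulr_ge0; exact: powR_ge0.
Qed.

End top_cube.
End testing.

(** * Weak type inequality from one testing condition *)

Section numeric.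
Context {R : realType}.

(** The weighted inequality, with the factors allowed to vanish. *)
Lemma hoelder_sum (I : finType) (X : {pred I}) (f g w : I -> R) (p r : R) :
  (forall i, 0 <= f i) -> (forall i, 0 <= g i) -> (forall i, 0 <= w i) ->
  1 < p -> 1 < r -> p^-1 + r^-1 = 1 ->
  \sum_(i in X) f i * g i * w i <=
  (\sum_(i in X) f i `^ p * w i) `^ p^-1 * (\sum_(i in X) g i `^ r * w i) `^ r^-1.
Proof.
move=> f0 g0 w0 p1 r1 pr.
have p0 : 0 < p by lra.
have r0 : 0 < r by lra.
have null (k : I -> R) (s : R) : (forall i, 0 <= k i) -> 0 < s ->
    \sum_(i in X) k i `^ s * w i = 0 -> forall i, i \in X -> k i = 0 \/ w i = 0.
  move=> k0 s0 /eqP; rewrite psumr_eq0; last first.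
    by move=> i _; rewrite mulr_ge0 ?powR_ge0.
  move=> /allP h i iX; have := h i (mem_index_enum _); rewrite iX/= mulf_eq0.
  by rewrite powR_eq0 => /orP[/andP[/eqP]|/eqP]; [left|right].
have A0 : 0 <= \sum_(i in X) f i `^ p * w i.
  by rewrite sumr_ge0// => i _; rewrite mulr_ge0 ?powR_ge0.
have B0 : 0 <= \sum_(i in X) g i `^ r * w i.
  by rewrite sumr_ge0// => i _; rewrite mulr_ge0 ?powR_ge0.
have Anull := null f p f0 p0; have Bnull := null g r g0 r0.
have [A AE] : exists A, A = \sum_(i in X) f i `^ p * w i by eexists.
have [B BE] : exists B, B = \sum_(i in X) g i `^ r * w i by eexists.
rewrite -AE in A0 Anull *; rewrite -BE in B0 Bnull *.
have [Az|Az] := eqVneq A 0.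
  rewrite big1 ?mulr_ge0 ?powR_ge0// => i iX.
  by have [->|->] := Anull Az i iX; rewrite ?mulr0 ?mul0r.
have [Bz|Bz] := eqVneq B 0.
  rewrite big1 ?mulr_ge0 ?powR_ge0// => i iX.
  by have [->|->] := Bnull Bz i iX; rewrite ?(mulr0, mul0r).
have Ap : 0 < A by rewrite lt_neqAle eq_sym Az.
have Bp : 0 < B by rewrite lt_neqAle eq_sym Bz.
have Aq : 0 < A `^ p^-1 by exact: powR_gt0.
have Bq : 0 < B `^ r^-1 by exact: powR_gt0.
have AB0 : 0 < A `^ p^-1 * B `^ r^-1 by exact: mulr_gt0 Aq Bq.
rewrite -[leRHS]mulr1 -(ler_pdivrMl _ _ AB0) big_distrr/=.
apply: (@le_trans _ _ (\sum_(i in X) (A^-1 / p * (f i `^ p * w i) +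
    B^-1 / r * (g i `^ r * w i)))).
  apply: ler_sum => i _.
  have := @conjugate_powR _ (f i / A `^ p^-1) (g i / B `^ r^-1) p r.
  move=> /(_ (divr_ge0 (f0 i) (ltW Aq)) (divr_ge0 (g0 i) (ltW Bq)) p0 r0 pr).
  have inv (C s : R) : 0 < C -> 0 < s -> (C `^ s^-1)^-1 `^ s = C^-1.
    move=> C0 s0; rewrite -powRN -powRrM mulNr mulVf ?gt_eqF//.
    by rewrite powR_inv1// ltW.
  rewrite !powRM ?invr_ge0 ?powR_ge0// !inv// => /(ler_wpM2r (w0 i)).
  move=> h; apply: le_trans (le_trans h _).
    apply: le_of_eq; field.
    by apply/andP; split; exact: lt0r_neq0.
  by apply: le_of_eq; ring.
rewrite big_split/= -!big_distrr/= -AE -BE.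
apply: le_of_eq; rewrite -pr; field.
by rewrite Az Bz !gt_eqF.
Qed.

(** The norm of l^s is at most that of l^1. *)
Lemma sum_powR_le (I : finType) (X : {pred I}) (F : I -> R) M s :
  1 <= s -> (forall i, i \in X -> 0 <= F i) -> \sum_(i in X) F i <= M ->
  \sum_(i in X) F i `^ s <= M `^ s.
Proof.
move=> s1 F0 FM.
have M0 : 0 <= M by apply: le_trans FM; exact: sumr_ge0.
have s0 : 0 < s by lra.
rewrite -(mulr_powRB1 M0 s0); apply: (@le_trans _ _ (\sum_(i in X) F i * M `^ (s - 1))).
  apply: ler_sum => i iX; rewrite -(mulr_powRB1 (F0 _ iX) s0) ler_wpM2l ?F0//.
  apply: powR_le; [lra|exact: F0|apply: le_trans FM].
  by rewrite (bigD1 i)//= lerDl sumr_ge0// => j /andP[jX _]; exact: F0.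
by rewrite -big_distrl/= ler_wpM2r ?powR_ge0.
Qed.

(** An inequality with an error term C / 2^k for all k: the good-lambda inequality
    is iterated without assuming first that the quantity to be bounded is finite. *)
Lemma le_half_pow (x W C : R) : (forall k : nat, x <= W + 2^-1 ^+ k * C) -> x <= W.
Proof.
move=> h; rewrite leNgt; apply/negP => Wx.
have C0 : 0 < C by have := h 0%N; rewrite expr0; lra.
pose k := (Num.truncn (C / (x - W))).+1.
have e0 : 0 < x - W by lra.
have h1 : C / (x - W) < k%:R by exact: truncnS_gt.
have h2 : k%:R <= 2 ^+ k :> R by rewrite -natrX ler_nat ltnW// ltn_expl.
have h3 : C < (x - W) * 2 ^+ k.
  by rewrite mulrC -ltr_pdivrMr//; exact: lt_le_trans h1 h2.
have := h k; rewrite exprVn mulrC.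
suff : C / 2 ^+ k < x - W by lra.
by rewrite ltr_pdivrMr// exprn_gt0.
Qed.

End numeric.

Section weak.
Context {R : realType} {T : finType}.
Implicit Types (P Q F G : {set T}) (D : {set {set T}}) (h m : T -> R).

Lemma chain_min (S X : {set {set T}}) P1 x : laminar S -> P1 \in X ->
  (forall P, P \in X -> P \in S /\ x \in P) ->
  exists2 P0, P0 \in X & forall P, P \in X -> P0 \subset P.
Proof.
move=> lS P1X XS.
case: (@arg_minnP _ P1 (mem X) (fun P => #|P|) P1X) => P0 P0X0 Pmin.
have P0X : P0 \in X by exact: P0X0.
exists P0 => // P PX; have [PS xP] := XS _ PX; have [P0S xP0] := XS _ P0X.
have [//|PP0] := lS _ _ _ P0S PS xP0 xP.
have h : (#|P0| <= #|P|)%N by exact: Pmin.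
by have /eqP -> : P == P0 by rewrite finset.eqEcard PP0.
Qed.

Lemma dyadic_op_dual D (t : {set T} -> R) h m :
  \sum_x m x * dyadic_op D t h x = \sum_x h x * dyadic_op D t m x.
Proof.
rewrite /dyadic_op -(sum_mass D (fun P => t P * mass h P) m).
rewrite -(sum_mass D (fun P => t P * mass m P) h).
by apply: eq_bigr => P _; rewrite mulrAC.
Qed.

Lemma dyadic_op_below0 (S : {set {set T}}) Q (t : {set T} -> R) h x :
  x \notin Q -> dyadic_op (below S Q) t h x = 0.
Proof.
move=> xQ; rewrite /dyadic_op big1// => P /andP[/below_sub[_ PQ] xP].
by move: xQ; rewrite (fintype.subsetP PQ).
Qed.

Lemma dyadic_op_ge0 D (t : {set T} -> R) h x : (forall P, 0 <= t P) ->
  (forall y, 0 <= h y) -> 0 <= dyadic_op D t h x.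
Proof.
move=> t0 h0; apply: sumr_ge0 => P _; rewrite mulr_ge0//; exact: mass_ge0.
Qed.

Variables (S : {set {set T}}) (t : {set T} -> R) (sg v f : T -> R).
Variables (p q r Kr : R).
Hypotheses (lS : laminar S) (t0 : forall P, 0 <= t P) (sg0 : forall x, 0 <= sg x).
Hypotheses (v0 : forall x, 0 < v x) (S0 : forall P, P \in S -> exists x, x \in P).
Hypotheses (f0 : forall x, 0 <= f x) (p1 : 1 < p) (r1 : 1 < r).
Hypotheses (pr : p^-1 + r^-1 = 1) (pq : p <= q) (Kr0 : 0 < Kr).
Hypothesis test : forall Q, Q \in S ->
  \sum_(x in Q) sg x * dyadic_op (below S Q) t v x `^ r <=
    Kr * mass v Q `^ (r * (1 - q^-1)).

Let h x := f x * sg x.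
Let h0 x : 0 <= h x. Proof. exact: mulr_ge0. Qed.
Let u x := dyadic_op S t h x.
Let v0' x : 0 <= v x. Proof. exact: ltW. Qed.

(* The part of T f that comes from the sets containing P; it is constant on P, and
   the level set of T f at l is the union of the sets P with uP P > l. *)
Let uP P : R := \sum_(P' in S | P \subset P') t P' * mass h P'.
Let D l := [set P in S | l < uP P].

Let term0 P : 0 <= t P * mass h P.
Proof. by rewrite mulr_ge0//; exact: mass_ge0. Qed.

Let lD l : laminar (D l).
Proof. by apply: laminar_sub lS; apply/fintype.subsetP => P; rewrite inE => /andP[]. Qed.

Let coverD l x : 0 < l -> (x \in finset.cover (D l)) = (l < u x).
Proof.
move=> l0; apply/finset.bigcupP/idP => [[P /[!inE]/andP[PS lP] xP]|lu].
  apply: lt_le_trans lP _; rewrite /uP /u /dyadic_op [leRHS](bigID (fun P' => P \subset P'))/=.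
  rewrite (eq_bigl (fun i => (i \in S) && (x \in i) && (P \subset i))).
    by rewrite lerDl sumr_ge0.
  move=> P'; case PP' : (P \subset P'); rewrite ?andbF// !andbT.
  by rewrite (fintype.subsetP PP' _ xP) andbT.
pose X := [set P in S | x \in P].
have [X0|[P1 P1X]] := set_0Vmem X.
  move: lu; rewrite /u /dyadic_op big1 ?ltNge ?(ltW l0)// => P PX.
  have : P \in X by rewrite inE.
  by rewrite X0 inE.
have [|P0 P0X Pmin] := @chain_min S X P1 x lS P1X.
  by move=> P; rewrite inE => /andP.
move: (P0X); rewrite inE => /andP[P0S xP0].
exists P0 => //; rewrite inE P0S/=; apply: lt_le_trans lu _.
rewrite /u /dyadic_op /uP (eq_bigl (fun P' => (P' \in S) && (P0 \subset P')))// => P.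
case PS : (P \in S) => //=; apply/idP/idP => [xP|/fintype.subsetP]; last exact.
by apply: Pmin; rewrite inE PS.
Qed.

(* By maximality of Q, the sets that strictly contain Q contribute at most l. *)
Let above_le l Q x : 0 < l -> Q \in tops (D l) -> x \in Q ->
  u x <= l + dyadic_op (below S Q) t h x.
Proof.
move=> l0 /topsP[QD Qp] xQ; have QS : Q \in S by move: QD; rewrite inE => /andP[].
rewrite /u /dyadic_op (bigID (fun P => P \subset Q))/= addrC; apply: lerD; last first.
  apply: le_of_eq; apply: eq_bigl => P.
  by rewrite inE andbAC.
pose X := [set P in S | (x \in P) && ~~ (P \subset Q)].
have XE P : (P \in X) = (P \in S) && (x \in P) && ~~ (P \subset Q).
  by rewrite inE andbA.
rewrite -(eq_bigl _ _ XE).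
have [->|[P1 P1X]] := set_0Vmem X; first by rewrite big_set0 ltW.
have [|P0 P0X Pmin] := @chain_min S X P1 x lS P1X.
  by move=> P; rewrite XE => /andP[/andP[]].
have up P : P \in X -> Q \proper P.
  rewrite XE => /andP[/andP[PS xP] PQ].
  have [QP|] := lS QS PS xQ xP; last by rewrite (negbTE PQ).
  by rewrite properE QP.
have := P0X; rewrite XE => /andP[/andP[P0S xP0] _].
have : P0 \notin D l by apply/negP => /Qp; rewrite up.
rewrite inE P0S/= -leNgt; apply: le_trans.
rewrite /uP; apply: le_of_eq; apply: eq_bigl => P.
apply/idP/andP => [PX|[PS P0P]].
  by split; [move: PX; rewrite XE => /andP[/andP[]]|exact: Pmin].
rewrite XE PS (fintype.subsetP P0P)//=; apply/negP => PQ.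
have /andP[_ /negP] := up _ P0X; apply; exact: fintype.subset_trans PQ.
Qed.

Let V l := \sum_(x | l < u x) v x.
Let Fp Q := \sum_(x in Q) f x `^ p * sg x.
Let Ft := \sum_x f x `^ p * sg x.

Let q0 : 0 < q. Proof. by apply: lt_le_trans pq; apply: lt_trans p1. Qed.
Let p0 : 0 < p. Proof. exact: lt_trans p1. Qed.
Let r0 : 0 < r. Proof. exact: lt_trans r1. Qed.
Let Fp0 Q : 0 <= Fp Q.
Proof. by apply: sumr_ge0 => x _; rewrite mulr_ge0 ?powR_ge0. Qed.

(* Duality moves the localised operator from f to v, where the testing
   condition applies. *)
Let local_est l Q : 0 < l -> Q \in tops (D l) ->
  l * \sum_(x in Q | 2 * l < u x) v x <=
    Fp Q `^ p^-1 * (Kr `^ r^-1 * mass v Q `^ (1 - q^-1)).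
Proof.
move=> l0 Qt; have QS : Q \in S by move/tops_sub: Qt; rewrite inE => /andP[].
apply: (@le_trans _ _ (\sum_(x in Q) v x * dyadic_op (below S Q) t h x)).
  rewrite big_distrr/= [leRHS](bigID (fun x => 2 * l < u x))/=.
  apply: ler_wpDr.
    by apply: sumr_ge0 => x _; rewrite mulr_ge0// dyadic_op_ge0.
  apply: ler_sum => x /andP[xQ lu]; rewrite mulrC ler_wpM2l//.
  have := above_le l0 Qt xQ; lra.
have -> : \sum_(x in Q) v x * dyadic_op (below S Q) t h x =
    \sum_(x in Q) f x * dyadic_op (below S Q) t v x * sg x.
  transitivity (\sum_x v x * dyadic_op (below S Q) t h x).
    rewrite [RHS](bigID (fun x => x \in Q))/= [X in _ = _ + X]big1 ?addr0//.
    by move=> x xQ; rewrite dyadic_op_below0// mulr0.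
  rewrite dyadic_op_dual (bigID (fun x => x \in Q))/= [X in _ + X]big1 ?addr0//.
    by apply: eq_bigr => x _; rewrite /h mulrAC.
  by move=> x xQ; rewrite dyadic_op_below0// mulr0.
apply: le_trans (hoelder_sum _ f0 _ sg0 p1 r1 pr) _.
  by move=> x; exact: dyadic_op_ge0.
rewrite ler_wpM2l ?powR_ge0//.
have := test QS; under eq_bigr do rewrite mulrC.
move=> test'; apply: le_trans (powR_le _ _ test') _.
- by rewrite invr_ge0 ltW.
- by apply: sumr_ge0 => x _; rewrite mulr_ge0 ?powR_ge0.
rewrite powRM ?powR_ge0 ?(ltW Kr0)// -[in leLHS]powRrM mulrAC mulfV ?mul1r//.
exact: lt0r_neq0.
Qed.

(* The value for which beta 2^q = 1/2, so that the iteration of [step]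
   contracts. *)
Let beta : R := 2 `^ (- q - 1).
Let beta0 : 0 < beta. Proof. exact: powR_gt0. Qed.

(* Either {T f > 2l} takes a small fraction beta of Q, or [local_est] bounds v(Q)
   itself. *)
Let local_good l Q : 0 < l -> Q \in tops (D l) ->
  \sum_(x in Q | 2 * l < u x) v x <= beta * mass v Q +
    (Kr `^ r^-1 / (l * beta)) `^ q * Fp Q `^ (q / p).
Proof.
move=> l0 Qt; have QS : Q \in S by move/tops_sub: Qt; rewrite inE => /andP[].
have c0 : 0 <= (Kr `^ r^-1 / (l * beta)) `^ q * Fp Q `^ (q / p).
  by rewrite mulr_ge0 ?powR_ge0.
set w := \sum_(x in Q | _) v x.
have vQ0 : 0 < mass v Q by have [x xQ] := S0 QS; exact: mass_gt0 xQ.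
have [wb|wb] := leP w (beta * mass v Q); first by lra.
apply: ler_wpDl; first by rewrite mulr_ge0// ltW.
have wv : w <= mass v Q.
  by rewrite /mass [leRHS](bigID (fun x => 2 * l < u x))/= lerDl sumr_ge0.
apply: le_trans wv _.
have := local_est l0 Qt; rewrite -/w => est.
have : l * beta * mass v Q `^ q^-1 <= Fp Q `^ p^-1 * Kr `^ r^-1.
  have v1 : 0 < mass v Q `^ (1 - q^-1) by exact: powR_gt0.
  rewrite -(ler_pM2r v1); apply: le_trans (le_trans _ est) _.
    rewrite -!mulrA -powRD_gt0// addrC subrK powRr1 ?(ltW vQ0)//.
    by rewrite ler_pM2l// ltW.
  by rewrite mulrA.
rewrite mulrC -ler_pdivlMr ?mulr_gt0// => /(powR_le (ltW q0) (powR_ge0 _ _)).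
rewrite -powRrM mulVf ?gt_eqF// powRr1 ?(ltW vQ0)// => /le_trans; apply.
rewrite -mulrA mulrC.
have k0 : 0 <= Kr `^ r^-1 / (l * beta).
  by rewrite divr_ge0 ?powR_ge0// ltW// mulr_gt0.
rewrite (powRM _ k0 (powR_ge0 _ _)) -(powRrM (Fp Q)) (mulrC p^-1); exact: lexx.
Qed.

Let step l : 0 < l -> V (2 * l) <= beta * V l +
    (Kr `^ r^-1 / (l * beta)) `^ q * Ft `^ (q / p).
Proof.
move=> l0.
have split_tops (F : T -> R) : \sum_(G in tops (D l)) \sum_(x in G) F x = \sum_(x | l < u x) F x.
  by rewrite tops_sum//; apply: eq_bigl => x; rewrite coverD.
have -> : V (2 * l) = \sum_(G in tops (D l)) \sum_(x in G | 2 * l < u x) v x.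
  rewrite (eq_bigr (fun G => \sum_(x in G) (if 2 * l < u x then v x else 0))).
    rewrite split_tops -big_mkcondr/=; apply: eq_bigl => x.
    by apply/idP/andP => [lu|[]//]; split => //; lra.
  by move=> G _; rewrite big_mkcondr.
have -> : V l = \sum_(G in tops (D l)) mass v G by rewrite /mass split_tops.
rewrite big_distrr/=; apply: le_trans (ler_sum _ (fun Q => local_good l0)) _.
rewrite big_split/= lerD2l -big_distrr/= ler_wpM2l ?powR_ge0//.
apply: sum_powR_le => //; first by rewrite ler_pdivlMr// mul1r.
rewrite split_tops /Ft [leRHS](bigID (fun x => l < u x))/= lerDl.
by apply: sumr_ge0 => x _; rewrite mulr_ge0 ?powR_ge0.
Qed.

Definition good_lambda_const : R := 2 * 2 `^ q * beta `^ (- q).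

(** The good-lambda inequality
      V(2l) <= beta V(l) + C l^-q,
    where V(l) is the v-measure of {T f > l}, is iterated from l downwards; the
    remainder after k steps is at most l^q v(T) / 2^k. *)
Lemma weak_type l : 0 < l ->
  l `^ q * \sum_(x | l < dyadic_op S t (fun y => f y * sg y) x) v x <=
    good_lambda_const * Kr `^ (q / r) * Ft `^ (q / p).
Proof.
move=> l00; rewrite -[X in _ * X]/(V l).
set W := good_lambda_const * _ * _.
have W0 : 0 <= W by rewrite /W /good_lambda_const !mulr_ge0 ?powR_ge0.
pose Vt := \sum_x v x.
have Vt0 : 0 <= Vt by exact: sumr_ge0.
apply: (@le_half_pow _ _ _ (l `^ q * Vt)) => k.
elim: k l l00 => [|k IH] l l0.
  rewrite expr0 mul1r; apply: ler_wpDl => //; rewrite ler_wpM2l ?powR_ge0//.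
  by rewrite /Vt [leRHS](bigID (fun x => l < u x))/= lerDl sumr_ge0.
have l20 : 0 < l / 2 by rewrite divr_gt0.
have := step l20; rewrite mulrC divfK// => st.
apply: le_trans (ler_wpM2l (powR_ge0 l q) st) _.
have b1 : l `^ q * beta = 2^-1 * (l / 2) `^ q.
  rewrite /beta powRM ?invr_ge0 ?(ltW l0)// powRD_gt0// powR_inv1//.
  by rewrite -(powR_inv1 (ler0n _ 2)) -powRrM mulN1r powRN; ring.
have b2 : l `^ q * (Kr `^ r^-1 / (l / 2 * beta)) `^ q = 
    2^-1 * (good_lambda_const * Kr `^ (q / r)).
  rewrite powRM ?powR_ge0 ?invr_ge0 ?mulr_ge0 ?(ltW l20) ?(ltW beta0)//.
  rewrite -powRrM [r^-1 * q]mulrC.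
  rewrite -(powR_inv1 (ltW (mulr_gt0 l20 beta0))) -powRrM mulN1r.
  rewrite powRM ?(ltW l20) ?(ltW beta0)// powRM ?(ltW l0)//.
  rewrite (powRN l) -(powR_inv1 (ler0n _ 2)) -[(2 `^ -1) `^ _]powRrM mulN1r opprK.
  rewrite ?powR_inv1 ?ler0n// /good_lambda_const; field; exact: lt0r_neq0 (powR_gt0 _ l0).
  exact: ltW.
have := IH _ l20 => {}IH.
have : (l / 2) `^ q <= l `^ q.
  by apply: powR_le; [exact: ltW|exact: ltW|lra].
move=> /(ler_wpM2r Vt0) hl.
rewrite mulrDr mulrA b1 mulrA b2 -/W.
have c0 : 0 <= 2^-1 ^+ k :> R by rewrite exprn_ge0.
have := ler_wpM2l c0 hl; rewrite exprS.
set A := 2^-1 ^+ k * _; set B := 2^-1 ^+ k * _ => AB.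
rewrite -[2^-1 * _ * V _]mulrA -[2^-1 * _ * Ft `^ _]mulrA -[2^-1 * _ * (l `^ q * Vt)]mulrA.
rewrite -/B -[good_lambda_const * _ * _]/W.
by move: IH; rewrite -/A => IH; lra.
Qed.

End weak.

(** * Half of the bilinear form, by principal sets *)

Section half.
Context {R : realType} {T : finType}.
Implicit Types (P Q F G : {set T}) (D : {set {set T}}) (h m : T -> R).

Variables (S : {set {set T}}) (t : {set T} -> R) (sg v f g : T -> R).
Variables (p q s Kq : R).
Hypotheses (lS : laminar S) (t0 : forall P, 0 <= t P) (sg0 : forall x, 0 < sg x).
Hypotheses (v0 : forall x, 0 < v x) (S0 : forall P, P \in S -> exists x, x \in P).
Hypotheses (f0 : forall x, 0 <= f x) (g0 : forall x, 0 <= g x).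
Hypotheses (p1 : 1 < p) (s1 : 1 < s) (q1 : 1 < q).
Hypotheses (qs : q^-1 + s^-1 = 1) (pq : p <= q) (Kq0 : 0 < Kq).
Hypothesis test : forall Q, Q \in S ->
  \sum_(x in Q) v x * dyadic_op (below S Q) t sg x `^ q <=
    Kq * mass sg Q `^ (q / p).
Hypothesis f1 : \sum_x f x `^ p * sg x <= 1.
Hypothesis g1 : \sum_x g x `^ s * v x <= 1.

Let sg0' x : 0 <= sg x. Proof. exact: ltW. Qed.
Let v0' x : 0 <= v x. Proof. exact: ltW. Qed.

(** The cubes where f dominates: the two energies compared here are those that
    the Carleson embedding makes summable over principal cubes. *)
Definition upper := [set P in S | (0 < density f sg P) &&
  (density g v P `^ s * mass v P <= density f sg P `^ p * mass sg P)].

Let A := upper.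
Let phi := density f sg.

Let A_S P : P \in A -> P \in S. Proof. by rewrite inE => /andP[]. Qed.
Let phi0 P : P \in A -> 0 < phi P. Proof. by rewrite inE => /and3P[]. Qed.
Let A_le P : P \in A -> density g v P `^ s * mass v P <= phi P `^ p * mass sg P.
Proof. by rewrite inE => /and3P[]. Qed.

Let lA : laminar A.
Proof. by apply: laminar_sub lS; apply/fintype.subsetP => P; exact: A_S. Qed.

Let Pr := principal phi A.
Let Pr_A F : F \in Pr -> F \in A.
Proof. by move/(fintype.subsetP (principal_sub _ _)). Qed.

Let msg0 P : P \in S -> 0 < mass sg P.
Proof. by move=> /S0[x]; exact: mass_gt0. Qed.
Let mv0 P : P \in S -> 0 < mass v P.
Proof. by move=> /S0[x]; exact: mass_gt0. Qed.

Let carl : \sum_(F in Pr) phi F `^ p * mass sg F <= carleson_const p.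
Proof.
have c0 : 0 <= carleson_const p by exact/ltW/carleson_const_gt0.
apply: le_trans (carleson lA f0 sg0' _ phi0 p1) _.
  by move=> P /A_S; exact: msg0.
by rewrite -[leRHS]mulr1 ler_wpM2l.
Qed.

(* Since f has norm at most 1, this energy is at most 1, so that raising it to
   the power q/p >= 1 only decreases it. *)
Let jensen P : P \in S -> phi P `^ p * mass sg P <= 1.
Proof.
move=> PS; have m0 := msg0 PS.
have p0 : 0 < p by exact: lt_trans p1.
have p1' := p1.
pose r := p / (p - 1).
have r1 : 1 < r by rewrite /r ltr_pdivlMr; lra.
have pr : p^-1 + r^-1 = 1.
  by rewrite /r; field; apply/andP; split; lra.
have := @hoelder_sum _ _ (mem P) f (fun=> 1) sg p r f0 (fun=> ler01) sg0' p1 r1 pr.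
rewrite (eq_bigr (fun i => f i * sg i)); last by move=> i _; rewrite mulr1.
rewrite -/(mass (fun i => f i * sg i) P) powR1.
rewrite [X in _ * X `^ _](eq_bigr sg); last by move=> i _; rewrite mul1r.
rewrite -/(mass sg P) => h.
have fP1 : \sum_(i in P) f i `^ p * sg i <= 1.
  apply: le_trans f1; rewrite [leRHS](bigID (fun x => x \in P))/= lerDl.
  by apply: sumr_ge0 => x _; rewrite mulr_ge0 ?powR_ge0.
have fP0 : 0 <= \sum_(i in P) f i `^ p * sg i.
  by apply: sumr_ge0 => x _; rewrite mulr_ge0 ?powR_ge0.
have pi0 : 0 <= p^-1 by rewrite invr_ge0 ltW.
have {}h : mass (fun i => f i * sg i) P <= mass sg P `^ r^-1.
  apply: le_trans h _; rewrite -[leRHS]mul1r ler_wpM2r ?powR_ge0//.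
  by have := powR_le pi0 fP0 fP1; rewrite powR1.
have n0 : 0 <= mass (fun i => f i * sg i) P.
  by apply: mass_ge0 => x; rewrite mulr_ge0.
rewrite /phi /density powRM ?invr_ge0 ?(ltW m0)//.
have {}h := powR_le (ltW p0) n0 h.
apply: (@le_trans _ _ ((mass sg P `^ r^-1) `^ p * (mass sg P)^-1 `^ p * mass sg P)).
  by rewrite !ler_wpM2r ?powR_ge0// ltW.
rewrite -powRrM -(powR_inv1 (ltW m0)) -powRrM -{3}(powRr1 (ltW m0)) -!powRD_gt0//.
have -> : r^-1 * p + -1 * p + 1 = 0 by rewrite /r; field; apply/andP; split; lra.
by rewrite powRr0.
Qed.

(* [st F] are the cubes that stop at F, [H F] their share of the operator applied to
   sg, [inner F] the principal cubes strictly inside F and [kids F] the maximal ones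
   among them. *)
Let st F := [set P in A | stopped phi A P F].
Let H F x := dyadic_op (st F) t sg x.
Let inner F := [set G in Pr | G \proper F].
Let kids F := tops (inner F).

Let linner F : laminar (inner F).
Proof.
by apply: laminar_sub lA; apply/fintype.subsetP => G; rewrite inE => /andP[/Pr_A].
Qed.

Let inner_sub F G : G \in inner F -> G \in Pr /\ G \proper F.
Proof. by rewrite inE => /andP. Qed.

Let H0 F x : 0 <= H F x.
Proof. exact: dyadic_op_ge0. Qed.

Let st_sub F P : P \in st F -> [/\ P \in A, P \subset F & stopped phi A P F].
Proof. by rewrite inE => /andP[? /[dup] /and3P[]]. Qed.

Let H_le F x : H F x <= dyadic_op (below S F) t sg x.
Proof.
rewrite /H /dyadic_op [leRHS](bigID (fun P => P \in st F))/=.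
rewrite [X in _ <= X + _](eq_bigl (fun P => (P \in st F) && (x \in P))).
  by rewrite lerDl sumr_ge0// => P _; rewrite mulr_ge0// mass_ge0.
move=> P; case: (boolP (P \in st F)) => Pst; rewrite ?andbF ?andbT//=.
by have [PA PF _] := st_sub Pst; rewrite inE A_S ?PF.
Qed.

Let H_out F x : x \notin F -> H F x = 0.
Proof.
move=> xF; apply/eqP; rewrite eq_le H0 andbT.
by apply: le_trans (H_le _ _) _; rewrite dyadic_op_below0.
Qed.

(* A cube that stops at F and meets a smaller principal cube G contains G: otherwise
   the level of G would not exceed that of F. *)
Let H_cst F G x y : F \in Pr -> G \in inner F -> x \in G -> y \in G ->
  H F x = H F y.
Proof.
move=> FPr /inner_sub[GPr GF].
have key z z' P : P \in st F -> z \in G -> z' \in G -> z \in P -> z' \in P.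
  move=> /st_sub[PA PF sP] zG z'G zP.
  have [GP|PG] := lA (Pr_A GPr) PA zG zP; first exact: (fintype.subsetP GP).
  have /and3P[_ _ /forallP/(_ G)] := sP.
  rewrite (Pr_A GPr) PG/= leNgt => /negP[].
  by have /principalP[_] := GPr; apply => //; exact: Pr_A.
move=> xG yG; rewrite /H /dyadic_op; apply: eq_bigl => P.
case Pst : (P \in st F) => //=.
by apply/idP/idP; [exact: (key x y)|exact: (key y x)].
Qed.

Let kap := Kq `^ q^-1.
Let kap0 : 0 < kap. Proof. exact: powR_gt0. Qed.
Let q0 : 0 < q. Proof. exact: lt_trans q1. Qed.
Let kapq : kap `^ q = Kq.
Proof. by rewrite /kap -powRrM mulVf ?powRr1 ?(ltW Kq0)// gt_eqF. Qed.

Let outer F := [set x in F | x \notin finset.cover (inner F)].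

Let young (x y : R) : 0 <= x -> 0 <= y -> x * y <= kap * (x `^ q / Kq + y `^ s).
Proof.
move=> x0 y0; have x0' : 0 <= x / kap by rewrite divr_ge0// ltW.
have s0 : 0 < s by exact: lt_trans s1.
have := @conjugate_powR _ _ _ q s x0' y0 q0 s0 qs.
rewrite powRM ?invr_ge0 ?(ltW kap0)//.
have -> : kap^-1 `^ q = Kq^-1.
  by rewrite -kapq -(powR_inv1 (ltW kap0)) -powRrM mulN1r powRN.
move=> /(ler_wpM2l (ltW kap0)) h.
have e : kap * (x / kap * y) = x * y by field; rewrite gt_eqF.
rewrite e in h; apply: le_trans h _; rewrite ler_pM2l//.
have le1 (c u : R) : 0 <= c -> 1 < u -> c / u <= c.
  move=> c0 u1; rewrite ler_pdivrMr; last by exact: lt_trans u1.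
  by rewrite ler_peMr// ltW.
apply: lerD; apply: le1 => //; last exact: powR_ge0.
by rewrite mulr_ge0 ?powR_ge0// invr_ge0 ltW.
Qed.

(* Since [H F] is constant on each G in [kids F], the function g may be replaced
   there by its average over G.  The Young inequality separates [H F] from g; the q-norm of
   [H F] is controlled by the testing condition, and on [kids F] the averages of g
   are dominated by those of f because G is an upper cube. *)
Let one_stop F : F \in Pr -> phi F * \sum_x g x * v x * H F x <=
  kap * (phi F `^ p * mass sg F + \sum_(x in outer F) g x `^ s * v x +
    \sum_(G in kids F) phi G `^ p * mass sg G).
Proof.
move=> FPr; have FA := Pr_A FPr; have FS := A_S FA; have ph0 := phi0 FA.
have mF0 := msg0 FS.
pose C := finset.cover (inner F).
have dens0 G : 0 <= density g v G.
  by rewrite divr_ge0 ?mass_ge0// => x; rewrite mulr_ge0.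
have CF : C \subset F.
  apply/fintype.subsetP => x /finset.bigcupP[G /inner_sub[_ /proper_sub/fintype.subsetP]].
  exact.
have split_sum (k : T -> R) : \sum_x k x * H F x =
    \sum_(x in outer F) k x * H F x + \sum_(x in C) k x * H F x.
  rewrite (bigID (fun x => x \in C))/= addrC; congr (_ + _).
  rewrite (bigID (fun x => x \in F))/= addrC big1 ?add0r.
    by apply: eq_bigl => x; rewrite inE andbC.
  by move=> x /andP[_ xF]; rewrite H_out// mulr0.
have onC : \sum_(x in C) g x * v x * H F x =
    \sum_(G in kids F) \sum_(x in G) density g v G * v x * H F x.
  rewrite /C -tops_sum//; apply: eq_bigr => G GK.
  have GI : G \in inner F by exact: tops_sub.
  have [GPr _] := inner_sub GI; have [y yG] := S0 (A_S (Pr_A GPr)).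
  rewrite (eq_bigr (fun x => g x * v x * H F y)); last first.
    by move=> x xG; congr (_ * _); exact: (H_cst FPr GI).
  rewrite [RHS](eq_bigr (fun x => v x * (density g v G * H F y))); last first.
    by move=> x xG; rewrite (H_cst FPr GI xG yG); ring.
  rewrite -!big_distrl/= mulrA; congr (_ * _).
  rewrite -/(mass (fun x => g x * v x) G) -/(mass v G) /density mulrC divfK//.
  by rewrite gt_eqF// mv0// A_S// Pr_A.
have HHq : \sum_x v x * H F x `^ q <= Kq * mass sg F `^ (q / p).
  apply: le_trans (test FS).
  rewrite [leRHS](eq_bigr (fun x => v x * dyadic_op (below S F) t sg x `^ q))//.
  rewrite (bigID (fun x => x \in F))/= [X in _ + X]big1 ?addr0.
    apply: ler_sum => x _; rewrite ler_wpM2l//.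
    by apply: powR_le; [exact: ltW|exact: H0|exact: H_le].
  by move=> x xF; rewrite H_out// powR0 ?mulr0// gt_eqF.
have first : \sum_x v x * ((phi F * H F x) `^ q / Kq) <= phi F `^ p * mass sg F.
  apply: (@le_trans _ _ ((phi F `^ p * mass sg F) `^ (q / p))).
    rewrite powRM ?powR_ge0 ?(ltW mF0)// -powRrM.
    have -> : p * (q / p) = q by field; rewrite gt_eqF// (lt_trans _ p1).
    rewrite -(ler_pM2l Kq0) big_distrr/= mulrCA.
    apply: le_trans (ler_wpM2l (powR_ge0 _ _) HHq).
    rewrite big_distrr/=; apply: ler_sum => x _.
    rewrite powRM ?(ltW ph0)//; apply: le_of_eq; field.
    by rewrite gt_eqF.
  apply: ge1r_powR; last by rewrite ler_pdivlMr ?mul1r// (lt_trans _ p1).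
  by rewrite jensen// mulr_gt0 ?powR_gt0.
rewrite split_sum onC mulrDr.
apply: (@le_trans _ _ (kap * (\sum_(x in outer F) v x * ((phi F * H F x) `^ q / Kq)
     + \sum_(x in outer F) g x `^ s * v x) +
   kap * (\sum_(x in C) v x * ((phi F * H F x) `^ q / Kq)
     + \sum_(G in kids F) \sum_(x in G) density g v G `^ s * v x))).
  apply: lerD.
    rewrite big_distrr/= -big_split/= big_distrr/=; apply: ler_sum => x _.
    have := young (mulr_ge0 (ltW ph0) (H0 F x)) (g0 x) => /(ler_wpM2l (v0' x)).
    move=> h; apply: le_trans (le_trans h _);
      by apply: le_of_eq; ring.
  rewrite /C -tops_sum// -big_split/= big_distrr/= big_distrr/=.
  apply: ler_sum => G _.
  rewrite big_distrr/= -big_split/= big_distrr/=; apply: ler_sum => x _.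
  have := young (mulr_ge0 (ltW ph0) (H0 F x)) (dens0 G) => /(ler_wpM2l (v0' x)).
  move=> h; apply: le_trans (le_trans h _);
    by apply: le_of_eq; ring.
rewrite -mulrDr ler_pM2l//.
have vk0 x : 0 <= v x * ((phi F * H F x) `^ q / Kq).
  by rewrite mulr_ge0// divr_ge0 ?powR_ge0// ltW.
have both : \sum_(x in outer F) v x * ((phi F * H F x) `^ q / Kq) +
    \sum_(x in C) v x * ((phi F * H F x) `^ q / Kq) <= phi F `^ p * mass sg F.
  apply: le_trans first; rewrite [leRHS](bigID (fun x => x \in C))/= addrC.
  apply: lerD; last exact: lexx.
  rewrite [leRHS](bigID (fun x => x \in F))/=.
  rewrite (eq_bigl (fun x => (x \notin C) && (x \in F))).
    by rewrite lerDl sumr_ge0.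
  by move=> x; rewrite inE andbC.
have third : \sum_(G in kids F) \sum_(x in G) density g v G `^ s * v x <=
    \sum_(G in kids F) phi G `^ p * mass sg G.
  apply: ler_sum => G /tops_sub /inner_sub[GPr _].
  by rewrite -big_distrr/=; apply: A_le; exact: Pr_A.
rewrite addrACA -[leRHS]addrA; apply: lerD; first exact: both.
by apply: lerD => //; exact: third.
Qed.

(* The sets [outer F] are disjoint. *)
Let outer_sum : \sum_(F in Pr) \sum_(x in outer F) g x `^ s * v x <= 1.
Proof.
apply: le_trans g1; rewrite (exchange_big_dep predT)//=; apply: ler_sum => x _.
have gx0 : 0 <= g x `^ s * v x by rewrite mulr_ge0 ?powR_ge0.
have [[F /andP[FPr xF]]|none] := pselect (exists F, (F \in Pr) && (x \in outer F)).
  rewrite (bigD1 F) ?FPr//= big1 ?addr0// => G /andP[/andP[GPr xG] GF].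
  exfalso; move: xF xG; rewrite !inE => /andP[xF xcF] /andP[xG xcG].
  have [FG|GsF] := lA (Pr_A FPr) (Pr_A GPr) xF xG.
    move/finset.bigcupP: xcG; apply; exists F => //.
    by rewrite inE FPr finset.properEneq eq_sym GF.
  move/finset.bigcupP: xcF; apply; exists G => //.
  by rewrite inE GPr finset.properEneq GF.
by rewrite big1// => F FF; exfalso; apply: none; exists F.
Qed.

(* A principal cube is a kid of at most one other. *)
Let kids_sum : \sum_(F in Pr) \sum_(G in kids F) phi G `^ p * mass sg G <= carleson_const p.
Proof.
apply: le_trans carl; rewrite (exchange_big_dep (fun G => G \in Pr))/=; last first.
  by move=> F G _ /tops_sub /inner_sub[].
apply: ler_sum => G GPr.
have gx0 : 0 <= phi G `^ p * mass sg G by rewrite mulr_ge0 ?powR_ge0 ?mass_ge0.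
have [[F /andP[FPr GF]]|none] := pselect (exists F, (F \in Pr) && (G \in kids F)).
  rewrite (bigD1 F) ?FPr//= big1 ?addr0// => F' /andP[/andP[F'Pr GF'] FF'].
  exfalso; have [y yG] := S0 (A_S (Pr_A GPr)).
  have [_ pF] := inner_sub (tops_sub GF); have [_ pF'] := inner_sub (tops_sub GF').
  have yF := fintype.subsetP (proper_sub pF) _ yG.
  have yF' := fintype.subsetP (proper_sub pF') _ yG.
  have [sF|sF] := lA (Pr_A FPr) (Pr_A F'Pr) yF yF'.
    have /topsP[_ /(_ F)] := GF'; rewrite inE FPr finset.properEneq eq_sym FF' sF.
    by move=> /(_ isT); rewrite pF.
  have /topsP[_ /(_ F')] := GF; rewrite inE F'Pr finset.properEneq FF' sF.
  by move=> /(_ isT); rewrite pF'.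
by rewrite big1// => F FF; exfalso; apply: none; exists F.
Qed.

Definition half_const := expR 1 * (carleson_const p + 1 + carleson_const p).

(** On the cubes stopped at F the averages of f are at most e times that over F, which
    leaves the bilinear form of [H F] with g, bounded by [one_stop]; the
    three resulting sums are bounded by the Carleson embedding, the
    norm of g, and the Carleson embedding again. *)
Lemma upper_bound :
  \sum_(P in upper) t P * mass (fun x => f x * sg x) P * mass (fun x => g x * v x) P
   <= half_const * Kq `^ q^-1.
Proof.
have gv0 P : 0 <= mass (fun x => g x * v x) P.
  by apply: mass_ge0 => x; rewrite mulr_ge0.
have fs0 P : 0 <= mass (fun x => f x * sg x) P.
  by apply: mass_ge0 => x; rewrite mulr_ge0.
apply: (@le_trans _ _ (\sum_(F in Pr) \sum_(P in st F)
   t P * mass (fun x => f x * sg x) P * mass (fun x => g x * v x) P)).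
  rewrite (exchange_big_dep (fun P => P \in A))/=; last first.
    by move=> F P _ /st_sub[].
  apply: ler_sum => P PA; have [F sF] := stopped_exists phi PA.
  have FPr : F \in Pr by have /and3P[] := sF.
  rewrite (bigD1 F)/=; last by rewrite FPr inE PA.
  by rewrite lerDl sumr_ge0// => G _; rewrite !mulr_ge0.
apply: (@le_trans _ _ (\sum_(F in Pr) expR 1 * (kap *
   (phi F `^ p * mass sg F + \sum_(x in outer F) g x `^ s * v x +
    \sum_(G in kids F) phi G `^ p * mass sg G)))).
  apply: ler_sum => F FPr.
  apply: le_trans (ler_wpM2l (expR_ge0 1) (one_stop FPr)).
  rewrite /H /dyadic_op -(sum_mass (st F) (fun P => t P * mass sg P) (fun x => g x * v x)).
  rewrite mulrA big_distrr/=; apply: ler_sum => P /st_sub[PA _ sP].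
  rewrite mulrA ler_wpM2r// [leRHS]mulrCA ler_wpM2l//.
  have hP := stopped_le PA phi0 sP.
  have mP := msg0 (A_S PA).
  apply: le_trans (ler_wpM2r (ltW mP) hP).
  by rewrite /phi /density divfK// gt_eqF.
rewrite -!big_distrr/= /half_const -/kap -mulrA ler_pM2l ?expR_gt0// mulrC ler_pM2r//.
by rewrite !big_split/=; apply: lerD => //; exact: lerD.
Qed.

End half.

Lemma half_const_gt0 (R : realType) (p : R) : 1 < p -> 0 < half_const p.
Proof.
move=> p1; have h := carleson_const_gt0 p1.
by rewrite /half_const mulr_gt0 ?expR_gt0// !addr_gt0.
Qed.

(** * Strong type inequality from two testing conditions *)

Section strong.
Context {R : realType} {T : finType}.
Implicit Types (P Q F G : {set T}) (D : {set {set T}}) (h m : T -> R).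

Variables (S : {set {set T}}) (t : {set T} -> R) (sg v : T -> R).
Variables (p q r s Kq Kr : R).
Hypotheses (lS : laminar S) (t0 : forall P, 0 <= t P) (sg0 : forall x, 0 < sg x).
Hypotheses (v0 : forall x, 0 < v x) (S0 : forall P, P \in S -> exists x, x \in P).
Hypotheses (p1 : 1 < p) (s1 : 1 < s) (q1 : 1 < q) (r1 : 1 < r).
Hypotheses (qs : q^-1 + s^-1 = 1) (pr : p^-1 + r^-1 = 1) (pq : p <= q).
Hypotheses (Kq0 : 0 < Kq) (Kr0 : 0 < Kr).
Hypothesis testq : forall Q, Q \in S ->
  \sum_(x in Q) v x * dyadic_op (below S Q) t sg x `^ q <=
    Kq * mass sg Q `^ (q / p).
Hypothesis testr : forall Q, Q \in S ->
  \sum_(x in Q) sg x * dyadic_op (below S Q) t v x `^ r <=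
    Kr * mass v Q `^ (r / s).

Let C := half_const p * Kq `^ q^-1 + half_const s * Kr `^ r^-1.

Let p0 : 0 < p. Proof. exact: lt_trans p1. Qed.
Let q0 : 0 < q. Proof. exact: lt_trans q1. Qed.
Let s0 : 0 < s. Proof. exact: lt_trans s1. Qed.
Let r0 : 0 < r. Proof. exact: lt_trans r1. Qed.

Let sr : s <= r.
Proof.
rewrite -lef_pV2 ?posrE//.
have h : q^-1 <= p^-1 by rewrite lef_pV2 ?posrE.
have h1 := pr; have h2 := qs; lra.
Qed.

(* A cube outside both [upper] families has a zero average of f or of g. *)
Let bilinear f g : (forall x, 0 <= f x) -> (forall x, 0 <= g x) ->
  \sum_x f x `^ p * sg x <= 1 -> \sum_x g x `^ s * v x <= 1 ->
  \sum_x g x * v x * dyadic_op S t (fun y => f y * sg y) x <= C.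
Proof.
move=> f0 g0 f1 g1.
pose A := upper S sg v f g p s; pose A' := upper S v sg g f s p.
have u1 := upper_bound lS t0 sg0 v0 S0 f0 g0 p1 s1 q1 qs pq Kq0 testq f1 g1.
have rp : r^-1 + p^-1 = 1 by rewrite addrC.
have u2 := upper_bound lS t0 v0 sg0 S0 g0 f0 s1 p1 r1 rp sr Kr0 testr g1 f1.
rewrite /dyadic_op -(sum_mass S (fun P => t P * mass (fun y => f y * sg y) P)).
have F0 P : 0 <= t P * mass (fun y => f y * sg y) P * mass (fun y => g y * v y) P.
  by rewrite !mulr_ge0 ?mass_ge0// => x; rewrite mulr_ge0// ltW.
apply: le_trans (lerD u1 u2).
rewrite [X in _ + X](eq_bigr (fun P => t P * mass (fun y => f y * sg y) P *
   mass (fun y => g y * v y) P)); last by move=> P _; rewrite mulrAC.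
rewrite -/A -/A' (bigID (fun P => P \in A))/=; apply: lerD.
  rewrite (eq_bigl (fun P => P \in A))// => P.
  by case PA : (P \in A); rewrite ?andbF// andbT; move: PA; rewrite inE => /andP[].
rewrite [leRHS](bigID (fun P => P \in A))/=; apply: ler_wpDl; first exact: sumr_ge0.
rewrite [leRHS]big_mkcond/= big_mkcond/=; apply: ler_sum => P _.
case: ifPn => [/andP[PS PA]|_]; last by case: ifP.
rewrite PA andbT; case: ifPn => // PA'.
have [x xP] := S0 PS.
have ms := mass_gt0 sg0 xP; have mv := mass_gt0 v0 xP.
have [fz|fz] := eqVneq (mass (fun y => f y * sg y) P) 0.
  by rewrite fz mulr0 mul0r.
have [gz|gz] := eqVneq (mass (fun y => g y * v y) P) 0.
  by rewrite gz mulr0.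
have df : 0 < density f sg P.
  rewrite divr_gt0// lt_neqAle eq_sym fz mass_ge0// => y.
  by rewrite mulr_ge0// ltW.
have dg : 0 < density g v P.
  rewrite divr_gt0// lt_neqAle eq_sym gz mass_ge0// => y.
  by rewrite mulr_ge0// ltW.
move: PA PA'; rewrite !inE PS df dg/= -!ltNge => h1 h2.
by have := lt_trans h1 h2; rewrite ltxx.
Qed.

(** Homogeneity reduces to f of norm 1, and g = u^(q-1), normalised, turns the bilinear
    bound into a bound on the q-norm of u = T f. *)
Lemma strong_type f : (forall x, 0 <= f x) ->
  \sum_x v x * dyadic_op S t (fun y => f y * sg y) x `^ q <=
    C `^ q * (\sum_x f x `^ p * sg x) `^ (q / p).
Proof.
move=> f0; set F := \sum_x f x `^ p * sg x.
have F0 : 0 <= F by apply: sumr_ge0 => x _; rewrite mulr_ge0 ?powR_ge0// ltW.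
have pow1 (X c : R) : 0 < X -> 0 < c -> (X `^ (- c^-1)) `^ c = X^-1.
  by move=> X0 c0; rewrite -powRrM mulNr mulVf ?gt_eqF// powR_inv1// ltW.
have [Fz|Fz] := eqVneq F 0.
  have fz x : f x = 0.
    move: Fz => /eqP; rewrite psumr_eq0; last first.
      by move=> y _; rewrite mulr_ge0 ?powR_ge0// ltW.
    move=> /allP/(_ x (mem_index_enum _)); rewrite /= mulf_eq0 (gt_eqF (sg0 x)) orbF.
    by rewrite powR_eq0 => /andP[/eqP].
  rewrite big1 ?mulr_ge0 ?powR_ge0// => x _; rewrite /dyadic_op big1 ?powR0 ?mulr0 ?gt_eqF//.
  by move=> P _; rewrite /mass big1 ?mulr0// => y _; rewrite fz mul0r.
have Fp : 0 < F by rewrite lt_neqAle eq_sym Fz.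
pose c := F `^ (- p^-1); have c0 : 0 < c by exact: powR_gt0.
pose f' x := c * f x.
have f'0 x : 0 <= f' x by rewrite mulr_ge0// ltW.
have f'1 : \sum_x f' x `^ p * sg x <= 1.
  rewrite (eq_bigr (fun x => c `^ p * (f x `^ p * sg x))); last first.
    by move=> x _; rewrite powRM ?(ltW c0)// mulrA.
  by rewrite -big_distrr/= -/F /c pow1// mulVf.
pose u x := dyadic_op S t (fun y => f' y * sg y) x.
have u0 x : 0 <= u x by apply: dyadic_op_ge0 => // y; rewrite mulr_ge0// ltW.
have uE x : u x = c * dyadic_op S t (fun y => f y * sg y) x.
  rewrite /u /dyadic_op big_distrr/=; apply: eq_bigr => P _.
  rewrite mulrCA; congr (_ * _); rewrite /mass big_distrr/=.
  by apply: eq_bigr => y _; rewrite /f' mulrA.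
pose U := \sum_x v x * u x `^ q.
have U0 : 0 <= U by apply: sumr_ge0 => x _; rewrite mulr_ge0 ?powR_ge0// ltW.
have UE : U = c `^ q * \sum_x v x * dyadic_op S t (fun y => f y * sg y) x `^ q.
  rewrite /U big_distrr/=; apply: eq_bigr => x _; rewrite uE powRM ?(ltW c0)//.
    by rewrite mulrCA.
  by apply: dyadic_op_ge0 => // y; rewrite mulr_ge0// ltW.
have cq : c `^ q * F `^ (q / p) = 1.
  rewrite /c -powRrM -powRD_gt0// (_ : _ + _ = 0) ?powRr0//; field.
  by rewrite gt_eqF.
suff UC : U <= C `^ q.
  have cq0 : 0 < c `^ q by exact: powR_gt0.
  by rewrite -(ler_pM2l cq0) -UE mulrCA cq mulr1.
have [->|Uz] := eqVneq U 0; first exact: powR_ge0.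
have Up : 0 < U by rewrite lt_neqAle eq_sym Uz.
pose g x := U `^ (- s^-1) * u x `^ (q - 1).
have g0 x : 0 <= g x by rewrite mulr_ge0 ?powR_ge0.
have qs' : (q - 1) * s = q.
  have : s = q / (q - 1).
    apply/(@invr_inj R); rewrite invf_div; have := qs => /(canRL (addKr _)) ->.
    by field; rewrite gt_eqF.
  move=> ->; field; by rewrite gt_eqF// subr_gt0.
have g1 : \sum_x g x `^ s * v x <= 1.
  rewrite (eq_bigr (fun x => U^-1 * (v x * u x `^ q))); last first.
    move=> x _; rewrite powRM ?powR_ge0// pow1// -powRrM qs'.
    by rewrite -mulrA; congr (_ * _); rewrite mulrC.
  by rewrite -big_distrr/= -/U mulVf.
have := bilinear f'0 g0 f'1 g1.
have -> : \sum_x g x * v x * dyadic_op S t (fun y => f' y * sg y) x = U `^ q^-1.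
  rewrite (eq_bigr (fun x => U `^ (- s^-1) * (v x * u x `^ q))); last first.
    move=> x _; rewrite -/(u x) -(mulr_powRB1 (u0 x) q0) /g; ring.
  rewrite -big_distrr/= -/U -{2}(powRr1 U0) -powRD_gt0//; congr (_ `^ _).
  by have := qs => /(canRL (addrK _)) ->; rewrite addrC.
move=> /(powR_le (ltW q0) (powR_ge0 _ _)).
by rewrite -powRrM mulVf ?gt_eqF// powRr1.
Qed.

End strong.

(** * Weighted bounds for the finite model *)

Section model.
Context {R : realType} {T : finType}.
Variables (mu sg v : T -> R) (S : {set {set T}}) (a p q r s A B A' B' : R).
Hypotheses (lS : laminar S) (dS : doubling mu S).
Hypotheses (mu0 : forall x, 0 < mu x) (sg0 : forall x, 0 < sg x).
Hypotheses (v0 : forall x, 0 < v x) (S0 : forall P, P \in S -> exists x, x \in P).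
Hypotheses (a01 : 0 < a < 1) (p1 : 1 < p) (q1 : 1 < q) (r1 : 1 < r) (s1 : 1 < s).
Hypotheses (pr : p^-1 + r^-1 = 1) (qs : q^-1 + s^-1 = 1) (apq : a = p^-1 - q^-1).
Hypotheses (A1 : 1 <= A) (B0 : 0 < B).
Hypothesis muckA : forall P, P \in S -> 1 <= muckenhoupt mu sg v q r P <= A.
Hypothesis muckB : forall P, P \in S -> muckenhoupt mu sg v q r P `^ (r / q) *
  (\sum_(x in P) mu x * dmax (mean_val mu v) (below S P) x) <= B `^ r * mass v P.

Let p0 : 0 < p. Proof. exact: lt_trans p1. Qed.
Let q0 : 0 < q. Proof. exact: lt_trans q1. Qed.
Let s0 : 0 < s. Proof. exact: lt_trans s1. Qed.
Let r0 : 0 < r. Proof. exact: lt_trans r1. Qed.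
Let pq : p <= q.
Proof.
rewrite -lef_pV2 ?posrE//.
have := a01; rewrite apq => /andP[h _]; lra.
Qed.
Let aqr : 1 - a = q^-1 + r^-1.
Proof. have h1 := pr; have h2 := apq; lra. Qed.

Let ar : 1 + a * r = r * (1 - q^-1).
Proof.
have -> : a = 1 - q^-1 - r^-1 by have h2 := aqr; lra.
by field; rewrite !gt_eqF.
Qed.

Let aq : 1 + a * q = q / p.
Proof. by rewrite apq; field; rewrite !gt_eqF. Qed.

Let t0 P : 0 <= riesz_coef a mu P. Proof. exact: powR_ge0. Qed.

Lemma testing_const_gt0 a' x y : 0 < a' < 1 -> 0 < x -> 0 < y -> 0 < testing_const a' x y :> R.
Proof.
move=> /andP[h1 h2] x0 y0; have h3 : 0 < 1 - a' by rewrite subr_gt0.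
rewrite /testing_const /hedberg_const /dmax_const !mulr_gt0 ?powR_gt0 ?expR_gt0 ?geo_gt0//.
by rewrite addr_gt0// geo_gt0.
Qed.

Lemma addr1_ln_gt0 x : 1 <= x -> 0 < 1 + ln x :> R.
Proof. by move=> x1; rewrite ltr_pwDl// ln_ge0. Qed.

Let Kr := testing_const a q r * (1 + ln A) * B `^ r.
Let Kr0 : 0 < Kr.
Proof. by apply: mulr_gt0 (powR_gt0 _ B0); apply: mulr_gt0 (testing_const_gt0 a01 q0 r0) (addr1_ln_gt0 A1). Qed.

Let KrE x : 0 < x -> Kr `^ (x / r) = testing_const a q r `^ (x / r) *
  ((1 + ln A) `^ r^-1 * B) `^ x.
Proof.
move=> x0; have tc0 := testing_const_gt0 a01 q0 r0; have ph := addr1_ln_gt0 A1.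
rewrite /Kr -mulrA powRM ?(ltW tc0)//; last by rewrite mulr_ge0 ?powR_ge0// ltW.
congr (_ * _); rewrite powRM ?powR_ge0 ?(ltW ph)// [in RHS]powRM ?powR_ge0 ?(ltW B0)//.
rewrite -!powRrM; congr (_ `^ _ * _ `^ _); first exact: mulrC.
by field; rewrite gt_eqF.
Qed.

Let testr Q : Q \in S ->
  \sum_(x in Q) sg x * dyadic_op (below S Q) (riesz_coef a mu) v x `^ r <=
    Kr * mass v Q `^ (r * (1 - q^-1)).
Proof.
by move=> QS; rewrite -ar; exact: (testing lS dS mu0 sg0 v0 S0 a01 q0 r0 aqr muckA muckB).
Qed.

(** The constants below depend on the exponents only. *)
Definition finite_weak_const : R := (good_lambda_const q * testing_const a q r `^ (q / r)) `^ q^-1.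

Lemma finite_weak f l : (forall x, 0 <= f x) -> 0 < l ->
  l `^ q * \sum_(x | l < dyadic_op S (riesz_coef a mu) (fun y => f y * sg y) x) v x <=
    (finite_weak_const * ((1 + ln A) `^ r^-1 * B)) `^ q * (\sum_x f x `^ p * sg x) `^ (q / p).
Proof.
move=> f0 l0.
apply: le_trans (weak_type lS t0 (fun x => ltW (sg0 x)) v0 S0 f0 p1 r1 pr pq Kr0 testr l0) _.
have w0 : 0 <= good_lambda_const q * testing_const a q r `^ (q / r).
  by rewrite /good_lambda_const !mulr_ge0 ?powR_ge0.
have wE : finite_weak_const `^ q = good_lambda_const q * testing_const a q r `^ (q / r).
  by rewrite /finite_weak_const -[LHS]powRrM mulVf ?gt_eqF// powRr1.
have X0 : 0 <= (1 + ln A) `^ r^-1 * B by rewrite mulr_ge0 ?powR_ge0// ltW.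
by rewrite (powRM q (powR_ge0 _ _ : 0 <= finite_weak_const) X0) wE KrE// !mulrA.
Qed.

Hypotheses (A'1 : 1 <= A') (B'0 : 0 < B').
Hypothesis muckA' : forall P, P \in S -> 1 <= muckenhoupt mu v sg r q P <= A'.
Hypothesis muckB' : forall P, P \in S -> muckenhoupt mu v sg r q P `^ (q / r) *
  (\sum_(x in P) mu x * dmax (mean_val mu sg) (below S P) x) <= B' `^ q * mass sg P.

Let Kq := testing_const a r q * (1 + ln A') * B' `^ q.
Let Kq0 : 0 < Kq.
Proof. by apply: mulr_gt0 (powR_gt0 _ B'0); apply: mulr_gt0 (testing_const_gt0 a01 r0 q0) (addr1_ln_gt0 A'1). Qed.

Let testq Q : Q \in S ->
  \sum_(x in Q) v x * dyadic_op (below S Q) (riesz_coef a mu) sg x `^ q <=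
    Kq * mass sg Q `^ (q / p).
Proof.
have arq : 1 - a = r^-1 + q^-1 by rewrite aqr addrC.
by move=> QS; rewrite -aq; exact: (testing lS dS mu0 v0 sg0 S0 a01 r0 q0 arq muckA' muckB').
Qed.

Definition finite_strong_const : R := half_const s * testing_const a q r `^ r^-1.
Definition finite_strong_const' : R := half_const p * testing_const a r q `^ q^-1.

Lemma finite_strong f : (forall x, 0 <= f x) ->
  \sum_x v x * dyadic_op S (riesz_coef a mu) (fun y => f y * sg y) x `^ q <=
    (finite_strong_const * ((1 + ln A) `^ r^-1 * B) + finite_strong_const' * ((1 + ln A') `^ q^-1 * B')) `^ q
     * (\sum_x f x `^ p * sg x) `^ (q / p).
Proof.
move=> f0.
have testr' Q : Q \in S ->
  \sum_(x in Q) sg x * dyadic_op (below S Q) (riesz_coef a mu) v x `^ r <=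
    Kr * mass v Q `^ (r / s).
  by have -> : s^-1 = 1 - q^-1; [have h := qs; lra|exact: testr].
have st := strong_type lS t0 sg0 v0 S0 p1 s1 q1 r1 qs pr pq Kq0 Kr0
  testq testr' f0.
have e : Kr `^ r^-1 = testing_const a q r `^ r^-1 * ((1 + ln A) `^ r^-1 * B).
  have := KrE ltr01; rewrite mul1r => ->; rewrite (powRr1 (_ : 0 <= _ * B))//.
  by rewrite mulr_ge0 ?powR_ge0// ltW.
have e' : Kq `^ q^-1 = testing_const a r q `^ q^-1 * ((1 + ln A') `^ q^-1 * B').
  have tc0 := testing_const_gt0 a01 r0 q0; have ph := addr1_ln_gt0 A'1.
  rewrite /Kq -mulrA powRM ?(ltW tc0)//; last by rewrite mulr_ge0 ?powR_ge0// ltW.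
  congr (_ * _); rewrite powRM ?powR_ge0 ?(ltW ph)//.
  by rewrite -!powRrM mulfV ?gt_eqF// (powRr1 (ltW B'0)).
have E : half_const s * Kr `^ r^-1 = finite_strong_const * ((1 + ln A) `^ r^-1 * B).
  by rewrite e /finite_strong_const mulrA.
have E' : half_const p * Kq `^ q^-1 = finite_strong_const' * ((1 + ln A') `^ q^-1 * B').
  by rewrite e' /finite_strong_const' mulrA.
have E2 : half_const p * Kq `^ q^-1 + half_const s * Kr `^ r^-1 =
    finite_strong_const * ((1 + ln A) `^ r^-1 * B) + finite_strong_const' * ((1 + ln A') `^ q^-1 * B').
  exact (etrans (f_equal2 (fun x y : R => x + y) E' E) (addrC _ _)).
have subst_const (U c c' F : R) : U <= c `^ q * F -> c = c' -> U <= c' `^ q * F.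
  by move=> Uc <-.
exact (subst_const _ _ _ _ st E2).
Qed.

End model.

Local Open Scope classical_set_scope.
Local Open Scope ring_scope.

(** * Integrals of nonnegative functions, null sets *)

Lemma poweR_le (R : realType) (x y : \bar R) (r : R) : 0 <= r -> (0 <= x)%E ->
  (x <= y)%E -> (x `^ r <= y `^ r)%E.
Proof.
move=> r0 x0 xy; apply: (gt0_ler_poweR r0) => //; rewrite in_itv/= leey andbT//.
exact: le_trans xy.
Qed.

Section integral_ae.
Local Open Scope ereal_scope.
Context d (T : measurableType d) (R : realType).
Variable mu : {measure set T -> \bar R}.
Implicit Types (f g : T -> \bar R) (D : set T).
Import HBNNSimple.

(** Stated without measurability, since weights are only Lebesgue measurable and the
    maximal function of a weight is integrated as it stands.  The integral is a
    supremum over simple functions h below f; cutting h to zero on the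
    exceptional null set makes it a simple function below g. *)
Lemma ge0_le_integral_ae f g : (forall x, 0 <= f x) -> (forall x, 0 <= g x) ->
  {ae mu, forall x, f x <= g x} -> \int[mu]_x f x <= \int[mu]_x g x.
Proof.
move=> f0 g0 [N [mN N0 fgN]]; rewrite !ge0_integralTE//.
apply: ge_ereal_sup => _ [h /= hf <-].
have [h' h'E] : exists h' : {nnsfun T >-> R},
    forall x, h' x = (h x * \1_(~` N) x)%R.
  by exists (proj_nnsfun h (measurableC mN)).
apply: ereal_sup_ubound; exists h'.
  move=> x; rewrite /= h'E indicE; case: (pselect (N x)) => Nx.
    by rewrite memNset ?mulr0//=; apply.
  rewrite mem_set// mulr1; apply: le_trans (hf x) _.
  by apply: contrapT => nfg; apply: Nx; apply: fgN.
have sE (k : {nnsfun T >-> R}) : sintegral mu k = \int[mu]_x (k x)%:E.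
  by rewrite (integral_nnsfun mu measurableT) patch_setT.
rewrite !sE; apply: ge0_ae_eq_integral => //.
- by apply/measurable_EFinP.
- by apply/measurable_EFinP.
- by move=> x _; rewrite lee_fin.
- by move=> x _; rewrite lee_fin.
exists N; split => // x /= /not_implyP[_]; apply: contra_notP => Nx.
by rewrite h'E indicE mem_set// mulr1.
Qed.

Lemma ge0_le_integral_any_ae D f g : (forall x, 0 <= f x) -> (forall x, 0 <= g x) ->
  {ae mu, forall x, D x -> f x <= g x} ->
  \int[mu]_(x in D) f x <= \int[mu]_(x in D) g x.
Proof.
move=> f0 g0 fg; rewrite !(integral_mkcond D); apply: ge0_le_integral_ae.
- exact: erestrict_ge0.
- exact: erestrict_ge0.
- apply: filterS fg => x fg; rewrite !patchE; case: ifPn => //.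
  by rewrite inE => /fg.
Qed.

Lemma ge0_le_integral_any D f g : (forall x, 0 <= f x) -> (forall x, 0 <= g x) ->
  (forall x, D x -> f x <= g x) ->
  \int[mu]_(x in D) f x <= \int[mu]_(x in D) g x.
Proof. by move=> f0 g0 fg; apply: ge0_le_integral_any_ae => //; exact/aeW. Qed.

Lemma ge0_eq_integral_ae D f g : (forall x, 0 <= f x) -> (forall x, 0 <= g x) ->
  {ae mu, forall x, f x = g x} ->
  \int[mu]_(x in D) f x = \int[mu]_(x in D) g x.
Proof.
move=> f0 g0 fg; apply/eqP; rewrite eq_le; apply/andP.
by split; apply: ge0_le_integral_any_ae => //; apply: filterS fg => x ->.
Qed.

Lemma ge0_subset_integral_any (A B : set T) f : (forall x, 0 <= f x) -> A `<=` B ->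
  \int[mu]_(x in A) f x <= \int[mu]_(x in B) f x.
Proof.
move=> f0 AB; rewrite !(integral_mkcond _ f); apply: ge0_le_integral_any.
- exact: erestrict_ge0.
- exact: erestrict_ge0.
- move=> x _; rewrite !patchE; case: ifPn => [/set_mem/AB/mem_set ->//|_].
  by case: ifP.
Qed.

Lemma eq_integral_ae f g : {ae mu, forall x, f x = g x} ->
  \int[mu]_x f x = \int[mu]_x g x.
Proof.
move=> fg; rewrite integralE [RHS]integralE; congr (_ - _).
  apply: ge0_eq_integral_ae; [exact: funepos_ge0|exact: funepos_ge0|].
  by apply: filterS fg => x; rewrite !funeposE => ->.
apply: ge0_eq_integral_ae; [exact: funeneg_ge0|exact: funeneg_ge0|].
by apply: filterS fg => x; rewrite !funenegE => ->.
Qed.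

End integral_ae.

Section weights_ae.
Local Open Scope ereal_scope.
Context (R : realType) (n : nat).
Local Notation E := (Rn R n).
Local Notation mu := (lebesgue_Rn R n).
Implicit Types (f : E -> R) (u v : E -> \bar R) (Q : set E).

Lemma epow_ge0 (x : \bar R) (r : R) : 0 <= epow x r.
Proof. by rewrite /epow; case: ifP => _; rewrite ?inve_ge0 ?poweR_ge0. Qed.

Lemma epow_nneg (x : \bar R) (r : R) : (0 <= r)%R -> epow x r = x `^ r.
Proof. by move=> r0; rewrite /epow ltNge r0. Qed.

Lemma avg_ge0 v Q : (forall x, 0 <= v x) -> 0 <= avg v Q.
Proof. by move=> v0; rewrite mule_ge0 ?integral_ge0 ?inve_ge0. Qed.

Lemma cubes_unit : cubes (cube ([tuple of nseq n (0%R : R)] : Rn R n) 1).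
Proof. by exists [tuple of nseq n (0%R : R)], 1%R. Qed.

Lemma mixed_const_ge0 r b c v : 0 <= mixed_const r b c v.
Proof.
apply: ereal_sup_ge; eexists; first by eexists; [exact: cubes_unit|].
by rewrite mule_ge0 ?epow_ge0.
Qed.

Lemma maximal_ge0 v x : (exists2 Q : set E, cubes Q & Q x) -> 0 <= maximal v x.
Proof.
move=> [Q cQ Qx]; apply: ereal_sup_ge; eexists; first by exists Q.
by apply: avg_ge0 => y /=.
Qed.

(** All quantities of the theorem depend on the weights up to null sets only, which allows
    to replace a Lebesgue measurable weight by a Borel one. *)

Section congruence.
Variables (u v : E -> \bar R).
Hypotheses (u0 : forall x, 0 <= u x) (v0 : forall x, 0 <= v x).
Hypothesis uv : {ae mu, forall x, u x = v x}.

Lemma avg_ae Q : avg u Q = avg v Q.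
Proof. by rewrite /avg; congr (_ / _); exact: ge0_eq_integral_ae. Qed.

Lemma A_loc_ae r Q : A_loc r u Q = A_loc r v Q.
Proof.
rewrite /A_loc avg_ae; congr (_ * epow _ _); rewrite /avg; congr (_ / _).
apply: ge0_eq_integral_ae => [x|x|]; [exact: epow_ge0..|].
by apply: filterS uv => x ->.
Qed.

Lemma A_const_ae r : A_const r u = A_const r v.
Proof.
have eA : A_loc r u = A_loc r v by apply/funext => Q; exact: A_loc_ae.
by rewrite /A_const eA.
Qed.

Lemma wmeas_ae A : wmeas u A = wmeas v A.
Proof. exact: ge0_eq_integral_ae. Qed.

Lemma maximal_ae Q x : maximal (u \_ Q) x = maximal (v \_ Q) x.
Proof.
have e Q' : avg (abse \o (u \_ Q)) Q' = avg (abse \o (v \_ Q)) Q'.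
  rewrite /avg; congr (_ / _); apply: ge0_eq_integral_ae; [by move=> y /=|by move=> y /=|].
  by apply: filterS uv => y uvy /=; rewrite !patchE uvy.
rewrite /maximal; congr ereal_sup; apply/seteqP.
by split => _ [Q' cQ <-]; exists Q' => //; rewrite e.
Qed.

Lemma AMinf_loc_ae Q : AMinf_loc u Q = AMinf_loc v Q.
Proof.
have e : maximal (u \_ Q) = maximal (v \_ Q).
  by apply/funext => x; exact: maximal_ae.
by rewrite /AMinf_loc e wmeas_ae.
Qed.

Lemma mixed_const_ae r b c : mixed_const r b c u = mixed_const r b c v.
Proof.
have eA : A_loc r u = A_loc r v by apply/funext => Q; exact: A_loc_ae.
have eM : AMinf_loc u = AMinf_loc v by apply/funext => Q; exact: AMinf_loc_ae.
by rewrite /mixed_const eA eM.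
Qed.

Lemma strong_norm_ae_weight p g : strong_norm p u g = strong_norm p v g.
Proof.
rewrite /strong_norm; congr epow; apply: ge0_eq_integral_ae.
- by move=> x; rewrite mule_ge0 ?epow_ge0.
- by move=> x; rewrite mule_ge0 ?epow_ge0.
- by apply: filterS uv => x ->.
Qed.

Lemma weak_norm_ae_weight q g : weak_norm q u g = weak_norm q v g.
Proof.
have e : wmeas u = wmeas v by apply/funext => A; exact: wmeas_ae.
by rewrite /weak_norm e.
Qed.

End congruence.

Lemma strong_norm_ae p v f g : (forall x, 0 <= v x) ->
  {ae mu, forall x, f x = g x} ->
  strong_norm p v (EFin \o f) = strong_norm p v (EFin \o g).
Proof.
move=> v0 fg; rewrite /strong_norm.
suff -> : \int[mu]_x (epow `|(EFin \o f) x| p * v x) =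
    \int[mu]_x (epow `|(EFin \o g) x| p * v x) by [].
apply: ge0_eq_integral_ae.
- by move=> x; rewrite mule_ge0 ?epow_ge0.
- by move=> x; rewrite mule_ge0 ?epow_ge0.
- by apply: filterS fg => x /= ->.
Qed.

Lemma riesz_ae al f g x : {ae mu, forall x, f x = g x} ->
  riesz al f x = riesz al g x.
Proof.
by move=> fg; apply: eq_integral_ae; apply: filterS fg => y ->.
Qed.

End weights_ae.

(** * Cubes *)

Section cubes.
Context (R : realType) (n : nat).
Local Notation E := (Rn R n).
Local Notation mu := (lebesgue_Rn R n).
Implicit Types (a : E) (l : R).

(** Half-open cubes tile; they differ from the closed ones by a null set. *)
Definition hcube a l : set E :=
  [set x | forall i, tnth a i <= tnth x i < tnth a i + l].

Lemma measurable_box (A : 'I_n -> set (measurableTypeR R)) :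
  (forall i, measurable (A i)) -> measurable [set x : E | forall i, A i (tnth x i)].
Proof.
move=> mA; rewrite (_ : [set x : E | _] = \bigcap_(i in [set: 'I_n])
    ((@tnth n _ ^~ i) @^-1` A i)).
  apply: fin_bigcap_measurable => // i _.
  by rewrite -[X in measurable X]setTI; exact: measurable_tnth.
by apply/seteqP; split => [x Bx i _|x Bx i]; [exact: Bx|exact: (Bx i)].
Qed.

Lemma cubeE a l : cube a l = [set x : E | forall i,
  [set` `[tnth a i, tnth a i + l]] (tnth x i)].
Proof. by apply/seteqP; split => x /= h i; have := h i; rewrite /= in_itv. Qed.

Lemma hcubeE a l : hcube a l = [set x : E | forall i,
  [set` `[tnth a i, tnth a i + l[] (tnth x i)].
Proof. by apply/seteqP; split => x /= h i; have := h i; rewrite /= in_itv. Qed.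

Lemma measurable_cube a l : measurable (cube a l).
Proof. rewrite cubeE.
by apply: (measurable_box (A := fun i => [set` `[tnth a i, tnth a i + l]])). Qed.

Lemma measurable_hcube a l : measurable (hcube a l).
Proof. rewrite hcubeE.
by apply: (measurable_box (A := fun i => [set` `[tnth a i, tnth a i + l[])). Qed.

Let volume_itv b a l : 0 < l -> mu [set x : E | forall i,
  [set` Interval (BLeft (tnth a i)) (BSide b (tnth a i + l))] (tnth x i)] = (l ^+ n)%:E.
Proof.
move=> l0; rewrite (@lebesgue_Rn_box R n (fun i =>
  [set` Interval (BLeft (tnth a i)) (BSide b (tnth a i + l))]))//.
rewrite (eq_bigr (fun=> l%:E)); last first.
  move=> i _; rewrite lebesgue_measure_itv/= lte_fin ltrDl l0.
  by rewrite -EFinD addrAC subrr add0r.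
by rewrite prodEFin prodr_const card_ord.
Qed.

Lemma volume_cube a l : 0 < l -> mu (cube a l) = (l ^+ n)%:E.
Proof. by move=> l0; rewrite cubeE; exact: volume_itv. Qed.

Lemma volume_hcube a l : 0 < l -> mu (hcube a l) = (l ^+ n)%:E.
Proof. by move=> l0; rewrite hcubeE; exact: volume_itv. Qed.

Lemma hcube_sub a l : hcube a l `<=` cube a l.
Proof. by move=> x h i; have /andP[-> /ltW] := h i. Qed.

Lemma cube_hcube_null a l : 0 < l -> mu (cube a l `\` hcube a l) = 0%E.
Proof.
move=> l0; have mc := measurable_cube a l; have mh := measurable_hcube a l.
have h : (mu (cube a l) < +oo)%E by rewrite volume_cube// ltry.
rewrite measureD//; last first.
rewrite (_ : cube a l `&` hcube a l = hcube a l); last first.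
  by rewrite setIC; apply/setIidPl; exact: hcube_sub.
transitivity (mu (cube a l) - mu (hcube a l))%E; first by [].
by rewrite volume_cube// volume_hcube// subee.
Qed.

Lemma integral_cube_hcube a l (f : E -> \bar R) : 0 < l ->
  (forall x, 0 <= f x)%E ->
  (\int[mu]_(x in cube a l) f x = \int[mu]_(x in hcube a l) f x)%E.
Proof.
move=> l0 f0; apply/eqP; rewrite eq_le; apply/andP; split; last first.
  by apply: ge0_subset_integral_any => //; exact: hcube_sub.
rewrite !(integral_mkcond _ f); apply: ge0_le_integral_ae.
- exact: erestrict_ge0.
- exact: erestrict_ge0.
- exists (cube a l `\` hcube a l); split.
  + by apply: measurableD; [exact: measurable_cube|exact: measurable_hcube].
  + exact: cube_hcube_null.
  + move=> x /=; rewrite !patchE => h; split.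
      apply: contrapT => nc; apply: h; rewrite memNset//.
      by case: ifP.
    by move=> hc; apply: h; rewrite (mem_set hc) mem_set//; exact: hcube_sub.
Qed.

Lemma cubes_cube a l : 0 < l -> cubes (cube a l).
Proof. by move=> l0; exists a, l. Qed.

Definition ncube (N : nat) : set E :=
  cube [tuple - N.+1%:R : R | i < n] (2 * N.+1%:R).

Lemma ncube_cubes N : cubes (ncube N).
Proof. by apply: cubes_cube; rewrite mulr_gt0. Qed.

Lemma ncubeP N x : ncube N x <-> forall i, `|tnth x i| <= N.+1%:R.
Proof.
split => h i; have := h i; rewrite /= tnth_mktuple ler_norml; last first.
  by move=> /andP[h1 h2]; apply/andP; split; lra.
by move=> /andP[h1 h2]; apply/andP; split; lra.
Qed.

Lemma ncube_exhaust : \bigcup_N ncube N = setT.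
Proof.
apply/seteqP; split => // x _.
pose M := \big[Num.max/0]_(i < n) `|tnth x i|.
exists (Num.truncn M) => //; apply/ncubeP => i.
apply: le_trans (ltW (truncnS_gt M)); rewrite /M (bigD1 i)//=.
by rewrite le_max lexx.
Qed.

Lemma ncube_nd N M : (N <= M)%N -> ncube N `<=` ncube M.
Proof.
move=> NM x /ncubeP h; apply/ncubeP => i; apply: le_trans (h i) _.
by rewrite ler_nat ltnS.
Qed.

End cubes.

(** * A Muckenhoupt weight vanishes almost everywhere or almost nowhere *)

Section dichotomy.
Local Open Scope ereal_scope.
Context (R : realType) (n : nat).
Local Notation E := (Rn R n).
Local Notation mu := (lebesgue_Rn R n).
Variables (u : E -> R) (q s : R).
Hypotheses (mu_ : measurable_fun setT u) (u0 : forall x, (0 <= u x)%R).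
Hypotheses (q0 : (0 < q)%R) (s1 : (1 < s)%R).
Hypothesis fin : A_const s (wpow u q) < +oo.

Lemma wpow_nneg x : wpow u q x = (u x `^ q)%:E.
Proof. by rewrite /wpow epow_nneg// ltW. Qed.

Lemma measurable_wpow_nneg : measurable_fun setT (wpow u q).
Proof.
rewrite (_ : wpow u q = EFin \o (fun x => u x `^ q)%R).
  by apply/measurable_EFinP; apply: (measurableT_comp (measurable_powR q) mu_).
by apply/funext => x; rewrite wpow_nneg.
Qed.

Let Z : set E := [set x | u x = 0%R].
Let mZ : measurable Z.
Proof. by rewrite -[Z]setTI; exact: (mu_ measurableT (measurable_set1 0%R)). Qed.

Let v0 x : 0 <= wpow u q x. Proof. exact: epow_ge0. Qed.

Let neg : (1 - conj_exp s < 0)%R.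
Proof.
rewrite /conj_exp (_ : (_ - _ = - (s - 1)^-1)%R).
  by rewrite oppr_lt0 invr_gt0 subr_gt0.
by field; rewrite subr_eq0 gt_eqF.
Qed.

(* On a cube where u vanishes on a set of positive measure, the average of the
   negative power of u is infinite, and finiteness of A_s forces the average of u^q to
   be zero. *)
Let vanish N : mu (Z `&` ncube N) != 0 -> {ae mu, forall x, ncube N x -> u x = 0%R}.
Proof.
move=> ZN; set Q : set E := ncube N.
have cQ : cubes Q by exact: ncube_cubes.
have mQ : measurable Q by exact: measurable_cube.
have [l [l0 muQ]] : exists l : R, (0 < l)%R /\ mu Q = l%:E.
  have l0 : (0 < 2 * N.+1%:R :> R)%R by rewrite mulr_gt0.
  by exists ((2 * N.+1%:R) ^+ n)%R; rewrite exprn_gt0// /Q /ncube volume_cube.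
have I : \int[mu]_(x in Q) epow (wpow u q x) (1 - conj_exp s) = +oo.
  apply/eqP; rewrite -leye_eq.
  apply: (@le_trans _ _ (\int[mu]_(x in Z `&` Q) epow (wpow u q x) (1 - conj_exp s))).
    rewrite (eq_integral (cst +oo)).
      by rewrite integral_cst; [rewrite gt0_mulye// lt0e ZN measure_ge0|exact: measurableI].
    move=> x /set_mem[Zx _]; rewrite wpow_nneg Zx powR0 ?gt_eqF//.
    by rewrite /epow neg poweR_EFin powR0 ?inve0// oppr_eq0 lt_eqF.
  by apply: ge0_subset_integral_any => [x|]; [exact: epow_ge0|exact: subIsetr].
have J : epow (avg (fun x => epow (wpow u q x) (1 - conj_exp s)) Q) (s - 1) = +oo.
  rewrite /avg I muQ inver gt_eqF// gt0_mulye ?lte_fin ?invr_gt0//.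
  by rewrite epow_nneg ?subr_ge0 ?(ltW s1)// poweRyr// subr_eq0 gt_eqF.
have a0 : avg (wpow u q) Q = 0.
  apply/eqP/negPn/negP => a0.
  have ap : 0 < avg (wpow u q) Q by rewrite lt0e a0 avg_ge0.
  have : A_loc s (wpow u q) Q <= A_const s (wpow u q).
    by apply: ereal_sup_ubound; exists Q.
  by rewrite /A_loc J gt0_muley// leye_eq => /eqP h; move: fin; rewrite h ltxx.
have i0 : \int[mu]_(x in Q) `|wpow u q x| = 0.
  move: a0; rewrite /avg muQ inver gt_eqF// => /eqP; rewrite mule_eq0.
  rewrite eqe invr_eq0 (gt_eqF l0) orbF => /eqP <-.
  by apply: eq_integral => x _; rewrite gee0_abs.
have mv : measurable_fun Q (wpow u q).
  by apply: measurable_funTS; exact: measurable_wpow_nneg.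
have [h _] := ae_eq_integral_abs mu mQ mv.
apply: filterS (h i0) => x {}h Qx; have := h Qx; rewrite wpow_nneg => -[].
exact: powR_eq0_eq0.
Qed.

(** The cubes exhaust the space increasingly, so that one bad cube makes all the
    larger ones bad. *)
Lemma weight_dichotomy : {ae mu, forall x, u x = 0%R} \/ {ae mu, forall x, (0 < u x)%R}.
Proof.
have [[N0 hN]|none] := pselect (exists N, mu (Z `&` ncube N) != 0); [left|right].
  have h : forall N, {ae mu, forall x, ncube (N0 + N) x -> u x = 0%R}.
    move=> N; apply: vanish; move: hN; apply: contra_neq => h0.
    apply/eqP; rewrite eq_le measure_ge0 andbT -h0; apply: le_measure.
    - by rewrite inE; apply: measurableI => //; exact: measurable_cube.
    - by rewrite inE; apply: measurableI => //; exact: measurable_cube.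
    - by apply: setIS; apply: ncube_nd; exact: leq_addr.
  have := ae_foralln h; apply: filterS => x hx.
  have : (\bigcup_N ncube N : set E) x by rewrite ncube_exhaust.
  move=> [N _ Nx]; apply: (hx N); apply: ncube_nd Nx; exact: leq_addl.
have h : mu.-negligible (\bigcup_N (Z `&` ncube N)).
  apply: negligible_bigcup => N; apply/negligibleP.
    by apply: measurableI => //; exact: measurable_cube.
  by apply/eqP/negPn/negP => h; apply: none; exists N.
rewrite -setI_bigcupr ncube_exhaust setIT in h.
apply: negligibleS h => x /= /negP; rewrite -leNgt => ux.
by apply/eqP; rewrite eq_le ux u0.
Qed.

End dichotomy.

(** * Dyadic grids with finitely many cubes *)

Section steps.
Context {R : realType}.

Lemma truncn_step (e t : R) (k : nat) : 0 < e -> 0 <= t ->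
  (Num.truncn (t / e) == k) = (e * k%:R <= t < e * k%:R + e).
Proof.
move=> e0 t0; rewrite truncn_eq ?divr_ge0 ?(ltW e0)//.
rewrite ler_pdivlMr// ltr_pdivrMr// mulrC; congr (_ && _).
by rewrite -natr1 mulrDl mul1r mulrC.
Qed.

Lemma truncn_scale (e t : R) (d : nat) : (0 < d)%N -> 0 < e -> 0 <= t ->
  Num.truncn (t / (e * d%:R)) = (Num.truncn (t / e) %/ d)%N.
Proof.
move=> d0 e0 t0; have dr : 0 < d%:R :> R by rewrite ltr0n.
apply/eqP; rewrite truncn_step ?mulr_gt0//.
have := eqxx (Num.truncn (t / e)); rewrite truncn_step//.
set k := Num.truncn _ => /andP[h1 h2].
rewrite -!mulrA -natrM; apply/andP; split.
  apply: le_trans h1; rewrite ler_pM2l// ler_nat mulnC; exact: leq_divM.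
apply: lt_le_trans h2 _.
have -> : e * k%:R + e = e * k.+1%:R by rewrite -natr1 mulrDr mulr1.
by rewrite -mulrDr ler_pM2l// -natrD ler_nat -mulnSr mulnC ltn_ceil.
Qed.

End steps.

Section dyadic_grid.
Context (R : realType) (n N : nat) (o : Rn R n).
Local Notation E := (Rn R n).
Local Notation mu := (lebesgue_Rn R n).
Hypothesis n0 : (0 < n)%N.

(** The grid with origin o has (2^(2N))^n cells of side 2^-N, and so covers a box of
    side 2^N.  A cell is named by its integer coordinates, and a dyadic cube of
    generation j by the cells that it contains: those whose coordinates have
    the same quotient by 2^j. *)
Definition side : R := 2^-1 ^+ N.
Definition gridM : nat := (2 ^ (2 * N))%N.
Definition Om := {ffun 'I_n -> 'I_gridM}.

Lemma side_gt0 : 0 < side. Proof. by rewrite exprn_gt0. Qed.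
Let side0 := side_gt0.

Lemma gridM_gt0 : (0 < gridM)%N. Proof. by rewrite expn_gt0. Qed.

Definition ccube (j : nat) (w : Om) : {set Om} :=
  [set w' : Om | [forall i, (w' i %/ 2 ^ j == w i %/ 2 ^ j)%N]]%SET.

Lemma ccubeP j (w w' : Om) : reflect (forall i, (w' i %/ 2 ^ j = w i %/ 2 ^ j)%N)
  (w' \in ccube j w).
Proof. by rewrite inE; apply: (iffP forallP) => h i; apply/eqP. Qed.

Lemma ccube_refl j w : w \in ccube j w.
Proof. exact/ccubeP. Qed.

Lemma ccube_eq j w w' : w' \in ccube j w -> ccube j w' = ccube j w.
Proof.
move=> /ccubeP h; apply/setP => z; apply/ccubeP/ccubeP => hz i; rewrite hz// h.
Qed.

Lemma ccube_mono j j' w : (j <= j')%N -> ccube j w \subset ccube j' w.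
Proof.
move=> jj'; apply/fintype.subsetP => z /ccubeP h; apply/ccubeP => i.
by rewrite -(subnKC jj') expnD !divnMA h.
Qed.

Definition corner j (w : Om) : E :=
  [tuple tnth o i + side * 2 ^+ j * (w i %/ 2 ^ j)%:R : R | i < n].

Definition gcube j (w : Om) : set E := hcube (corner j w) (side * 2 ^+ j).

Definition box : set E := hcube o (side * gridM%:R).

Definition idx (x : E) : Om :=
  [ffun i => insubd (Ordinal gridM_gt0) (Num.truncn ((tnth x i - tnth o i) / side))].

Lemma idxE x i : box x ->
  nat_of_ord (idx x i) = Num.truncn ((tnth x i - tnth o i) / side).
Proof.
move=> bx; have /andP[h1 h2] := bx i.
have t0 : 0 <= tnth x i - tnth o i by rewrite subr_ge0.
rewrite ffunE val_insubd ifT// truncn_lt_nat ?divr_ge0 ?(ltW side0)//.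
by rewrite ltr_pdivrMr// ltrBlDl mulrC.
Qed.

(** Geometric and combinatorial cubes agree, because taking integer parts commutes with
    division by 2^j ([truncn_scale]). *)
Lemma gcubeP j w x : (j <= 2 * N)%N ->
  gcube j w x <-> box x /\ idx x \in ccube j w.
Proof.
move=> jN; have sj : 0 < side * 2 ^+ j by rewrite mulr_gt0// exprn_gt0.
have natj : 2 ^+ j = (2 ^ j)%:R :> R by rewrite natrX.
have j0 : (0 < 2 ^ j)%N by rewrite expn_gt0.
split => [h|[bx /ccubeP h] i].
  have bx : box x.
    move=> i; have := h i; rewrite tnth_mktuple => /andP[h1 h2].
    apply/andP; split.
      by apply: le_trans h1; rewrite lerDl mulr_ge0// ltW.
    apply: lt_le_trans h2 _; rewrite -addrA lerD2l -[X in _ + X]mulr1 -mulrDr.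
    rewrite natr1 -mulrA ler_pM2l// natj -natrM ler_nat.
    move: (nat_of_ord (w i)) (ltn_ord (w i)) => k kM.
    have gE : gridM = (2 ^ (2 * N - j) * 2 ^ j)%N by rewrite -expnD subnK.
    by rewrite gE mulnC leq_mul2r ltn_divLR// -gE kM orbT.
  split => //; apply/ccubeP => i; have := h i; rewrite tnth_mktuple => hi.
  have t0 : 0 <= tnth x i - tnth o i.
    by rewrite subr_ge0; have /andP[] := bx i.
  rewrite idxE// -truncn_scale// -natj; apply/eqP; rewrite truncn_step//.
  by move: hi => /andP[h1 h2]; apply/andP; split; lra.
have t0 : 0 <= tnth x i - tnth o i.
  by rewrite subr_ge0; have /andP[] := bx i.
have := h i; rewrite idxE// -truncn_scale// -natj => /eqP; rewrite truncn_step//.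
by rewrite tnth_mktuple => /andP[h1 h2]; apply/andP; split; lra.
Qed.

Definition fcube (w : Om) : set E := gcube 0 w.

Lemma fcubeP w x : fcube w x <-> box x /\ idx x = w.
Proof.
rewrite /fcube gcubeP//; split => -[bx h]; split => //.
  by apply/ffunP => i; apply/val_inj; move/ccubeP: h => /(_ i); rewrite expn0 !divn1.
by rewrite h ccube_refl.
Qed.

Lemma measurable_gcube j w : measurable (gcube j w).
Proof. exact: measurable_hcube. Qed.

Definition region (A : {set Om}) : set E := [set x | box x /\ idx x \in A].

Lemma regionE A : region A = \big[setU/set0]_(w <- enum A) fcube w.
Proof.
rewrite -bigcup_seq; apply/seteqP; split => x.
  by move=> [bx xA]; exists (idx x); [rewrite /= mem_enum|apply/fcubeP].
by move=> [w /= wA /fcubeP[bx xw]]; split => //; rewrite xw; move: wA; rewrite mem_enum.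
Qed.

Lemma gcube_region j w : (j <= 2 * N)%N -> gcube j w = region (ccube j w).
Proof. by move=> jN; apply/seteqP; split => x /(gcubeP w x jN). Qed.

Lemma measurable_region A : measurable (region A).
Proof.
rewrite regionE; apply: bigsetU_measurable => w _; exact: measurable_gcube.
Qed.

Lemma integral_region A (f : E -> \bar R) : measurable_fun setT f ->
  (forall x, 0 <= f x)%E ->
  (\int[mu]_(x in region A) f x = \sum_(w in A) \int[mu]_(x in fcube w) f x)%E.
Proof.
move=> mf f0; rewrite regionE ge0_integral_bigsetU//.
- by rewrite big_enum.
- by move=> w; exact: measurable_gcube.
- exact: enum_uniq.
- apply/trivIsetP => w w' _ _ ww'; apply/seteqP; split => // x [].
  by move=> /fcubeP[_ h] /fcubeP[_ h']; move: ww'; rewrite -h -h' eqxx.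
- exact: measurable_funTS.
Qed.

Definition vol (w : Om) : R := side ^+ n.

Lemma volume_gcube j w : mu (gcube j w) = ((side * 2 ^+ j) ^+ n)%:E.
Proof. by rewrite volume_hcube// mulr_gt0// exprn_gt0. Qed.

Lemma mass_vol j w : (j <= 2 * N)%N -> mass vol (ccube j w) = (side * 2 ^+ j) ^+ n.
Proof.
move=> jN; apply: EFin_inj; rewrite -(volume_gcube j w) gcube_region//.
have h1 (A : set E) : measurable A -> mu A = (\int[mu]_(x in A) cst 1%E x)%E.
  by move=> mA; rewrite integral_cst// mul1e.
rewrite (h1 _ (measurable_region _)) integral_region; [|exact: measurable_cst|by move=> x; rewrite lee01].
rewrite /mass -sumEFin; apply: eq_bigr => z _.
by rewrite -(h1 _ (measurable_gcube _ _)) volume_gcube expr0 mulr1.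
Qed.

Definition dcubes : {set {set Om}} :=
  imset (fun p : 'I_(2 * N).+1 * Om => ccube p.1 p.2) (mem predT).

Lemma dcubesP P : reflect (exists j w, (j <= 2 * N)%N /\ P = ccube j w) (P \in dcubes).
Proof.
apply: (iffP imsetP) => [[[j w] _ ->]|[j [w [jN ->]]]].
  by exists j, w; split => //; rewrite -ltnS.
have jN' : (j < (2 * N).+1)%N by rewrite ltnS.
by exists (Ordinal jN', w).
Qed.

Lemma dcubes_nonempty P : P \in dcubes -> exists w, w \in P.
Proof. by move=> /dcubesP[j [w [_ ->]]]; exists w; exact: ccube_refl. Qed.

Lemma dcubes_exists : exists P, P \in dcubes.
Proof.
have w0 : Om := [ffun=> Ordinal gridM_gt0].
by exists (ccube 0 w0); apply/dcubesP; exists 0%N, w0.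
Qed.

Lemma dcubes_laminar : laminar dcubes.
Proof.
move=> P Q x /dcubesP[j [w [_ ->]]] /dcubesP[j' [w' [_ ->]]] xw xw'.
rewrite -(ccube_eq xw) -(ccube_eq xw').
by have [jj|/ltnW jj] := leqP j j'; [left|right]; exact: ccube_mono.
Qed.

Lemma dcubes_doubling : doubling vol dcubes.
Proof.
move=> P Q /dcubesP[j [w [jN ->]]] /dcubesP[j' [w' [jN' ->]]] PQ.
have jj : (j < j')%N.
  rewrite ltnNge; apply/negP => j'j; have /properP[s [z zQ zP]] := PQ.
  have wQ := fintype.subsetP s _ (ccube_refl j w).
  have h := ccube_mono w j'j; rewrite (ccube_eq wQ) in h.
  by move: zP; rewrite (fintype.subsetP h).
rewrite !mass_vol//.
have -> : side * 2 ^+ j' = side * 2 ^+ j * 2 ^+ (j' - j).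
  by rewrite -mulrA -exprD subnKC// ltnW.
have A0 : 0 <= side * 2 ^+ j by rewrite mulr_ge0 ?exprn_ge0// ltW.
rewrite [leRHS]exprMn mulrC ler_wpM2l ?exprn_ge0// -exprM.
by rewrite -[leLHS]expr1 ler_weXn2l ?ler1n// muln_gt0 subn_gt0 jj n0.
Qed.

(** Distinct generations give distinct cubes, since their volumes differ. *)
Lemma dcubes_sum (F : {set Om} -> R) w :
  \sum_(j < (2 * N).+1) F (ccube j w) = \sum_(P in dcubes | w \in P) F P.
Proof.
pose h (j : 'I_(2 * N).+1) := ccube j w.
have hinj : {in predT &, injective h}.
  move=> i j _ _ ij; apply/val_inj/eqP/negPn/negP => /= ne.
  have hl (k : 'I_(2 * N).+1) : (k <= 2 * N)%N by rewrite -ltnS.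
  have := mass_vol w (hl i); have hj := mass_vol w (hl j) => hi.
  move: hj; rewrite -[ccube j w]/(h j) -ij [LHS]hi => /eqP.
  rewrite eqrXn2 ?mulr_ge0 ?exprn_ge0 ?(ltW side0)//.
  rewrite (inj_eq (mulfI (lt0r_neq0 side0))) -!natrX eqr_nat eqn_exp2l//.
  by rewrite (negbTE ne).
rewrite -(@big_imset _ _ _ _ _ h (mem predT) F hinj); apply: eq_bigl => P.
apply/imsetP/andP => [[j _ ->]|[/dcubesP[j [z [jN ->]]] wz]].
  split; last exact: ccube_refl.
  by apply/dcubesP; exists j, w; split => //; rewrite -ltnS.
have jN' : (j < (2 * N).+1)%N by rewrite ltnS.
by exists (Ordinal jN') => //; rewrite /h (ccube_eq wz).
Qed.

End dyadic_grid.

(** * Muckenhoupt constants on a cube *)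

Section integral_tools.
Local Open Scope ereal_scope.
Context d (T : measurableType d) (R : realType).
Variable mu : {measure set T -> \bar R}.

(** The inequality on a set follows from that on the space, applied to the products
    with the indicator of the set. *)
Lemma hoelder_set (D : set T) (f g : T -> R) (p r : R) : measurable D ->
  measurable_fun setT f -> measurable_fun setT g ->
  (forall x, 0 <= f x)%R -> (forall x, 0 <= g x)%R ->
  (0 < p)%R -> (0 < r)%R -> (p^-1 + r^-1 = 1)%R ->
  \int[mu]_(x in D) (f x * g x)%:E <=
    (\int[mu]_(x in D) (f x `^ p)%:E) `^ p^-1 *
    (\int[mu]_(x in D) (g x `^ r)%:E) `^ r^-1.
Proof.
move=> mD mf mg f0 g0 p0 r0 pr.
pose F x := (f x * \1_D x)%R; pose G x := (g x * \1_D x)%R.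
have mF : measurable_fun setT F by apply: measurable_funM => //; exact: measurable_indic.
have mG : measurable_fun setT G by apply: measurable_funM => //; exact: measurable_indic.
have i0 x : (0 <= \1_D x :> R)%R by rewrite indicE.
have res (u : T -> R) : \int[mu]_(x in D) (u x)%:E = \int[mu]_x (u x * \1_D x)%:E.
  rewrite integral_mkcond; apply: eq_integral => x _.
  by rewrite patchE indicE; case: (x \in D); rewrite ?mulr1 ?mulr0.
have Nr (u : T -> R) (t : R) : (forall x, 0 <= u x)%R -> (0 < t)%R ->
    'N[mu]_t%:E[EFin \o (fun x => u x * \1_D x)%R] =
     (\int[mu]_(x in D) (u x `^ t)%:E) `^ t^-1.
  move=> u0 t0; rewrite unlock res; congr (_ `^ _); apply: eq_integral => x _ /=.
  rewrite ger0_norm ?mulr_ge0// indicE.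
  by case: (x \in D); rewrite ?mulr1 ?mulr0// powR0// gt_eqF.
have := @hoelder _ _ _ mu F G p r mF mG p0 r0 pr.
rewrite (Nr f p f0 p0) (Nr g r g0 r0); apply: le_trans.
rewrite Lnorm1 res; apply: le_of_eq; apply: eq_integral => x _.
rewrite /F /G /= ger0_norm ?mulr_ge0// indicE.
by case: (x \in D); rewrite ?mulr1 ?mulr0.
Qed.

Lemma integral_pos (D : set T) (g : T -> R) : measurable D -> mu D != 0 ->
  measurable_fun setT g -> (forall x, 0 < g x)%R ->
  0 < \int[mu]_(x in D) (g x)%:E.
Proof.
move=> mD D0 mg g0; rewrite lt0e integral_ge0 ?andbT; last first.
  by move=> x _; rewrite lee_fin ltW.
apply/eqP => I0.
have mgD : measurable_fun D (EFin \o g).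
  by apply: measurable_funTS; exact/measurable_EFinP.
have [h _] := ae_eq_integral_abs mu mD mgD.
have : \int[mu]_(x in D) `|(EFin \o g) x| = 0.
  by rewrite -I0; apply: eq_integral => x _; rewrite gee0_abs// lee_fin ltW.
move/h => [N [mN N0 DN]].
have : mu D <= mu N.
  apply: le_measure; rewrite ?inE// => x Dx; apply: DN => /= /(_ Dx) [].
  by apply/eqP; rewrite gt_eqF.
by rewrite N0 measure_le0 (negbTE D0).
Qed.

End integral_tools.

Section cube_weights.
Context (R : realType) (n : nat).
Local Notation E := (Rn R n).
Local Notation mu := (lebesgue_Rn R n).
Variables (v : E -> R) (q r : R).
Hypotheses (mv : measurable_fun setT v) (v0 : forall x, 0 < v x).
Hypotheses (q0 : 0 < q) (r0 : 0 < r).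

(** This is w^-r when v = w^q. *)
Definition dual_weight x : R := v x `^ (- (r / q)).
Local Notation sg := dual_weight.
Local Notation s := (1 + q / r).

Lemma dual_weight_gt0 x : 0 < sg x.
Proof. exact: powR_gt0. Qed.

Lemma measurable_dual_weight : measurable_fun setT sg.
Proof. by apply: (measurableT_comp (measurable_powR _) mv). Qed.

Lemma epow_dual x : epow (v x)%:E (1 - conj_exp s) = (sg x)%:E.
Proof.
have qr : 0 < q / r by exact: divr_gt0.
have -> : 1 - conj_exp s = - (r / q).
  rewrite /conj_exp (_ : s - 1 = q / r); last by ring.
  by field; rewrite !gt_eqF.
rewrite /epow oppr_lt0 divr_gt0// opprK poweR_EFin inver gt_eqF ?powR_gt0//.
by rewrite /sg powRN.
Qed.

Hypothesis fin : (A_const s (EFin \o v) < +oo)%E.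

Definition wint (g : E -> R) (D : set E) : R := fine (\int[mu]_(x in D) (g x)%:E)%E.

Let A_le a l : 0 < l -> (A_loc s (EFin \o v) (cube a l) <= A_const s (EFin \o v))%E.
Proof. by move=> l0; apply: ereal_sup_ubound; exists (cube a l) => //; exact: cubes_cube. Qed.

Lemma A_loc_dualE Q : A_loc s (EFin \o v) Q =
  (avg (EFin \o v) Q * (avg (EFin \o sg) Q) `^ (q / r))%E.
Proof.
rewrite /A_loc (_ : (fun x => epow _ _) = EFin \o sg).
  by rewrite epow_nneg addrAC subrr add0r// ltW// divr_gt0.
by apply/funext => x; exact: epow_dual.
Qed.

(** Both averages in A_s are positive, hence if their product is finite so are they. *)
Lemma cube_finite a l : 0 < l ->
  ((\int[mu]_(x in cube a l) (v x)%:E < +oo) /\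
   (\int[mu]_(x in cube a l) (sg x)%:E < +oo))%E.
Proof.
move=> l0; have mQ := measurable_cube a l; have mus := measurable_dual_weight.
have ln0 : 0 < l ^+ n by exact: exprn_gt0.
have Q0 : mu (cube a l) != 0%E by rewrite volume_cube// eqe gt_eqF.
have qr : 0 < q / r by exact: divr_gt0.
have Iv := integral_pos mQ Q0 mv v0.
have Is := integral_pos mQ Q0 mus dual_weight_gt0.
have inv0 : (0 < (mu (cube a l))^-1)%E.
  by rewrite volume_cube// inver gt_eqF// lte_fin invr_gt0.
have av : (0 < avg (EFin \o v) (cube a l))%E by rewrite /avg mule_gt0.
have as_ : (0 < (avg (EFin \o sg) (cube a l)) `^ (q / r))%E.
  by rewrite poweR_gt0// /avg mule_gt0.
have := le_lt_trans (A_le a l0) fin; rewrite A_loc_dualE => h.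
have avy : (avg (EFin \o v) (cube a l) < +oo)%E.
  by rewrite ltey; apply/eqP => e; move: h; rewrite e gt0_mulye.
have asy : (avg (EFin \o sg) (cube a l) < +oo)%E.
  rewrite ltey; apply/eqP => e; move: h.
  by rewrite e poweRyr ?gt_eqF// gt0_muley.
split; rewrite ltey; apply/eqP => e.
  by move: avy; rewrite /avg e gt0_mulye.
by move: asy; rewrite /avg e gt0_mulye.
Qed.

Lemma wint_sub (g : E -> R) (D : set E) a l : 0 < l -> (forall x, 0 <= g x) ->
  (\int[mu]_(x in cube a l) (g x)%:E < +oo)%E -> D `<=` cube a l ->
  (\int[mu]_(x in D) (g x)%:E = (wint g D)%:E)%E.
Proof.
move=> l0 g0 h DQ; rewrite fineK// ge0_fin_numE.
  by apply: le_lt_trans h; apply: ge0_subset_integral_any => // x; rewrite lee_fin.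
by apply: integral_ge0 => x _; rewrite lee_fin.
Qed.

Lemma A_loc_cube a l : 0 < l ->
  (A_loc s (EFin \o v) (cube a l) =
   (wint v (hcube a l) / l ^+ n * (wint sg (hcube a l) / l ^+ n) `^ (q / r))%:E)%E.
Proof.
move=> l0; have [hv hs] := cube_finite a l0.
have ln0 : 0 < l ^+ n by exact: exprn_gt0.
have av (g : E -> R) : (forall x, 0 < g x) ->
    (\int[mu]_(x in cube a l) (g x)%:E < +oo)%E ->
    avg (EFin \o g) (cube a l) = (wint g (hcube a l) / l ^+ n)%:E.
  move=> g0 h; rewrite /avg volume_cube// inver gt_eqF//.
  rewrite integral_cube_hcube//; last by move=> x; rewrite lee_fin ltW.
  rewrite (@wint_sub g (hcube a l) a l)//; first by move=> x; exact: ltW.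
  exact: hcube_sub.
by rewrite A_loc_dualE (av v)// (av sg)//; exact: dual_weight_gt0.
Qed.

(** Hoelder applied to 1 = v^(1/p1) sg^(1/p2), with p1 = 1 + q/r and p2 = 1 + r/q. *)
Lemma A_loc_ge1 a l : 0 < l -> (1 <= A_loc s (EFin \o v) (cube a l))%E.
Proof.
move=> l0; rewrite A_loc_cube// lee_fin.
have [hv hs] := cube_finite a l0.
have ln0 : 0 < l ^+ n by exact: exprn_gt0.
have Q0 : mu (hcube a l) != 0%E by rewrite volume_hcube// eqe gt_eqF.
have mH := measurable_hcube a l.
set V := wint v (hcube a l); set W := wint sg (hcube a l).
have VE := wint_sub l0 (fun x => ltW (v0 x)) hv (@hcube_sub _ _ a l).
have WE := wint_sub l0 (fun x => ltW (dual_weight_gt0 x)) hs (@hcube_sub _ _ a l).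
have V0 : 0 < V.
  by rewrite -lte_fin -VE; exact: integral_pos.
have W0 : 0 < W.
  rewrite -lte_fin -WE; apply: integral_pos => //; first exact: measurable_dual_weight.
  exact: dual_weight_gt0.
have qr0 : 0 < q + r by exact: addr_gt0.
pose p1 := (q + r) / r; pose p2 := (q + r) / q.
have p10 : 0 < p1 by exact: divr_gt0.
have p20 : 0 < p2 by exact: divr_gt0.
have pp : p1^-1 + p2^-1 = 1.
  by rewrite /p1 /p2; field; rewrite !gt_eqF.
pose f x := v x `^ p1^-1; pose g x := sg x `^ p2^-1.
have mf : measurable_fun setT f by apply: (measurableT_comp (measurable_powR _) mv).
have mg : measurable_fun setT g.
  by apply: (measurableT_comp (measurable_powR _) measurable_dual_weight).
have hh := @hoelder_set _ _ _ mu (hcube a l) f g p1 p2 mH mf mg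
  (fun x => powR_ge0 _ _) (fun x => powR_ge0 _ _) p10 p20 pp.
have fE : (\int[mu]_(x in hcube a l) (f x `^ p1)%:E = V%:E)%E.
  rewrite -VE; apply: eq_integral => x _.
  by rewrite /f -powRrM mulVf ?gt_eqF// powRr1// ltW.
have gE : (\int[mu]_(x in hcube a l) (g x `^ p2)%:E = W%:E)%E.
  rewrite -WE; apply: eq_integral => x _.
  by rewrite /g -powRrM mulVf ?gt_eqF// powRr1// ltW// dual_weight_gt0.
have fgE : (\int[mu]_(x in hcube a l) (f x * g x)%:E = (l ^+ n)%:E)%E.
  rewrite (eq_integral (cst 1%E)).
    by rewrite integral_cst// mul1e; exact: volume_hcube.
  move=> x _; rewrite /f /g /sg -powRrM -powRD_gt0// (_ : _ + _ = 0) ?powRr0//.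
  by rewrite /p1 /p2; field; rewrite !gt_eqF.
have h : l ^+ n <= V `^ p1^-1 * W `^ p2^-1.
  by rewrite -lee_fin EFinM -!poweR_EFin -fE -gE -fgE.
have e1 : V / l ^+ n * (W / l ^+ n) `^ (q / r) =
    (V `^ p1^-1 * W `^ p2^-1 / l ^+ n) `^ p1.
  have li0 : 0 < (l ^+ n)^-1 by rewrite invr_gt0.
  rewrite -[X in (_ * _ * X) `^ _](powRr1 (ltW li0)) -pp powRD_gt0//.
  rewrite !powRM ?mulr_ge0 ?powR_ge0 ?(ltW V0) ?(ltW W0) ?(ltW li0)//.
  rewrite -!powRrM !mulVf ?gt_eqF// !powRr1 ?(ltW V0) ?(ltW li0)//.
  have -> : p2^-1 * p1 = q / r by rewrite /p1 /p2; field; rewrite !gt_eqF.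
  by ring.
have h1 : 1 <= V `^ p1^-1 * W `^ p2^-1 / l ^+ n by rewrite ler_pdivlMr// mul1r.
by have := powR_le (ltW p10) ler01 h1; rewrite e1 powR1.
Qed.

End cube_weights.

(** The two families of constants in the theorem are exchanged by passing from
    v = w^q, with exponents (q, p'), to w^-p', with exponents (p', q). *)
Lemma dual_weightK (R : realType) (n : nat) (v : Rn R n -> R) (q r : R) :
  (forall x, 0 < v x) -> 0 < q -> 0 < r ->
  dual_weight (dual_weight v q r) r q = v.
Proof.
move=> v0 q0 r0; apply/funext => x; rewrite /dual_weight -powRrM.
have -> : - (r / q) * - (q / r) = 1 by field; rewrite !gt_eqF.
by rewrite powRr1// ltW.
Qed.

(** * A weight seen by a grid *)

Section integral_sum_indic.
Context d (T : measurableType d) (R : realType).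
Variable mu : {measure set T -> \bar R}.

Lemma integral_sum_indic (I : finType) (c : I -> R) (D : I -> set T) (g : T -> R) :
  (forall i, 0 <= c i) -> (forall i, measurable (D i)) ->
  measurable_fun setT g -> (forall x, 0 <= g x) ->
  (\int[mu]_x ((\sum_i c i * \1_(D i) x) * g x)%:E =
    \sum_i (c i)%:E * \int[mu]_(x in D i) (g x)%:E)%E.
Proof.
move=> c0 mD mg g0.
transitivity (\int[mu]_x (\sum_(i <- enum I) (c i * (\1_(D i) x * g x))%:E))%E.
  apply: eq_integral => x _; rewrite sumEFin big_enum/=; congr EFin.
  by rewrite big_distrl/=; apply: eq_bigr => w _; rewrite mulrA.
have mi i : measurable_fun setT (fun x => \1_(D i) x * g x : R).
  by apply: measurable_funM => //; apply: measurable_indic.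
have i0 i x : 0 <= \1_(D i) x * g x :> R by rewrite mulr_ge0// indicE.
rewrite ge0_integral_sum//; last 2 first.
- by move=> i; apply/measurable_EFinP; apply: measurable_funM.
- by move=> i x _; rewrite lee_fin mulr_ge0.
rewrite big_enum/=; apply: eq_bigr => i _.
under eq_integral do rewrite EFinM.
rewrite ge0_integralZl_EFin//; last 2 first.
- by move=> x _; rewrite lee_fin.
- exact/measurable_EFinP.
congr (_ * _)%E; rewrite [RHS]integral_mkcond; apply: eq_integral => x _.
by rewrite patchE indicE; case: (x \in _); rewrite ?mul1r ?mul0r.
Qed.

End integral_sum_indic.

Section step_functions.
Context (R : realType) (n N : nat) (o : Rn R n).
Local Notation E := (Rn R n).
Local Notation mu := (lebesgue_Rn R n).
Local Notation Om := (Om n N).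
Implicit Types (c : Om -> R).

Definition stepf c (x : E) : R := \sum_w c w * \1_(fcube o w) x.

Lemma stepf_in c w x : fcube o w x -> stepf c x = c w.
Proof.
move=> wx; rewrite /stepf (bigD1 w)//= big1 ?addr0.
  by rewrite indicE mem_set// mulr1.
move=> w' w'w; rewrite indicE memNset ?mulr0//.
move: wx => /fcubeP[_ h] /fcubeP[_ h']; move: w'w.
by rewrite -h -h' eqxx.
Qed.

Lemma stepf_out c x : ~ box N o x -> stepf c x = 0.
Proof.
move=> bx; rewrite /stepf big1// => w _; rewrite indicE memNset ?mulr0//.
by move=> /fcubeP[].
Qed.

Lemma measurable_stepf c : measurable_fun setT (stepf c).
Proof.
apply: measurable_sum => w; apply: measurable_funM => //.
by apply: measurable_indic; exact: measurable_gcube.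
Qed.

Lemma stepf_ge0 c x : (forall w, 0 <= c w) -> 0 <= stepf c x.
Proof.
by move=> c0; apply: sumr_ge0 => w _; rewrite mulr_ge0// indicE.
Qed.

Lemma integral_stepf c (g : E -> R) : (forall w, 0 <= c w) ->
  measurable_fun setT g -> (forall x, 0 <= g x) ->
  (\int[mu]_x (stepf c x * g x)%:E =
    \sum_w (c w)%:E * \int[mu]_(x in fcube o w) (g x)%:E)%E.
Proof.
move=> c0 mg g0; apply: integral_sum_indic => // w; exact: measurable_gcube.
Qed.

End step_functions.

Section grid_weights.
Context (R : realType) (n N : nat) (o : Rn R n).
Local Notation E := (Rn R n).
Local Notation mu := (lebesgue_Rn R n).
Local Notation Om := (Om n N).
Hypothesis n0 : (0 < n)%N.
Variables (v : E -> R) (q r : R).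
Hypotheses (mv : measurable_fun setT v) (v0 : forall x, 0 < v x).
Hypotheses (q0 : 0 < q) (r0 : 0 < r).
Local Notation sg := (dual_weight v q r).
Local Notation s := (1 + q / r).
Hypothesis fin : (A_const s (EFin \o v) < +oo)%E.

Definition cellint (g : E -> R) (w : Om) : R := wint g (fcube o w).

Local Notation vol := (@vol R n N).
Local Notation S := (dcubes n N).

Definition kside (j : nat) : R := side R N * 2 ^+ j.
Lemma kside_gt0 j : 0 < kside j.
Proof. by rewrite mulr_gt0 ?exprn_gt0// side_gt0. Qed.

Lemma vol_gt0 w : 0 < vol w.
Proof. by rewrite exprn_gt0// side_gt0. Qed.

Lemma volume_fcube (w : Om) : mu (fcube o w) = (vol w)%:E.
Proof. by rewrite /fcube volume_gcube expr0 mulr1. Qed.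

Lemma fcube_neq0 (w : Om) : mu (fcube o w) != 0%E.
Proof. by rewrite volume_fcube eqe gt_eqF// vol_gt0. Qed.

Let fcube_sub (w : Om) : fcube o w `<=` cube (corner o 0 w) (kside 0).
Proof. exact: hcube_sub. Qed.

Section one_weight.
Variable g : E -> R.
Hypotheses (mg : measurable_fun setT g) (g0 : forall x, 0 <= g x).
Hypothesis (gfin : forall a l, 0 < l -> (\int[mu]_(x in cube a l) (g x)%:E < +oo)%E).

Lemma cellintE w : (\int[mu]_(x in fcube o w) (g x)%:E = (cellint g w)%:E)%E.
Proof. exact: (wint_sub (kside_gt0 0) g0 (gfin _ (kside_gt0 0)) (@fcube_sub w)). Qed.

Lemma cellint_gt0 w : (forall x, 0 < g x) -> 0 < cellint g w.
Proof.
move=> gp; rewrite -lte_fin -cellintE; apply: integral_pos => //; first exact: measurable_gcube.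
exact: fcube_neq0.
Qed.

Lemma mass_cellint j w : (j <= 2 * N)%N -> mass (cellint g) (ccube j w) = wint g (gcube o j w).
Proof.
move=> jN; apply: EFin_inj.
rewrite -(wint_sub (kside_gt0 j) g0 (gfin _ (kside_gt0 j)) (@hcube_sub _ _ (corner o j w) _)).
rewrite -/(gcube o j w) gcube_region// integral_region.
- by rewrite /mass -sumEFin; apply: eq_bigr => z _; rewrite cellintE.
- exact/measurable_EFinP.
- by move=> x; rewrite lee_fin.
Qed.

End one_weight.

Let vfin a l (l0 : 0 < l) := (cube_finite mv v0 q0 r0 fin a l0).1.
Let sfin a l (l0 : 0 < l) := (cube_finite mv v0 q0 r0 fin a l0).2.
Let msg := measurable_dual_weight q r mv.
Let sg0 := dual_weight_gt0 q r v0.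
Let v0' x : 0 <= v x. Proof. exact: ltW. Qed.
Let sg0' x : 0 <= sg x. Proof. exact: ltW (sg0 x). Qed.

Lemma muckenhoupt_grid j w : (j <= 2 * N)%N ->
  (muckenhoupt vol (cellint sg) (cellint v) q r (ccube j w))%:E =
  A_loc s (EFin \o v) (cube (corner o j w) (kside j)).
Proof.
move=> jN; rewrite (A_loc_cube mv v0 q0 r0 fin _ (kside_gt0 j)).
by rewrite /muckenhoupt /mean_val mass_vol// (mass_cellint mv v0' vfin)// (mass_cellint msg sg0' sfin).
Qed.

Lemma muckenhoupt_bounds P : P \in S ->
  1 <= muckenhoupt vol (cellint sg) (cellint v) q r P <= fine (A_const s (EFin \o v)).
Proof.
move=> /dcubesP[j [w [jN ->]]].
have h1 := A_loc_ge1 mv v0 q0 r0 fin (corner o j w) (kside_gt0 j).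
have h2 : (A_loc s (EFin \o v) (cube (corner o j w) (kside j)) <=
    A_const s (EFin \o v))%E.
  apply: ereal_sup_ubound; exists (cube (corner o j w) (kside j)) => //.
  exact/cubes_cube/kside_gt0.
rewrite -muckenhoupt_grid// in h1 h2; rewrite -!lee_fin h1/= fineK//.
by rewrite ge0_fin_numE// (le_trans _ h2)// (le_trans _ h1).
Qed.

(** Every dyadic cube inside Q competes in the supremum that defines M(v 1_Q). *)
Lemma AMinf_grid j w (P := ccube j w) : (j <= 2 * N)%N ->
  (((\sum_(x in P) vol x * dmax (mean_val vol (cellint v)) (below S P) x) / mass (cellint v) P)%:E <=
   AMinf_loc (EFin \o v) (cube (corner o j w) (kside j)))%E.
Proof.
move=> jN; set Q := cube _ _; set phi := mean_val _ _.
pose c x := if x \in P then dmax phi (below S P) x else 0.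
have c0 x : 0 <= c x by rewrite /c; case: ifP => // _; exact: dmax_ge0.
have V0 : 0 < mass (cellint v) P.
  by apply: (mass_gt0 (x := w)); [exact: (fun x => cellint_gt0 mv v0' vfin x v0)|exact: ccube_refl].
have wm : wmeas (EFin \o v) Q = (mass (cellint v) P)%:E.
  rewrite /wmeas integral_cube_hcube//; last exact: kside_gt0.
  rewrite (wint_sub (kside_gt0 j) v0' (vfin _ (kside_gt0 j)) (@hcube_sub _ _ _ _)).
  by rewrite mass_cellint.
have max0 x : (0 <= maximal ((EFin \o v) \_ Q) x)%E.
  apply: maximal_ge0; have : (\bigcup_N ncube N : set E) x by rewrite ncube_exhaust.
  by move=> [k _ kx]; exists (ncube k) => //; exact: ncube_cubes.
have vQ0 x : (0 <= ((EFin \o v) \_ Q) x)%E.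
  by apply: erestrict_ge0 => y _; rewrite lee_fin ltW.
rewrite /AMinf_loc wm inver gt_eqF// mulrC EFinM lee_pmul2l//; last first.
  by rewrite lte_fin invr_gt0.
have -> : (\sum_(x in P) vol x * dmax phi (below S P) x)%:E =
    (\int[mu]_x (stepf o c x * (fun=> 1%R) x)%:E)%E.
  rewrite integral_stepf// -sumEFin big_mkcond/=; apply: eq_bigr => x _.
  rewrite (eq_integral (cst 1%E))// integral_cst ?mul1e; last exact: measurable_gcube.
  transitivity ((c x)%:E * mu (fcube o x))%E => //.
  rewrite volume_fcube /c; case: ifP => _; last by rewrite mul0e.
  by rewrite mulrC EFinM.
rewrite [leRHS]integral_mkcond; apply: ge0_le_integral_any => [x|x|x _].
- by rewrite lee_fin mulr1 stepf_ge0.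
- exact: erestrict_ge0.
rewrite mulr1 patchE.
have [bx|bx] := pselect (box N o x); last first.
  by rewrite stepf_out//; case: ifP.
have xf : fcube o (idx N o x) x by apply/fcubeP.
rewrite (stepf_in _ xf) /c.
case: ifPn => xP; last by case: ifP.
have xg : gcube o j w x by apply/gcubeP.
have xQ : Q x by apply: hcube_sub; exact: xg.
rewrite mem_set//.
have [->//|[P' [P'S xP' ->]]] := dmax_attained phi (below S P) (idx N o x).
have [/dcubesP[j' [w' [j'N P'E]]] P'P] := below_sub P'S.
pose Q' := cube (corner o j' w') (kside j').
have xg' : gcube o j' w' x by apply/gcubeP => //; rewrite -P'E.
have sub : gcube o j' w' `<=` gcube o j w.
  move=> y /(gcubeP o w' y j'N)[by_ yP']; apply/gcubeP => //; split => //.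
  by apply: (fintype.subsetP P'P); rewrite P'E.
have cub' : cubes Q' by exact/cubes_cube/kside_gt0.
have ks' := kside_gt0 j'.
apply: ereal_sup_ge; exists (avg (abse \o ((EFin \o v) \_ Q)) Q').
  by exists Q' => //; split => //; apply: hcube_sub; exact: xg'.
rewrite /phi /mean_val P'E mass_vol// mass_cellint// /avg volume_cube// inver gt_eqF ?exprn_gt0//.
rewrite EFinM lee_pmul2r//; last by rewrite lte_fin invr_gt0 exprn_gt0.
rewrite -(wint_sub ks' v0' (vfin _ ks') (@hcube_sub _ _ _ _)).
apply: (@le_trans _ _ (\int[mu]_(y in gcube o j' w') (abse \o ((EFin \o v) \_ Q)) y)%E).
  apply: ge0_le_integral_any => [y|y|y yg]; [by rewrite lee_fin ltW|by rewrite /= abse_ge0|].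
  have yQ : Q y by apply: hcube_sub; exact: (sub _ yg).
  by rewrite /= patchE mem_set// gee0_abs// lee_fin ltW.
apply: ge0_subset_integral_any; last exact: hcube_sub.
by move=> y; rewrite /= abse_ge0.
Qed.

(** The r-th power of the mixed bound A^(1/q) (A_infty)^(1/r) <= B, in the form
    required by [testing]. *)
Lemma muckenhoupt_mixed P (B : R) : mixed_const s q^-1 r^-1 (EFin \o v) = B%:E -> P \in S ->
  muckenhoupt vol (cellint sg) (cellint v) q r P `^ (r / q) *
   (\sum_(x in P) vol x * dmax (mean_val vol (cellint v)) (below S P) x) <=
    B `^ r * mass (cellint v) P.
Proof.
move=> BE PS; have /dcubesP[j [w [jN PE]]] := PS.
have /andP[m1 _] := muckenhoupt_bounds PS.
have V0 : 0 < mass (cellint v) P.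
  by apply: (mass_gt0 (x := w)); [exact: (fun x => cellint_gt0 mv v0' vfin x v0)|rewrite PE; exact: ccube_refl].
have := AMinf_grid w jN; rewrite -PE; set X := \sum_(x in P) _.
have X0 : 0 <= X.
  by apply: sumr_ge0 => x _; rewrite mulr_ge0 ?dmax_ge0// ltW// vol_gt0.
set Q := cube _ _ => hX.
have : (epow (A_loc s (EFin \o v) Q) q^-1 * epow (AMinf_loc (EFin \o v) Q) r^-1 <=
    B%:E)%E.
  rewrite -BE; apply: ereal_sup_ubound; exists Q => //.
  exact/cubes_cube/kside_gt0.
rewrite !epow_nneg ?invr_ge0 ?(ltW q0) ?(ltW r0)// -muckenhoupt_grid// -PE => hB.
have XV0 : 0 <= X / mass (cellint v) P by rewrite divr_ge0// ltW.
have : muckenhoupt vol (cellint sg) (cellint v) q r P `^ q^-1 * (X / mass (cellint v) P) `^ r^-1 <= B.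
  rewrite -lee_fin; apply: le_trans hB; rewrite EFinM -!poweR_EFin.
  apply: lee_wpmul2l; first exact: poweR_ge0.
  by apply: poweR_le hX; rewrite ?invr_ge0 ?(ltW r0)// lee_fin.
move=> /(powR_le (ltW r0) (mulr_ge0 (powR_ge0 _ _) (powR_ge0 _ _))).
have [Y YE] : exists Y, Y = X / mass (cellint v) P by eexists.
rewrite -YE in XV0 *; move: (muckenhoupt _ _ _ _ _ P) => M.
rewrite powRM ?powR_ge0// -(powRrM M) -(powRrM Y) mulVf ?gt_eqF// powRr1//.
by rewrite (mulrC q^-1) YE mulrA ler_pdivrMr.
Qed.

End grid_weights.

(** * Lower limits *)

Section limits.
Local Open Scope ereal_scope.
Context {R : realType}.

Lemma limn_einfE (u : (\bar R)^nat) : limn_einf u = ereal_sup (range (einfs u)).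
Proof. by rewrite limn_einf_lim; apply/cvg_lim => //; exact: cvg_einfs_sup. Qed.

Lemma limn_einf_ge (u : (\bar R)^nat) c N0 : (forall n, (N0 <= n)%N -> c <= u n) ->
  c <= limn_einf u.
Proof.
move=> h; rewrite limn_einfE; apply: ereal_sup_ge; exists (einfs u N0); first by exists N0.
by apply: le_ereal_inf_tmp => _ [m /= Nm <-]; exact: h.
Qed.

Lemma lt_limn_einf (u : (\bar R)^nat) c : c < limn_einf u ->
  exists N0, forall n, (N0 <= n)%N -> c < u n.
Proof.
rewrite limn_einfE => /ereal_sup_gt[_ [N0 _ <-] h].
exists N0 => n Nn; apply: lt_le_trans h _; apply: ereal_inf_lbound.
by exists n.
Qed.

(** This form applies to the potential G, of which only a pointwise bound is known. *)
Lemma fatou_bound d (T : measurableType d) (mu : {measure set T -> \bar R})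
    (F : (T -> \bar R)^nat) (G : T -> \bar R) :
  (forall n, measurable_fun setT (F n)) -> (forall n x, 0 <= F n x) ->
  (forall x, 0 <= G x) -> (forall x, G x <= limn_einf (F ^~ x)) ->
  \int[mu]_x G x <= limn_einf (fun n => \int[mu]_x F n x).
Proof.
move=> mF F0 G0 GF; apply: le_trans (fatou mu measurableT mF _); last by [].
apply: ge0_le_integral_any => // x; exact: le_trans (GF x).
Qed.

Lemma limn_einf_le (u : (\bar R)^nat) c : (forall n, u n <= c) -> limn_einf u <= c.
Proof.
move=> h; rewrite limn_einfE; apply: ge_ereal_sup => _ [n _ <-].
by apply: le_trans (h n); apply: ereal_inf_lbound; exists n => /=.
Qed.

(** A strict inequality b < a^q c yields a number t' with t'^q c > b and
    eventually u > t'. *)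
Lemma limn_einf_powM (u : nat -> R) (a : \bar R) (q c : R) :
  (0 < q)%R -> (0 < c)%R -> (forall n, 0 <= u n)%R -> 0 <= a ->
  a <= limn_einf (fun n => (u n)%:E) ->
  a `^ q * c%:E <= limn_einf (fun n => (u n `^ q * c)%:E).
Proof.
move=> q0 c0 u0 a0 au; rewrite leNgt; apply/negP => h.
have hl0 : 0 <= limn_einf (fun n => (u n `^ q * c)%:E).
  apply: (@limn_einf_ge _ 0 0%N) => n _.
  by rewrite lee_fin mulr_ge0 ?powR_ge0// ltW.
have [b bE] : exists b : R, limn_einf (fun n => (u n `^ q * c)%:E) = b%:E.
  exists (fine (limn_einf (fun n => (u n `^ q * c)%:E))); rewrite fineK//.
  by rewrite ge0_fin_numE// (lt_le_trans h)// leey.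
rewrite bE in h hl0; have b0 : (0 <= b)%R by rewrite -lee_fin.
pose t := ((b / c) `^ q^-1)%R.
have t0 : (0 <= t)%R by exact: powR_ge0.
have tq : (t `^ q * c = b)%R.
  rewrite /t -powRrM mulVf ?gt_eqF// powRr1 ?divr_ge0 ?(ltW c0)// divfK//.
  by rewrite gt_eqF.
have ta : t%:E < a.
  rewrite ltNge; apply/negP => at_; move: h; rewrite ltNge => /negP; apply.
  rewrite -tq EFinM -poweR_EFin; apply: lee_wpmul2r; first by rewrite lee_fin ltW.
  exact: poweR_le (ltW q0) a0 at_.
have [t' tt' t'a] : exists2 t' : R, (t < t')%R & t'%:E < a.
  case: (a) ta => [a'| |//]; last by move=> _; exists (t + 1)%R; rewrite ?ltrDl// ltry.
  by rewrite lte_fin => ta; exists ((t + a') / 2)%R; rewrite ?lte_fin; lra.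
have [N0 hN] := lt_limn_einf (lt_le_trans t'a au).
have : (t' `^ q * c)%:E <= b%:E.
  rewrite -bE; apply: (@limn_einf_ge _ _ N0) => n Nn; rewrite lee_fin.
  rewrite ler_wpM2r ?(ltW c0)//; apply: powR_le; [exact: ltW|lra|].
  by have := hN _ Nn; rewrite lte_fin => /ltW.
rewrite lee_fin -tq ler_pM2r// leNgt => /negP; apply.
by apply: gt0_ltr_powR => //; rewrite nnegrE//; lra.
Qed.

End limits.

(** * Two points in a common dyadic cube: the one-third trick *)

Section one_third.
Context {R : realType}.

(** One coordinate of the origin of a grid: the grids are those of origins
    -2^N/3 and -2^(N+1)/3. *)
Definition orig1 (N : nat) (b : bool) : R := - (2 ^+ N / 3) * (if b then 1 else 2).

Lemma dvd3_pow2 D : ~~ (3 %| 2 ^ D)%N.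
Proof. by rewrite Euclid_dvdX. Qed.

(** The one-third trick.  If points of both grids of mesh k lay between x and y, they
    would be at distance less than k/3; but their difference is 2^N/3
    modulo k, where 2^N = 2^D k, and 3 does not divide 2^D, so that it is at least k/3. *)
Lemma third_separates (N j : nat) (k x y : R) : (j <= 2 * N)%N ->
  k = side R N * 2 ^+ j ->
  `|x| < 2 ^+ N / 3 -> `|y| < 2 ^+ N / 3 -> `|x - y| < k / 3 ->
  exists b, Num.truncn ((x - orig1 N b) / k) = Num.truncn ((y - orig1 N b) / k).
Proof.
move=> jN kE; wlog xy : x y / x <= y.
  move=> H xL yL h; have [xy|/ltW yx] := leP x y; first exact: H.
  have [|b bE] := H _ _ yx yL xL; first by rewrite distrC.
  by exists b.
move=> xL yL; rewrite distrC ger0_norm ?subr_ge0// => h.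
apply: contrapT => none.
have k0 : 0 < k by rewrite kE mulr_gt0 ?exprn_gt0 ?invr_gt0.
pose D := (2 ^ (2 * N - j))%N.
have LE : 2 ^+ N = k * D%:R.
  rewrite kE /D natrX -mulrA -exprD subnKC// /side mul2n -addnn exprD mulrA.
  by rewrite -exprMn mulVf// expr1n mul1r.
have L0 : 0 < 2 ^+ N :> R by rewrite exprn_gt0.
have pt b : exists m : nat, x < orig1 N b + k * m%:R <= y.
  have ob : 0 <= x - orig1 N b /\ 0 <= y - orig1 N b.
    by move: xL yL; rewrite !ltr_norml /orig1 => /andP[? ?] /andP[? ?]; case: b; split; lra.
  have [ox oy] := ob.
  exists (Num.truncn ((y - orig1 N b) / k)).
  have := eqxx (Num.truncn ((y - orig1 N b) / k)); rewrite truncn_step// => /andP[h1 h2].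
  apply/andP; split; last by lra.
  rewrite ltNge; apply/negP => h3; apply: none; exists b; apply/eqP.
  by rewrite truncn_step//; apply/andP; split; lra.
have [m1 /andP[a1 a2]] := pt true; have [m2 /andP[b1 b2]] := pt false.
rewrite /orig1 mulr1 in a1 a2; rewrite /orig1 in b1 b2.
have e3 (m : nat) : (3 * m)%:R = 3 * m%:R :> R by rewrite natrM.
have h1 : k * (D + 3 * m1)%:R < k * (3 * m2 + 1)%:R.
  by rewrite (natrD _ D) (natrD _ _ 1) !e3 !mulrDr -LE; lra.
have h2 : k * (3 * m2)%:R < k * (D + 3 * m1 + 1)%:R.
  by rewrite (natrD _ _ 1) (natrD _ D) !e3 !mulrDr -LE; lra.
rewrite ltr_pM2l// ltr_nat addn1 ltnS in h1.
rewrite ltr_pM2l// ltr_nat addn1 ltnS in h2.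
have e : (D + 3 * m1 = 3 * m2)%N by apply/eqP; rewrite eqn_leq h1 h2.
have := dvd3_pow2 (2 * N - j); rewrite -/D => /negP; apply.
have : (3 %| D + 3 * m1)%N by rewrite e dvdn_mulr.
by rewrite dvdn_addl// dvdn_mulr.
Qed.

End one_third.

Section kernel.
Context (R : realType) (n : nat).
Local Notation E := (Rn R n).
Local Notation mu := (lebesgue_Rn R n).
Hypothesis n0 : (0 < n)%N.

Definition orig (N : nat) (e : {ffun 'I_n -> bool}) : E :=
  [tuple orig1 N (e i) : R | i < n].

Lemma side_grid N : side R N * (gridM N)%:R = 2 ^+ N.
Proof.
rewrite /side /gridM natrX mul2n -addnn exprD mulrA -exprMn mulVf//.
by rewrite expr1n mul1r.
Qed.

Lemma box_orig N e (x : E) : (forall i, `|tnth x i| < 2 ^+ N / 3) ->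
  box N (orig N e) x.
Proof.
move=> h i; rewrite tnth_mktuple side_grid; have := h i; rewrite ltr_norml.
have L0 : 0 < 2 ^+ N :> R by rewrite exprn_gt0.
by rewrite /orig1 => /andP[h1 h2]; apply/andP; case: (e i); split; lra.
Qed.

Lemma edist_ge (x y : E) i : `|tnth x i - tnth y i| <= Defs.edist x y.
Proof.
rewrite -sqrtr_sqr /Defs.edist; apply: ler_wsqrtr.
by rewrite (bigD1 i)//= lerDl sumr_ge0// => j _; exact: sqr_ge0.
Qed.

(** The pairs of points that the truncation at N can resolve: inside the box, and not
    closer than the cells. *)
Definition near_pair N (x y : E) :=
  [/\ forall i, `|tnth x i| < 2 ^+ N / 3, forall i, `|tnth y i| < 2 ^+ N / 3,
      forall i, `|tnth x i - tnth y i| < 2 ^+ N / 3 &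
      side R N / 6 <= Defs.edist x y].

(** Take the least generation j for which all the coordinates differ by less than a
    third of the side; the grid is chosen coordinate by coordinate.  Minimality
    bounds the side by the distance of the points. *)
Lemma common_cube N (x y : E) : near_pair N x y ->
  exists e, exists2 j, (j <= 2 * N)%N &
    kside R N j / 6 <= Defs.edist x y /\
    gcube (orig N e) j (idx N (orig N e) x) y.
Proof.
move=> [xL yL xyL dxy].
have k2N : kside R N (2 * N) = 2 ^+ N.
  by rewrite /kside -(side_grid N) /gridM natrX.
pose ok j := `[< forall i, `|tnth x i - tnth y i| < kside R N j / 3 >].
have ex : exists j, ok j by exists (2 * N)%N; apply/asboolP => i; rewrite k2N.
case: (ex_minnP ex) => j /asboolP okj jmin.
have jN : (j <= 2 * N)%N by apply: jmin; apply/asboolP => i; rewrite k2N.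
have kd : kside R N j / 6 <= Defs.edist x y.
  case: j okj jmin jN => [|j] okj jmin jN; first by rewrite /kside expr0 mulr1.
  have : ~~ ok j by apply/negP => /jmin; rewrite ltnn.
  move=> /asboolPn /existsNP[i /negP]; rewrite -leNgt => h.
  apply: le_trans (edist_ge x y i); apply: le_trans h.
  by rewrite /kside exprS; lra.
have sep i : exists b, Num.truncn ((tnth x i - orig1 N b) / kside R N j) ==
    Num.truncn ((tnth y i - orig1 N b) / kside R N j).
  have [b bE] := third_separates jN (erefl _) (xL i) (yL i) (okj i).
  by exists b; apply/eqP.
pose e : {ffun 'I_n -> bool} := [ffun i => xchoose (sep i)].
exists e; exists j => //; split => //.
have bx := box_orig e xL; have by_ := box_orig e yL.
apply/gcubeP => //; split => //; apply/ccubeP => i.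
rewrite !idxE//.
have tx : 0 <= tnth x i - tnth (orig N e) i.
  by rewrite subr_ge0; have /andP[] := bx i.
have ty : 0 <= tnth y i - tnth (orig N e) i.
  by rewrite subr_ge0; have /andP[] := by_ i.
have s0 := side_gt0 R N; have j0 : (0 < 2 ^ j)%N by rewrite expn_gt0.
rewrite -!truncn_scale// natrX !tnth_mktuple ffunE.
by have /eqP := xchooseP (sep i); rewrite /kside => ->.
Qed.

Variable be : R.
Hypothesis be0 : 0 < be.

Definition dkernel N (x y : E) : R :=
  \sum_(e : {ffun 'I_n -> bool}) \sum_(j < (2 * N).+1)
    \1_(box N (orig N e)) x *
    (kside R N j `^ (- be) * \1_(gcube (orig N e) j (idx N (orig N e) x)) y).

Lemma kernel_le N (x y : E) : near_pair N x y ->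
  (Defs.edist x y `^ be)^-1 <= 6 `^ be * dkernel N x y.
Proof.
move=> np; have [e [j jN [kd xy]]] := common_cube np.
have bx : box N (orig N e) x by case: np => xL _ _ _; exact: box_orig.
have k0 := kside_gt0 R N j.
have d0 : 0 < Defs.edist x y by apply: lt_le_trans kd; rewrite divr_gt0.
have jN' : (j < (2 * N).+1)%N by rewrite ltnS.
have t0 e' (j' : 'I_(2 * N).+1) : 0 <= \1_(box N (orig N e')) x *
    (kside R N j' `^ (- be) * \1_(gcube (orig N e') j' (idx N (orig N e') x)) y) :> R.
  by rewrite !mulr_ge0 ?powR_ge0// indicE.
apply: (@le_trans _ _ (6 `^ be * kside R N j `^ (- be))); last first.
  rewrite ler_pM2l ?powR_gt0// /dkernel (bigD1 e)//= (bigD1 (Ordinal jN'))//= -addrA.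
  apply: ler_wpDr; last by rewrite !indicE !mem_set// mul1r mulr1.
  apply: addr_ge0; first by apply: sumr_ge0 => ? _; exact: t0.
  by apply: sumr_ge0 => ? _; apply: sumr_ge0 => ? _; exact: t0.
have -> : 6 `^ be * kside R N j `^ (- be) = ((kside R N j / 6) `^ be)^-1.
  rewrite powRM ?invr_ge0 ?(ltW k0)// invfM -powRN mulrC.
  congr (_ * _); rewrite -powRN -(powR_inv1 (ler0n _ 6)) -powRrM.
  by congr (_ `^ _); ring.
rewrite lef_pV2 ?posrE ?powR_gt0 ?divr_gt0//.
by apply: powR_le => //; [exact: ltW|rewrite divr_ge0// ltW].
Qed.

Lemma eventually_near (x y : E) : x != y ->
  exists N0, forall N, (N0 <= N)%N -> near_pair N x y.
Proof.
move=> xy.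
have [i ixy] : exists i, tnth x i != tnth y i.
  apply: contrapT => none; move/eqP: xy; apply; apply: eq_from_tnth => i.
  by apply/eqP/negPn/negP => h; apply: none; exists i.
pose d := `|tnth x i - tnth y i|.
have d0 : 0 < d by rewrite normr_gt0 subr_eq0.
pose M := \big[Num.max/0]_(i < n) `|tnth x i| + \big[Num.max/0]_(i < n) `|tnth y i|.
have mle (z : E) l : `|tnth z l| <= \big[Num.max/0]_(i < n) `|tnth z i|.
  by rewrite (bigD1 l)//= le_max lexx.
have m0 (z : E) : 0 <= \big[Num.max/0]_(i < n) `|tnth z i|.
  by apply: le_trans (mle z i).
exists (Num.truncn (3 * M + d^-1)).+1 => N hN.
have big : 3 * M + d^-1 < 2 ^+ N.
  apply: lt_trans (truncnS_gt _) _; apply: (@le_lt_trans _ _ N%:R).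
    by rewrite ler_nat.
  by rewrite -natrX ltr_nat ltn_expl.
have dV : 0 < d^-1 by rewrite invr_gt0.
have Mx := m0 x; have My := m0 y.
have ME : M = \big[Num.max/0]_(i < n) `|tnth x i| + \big[Num.max/0]_(i < n) `|tnth y i| by [].
split.
- by move=> l; have := mle x l; lra.
- by move=> l; have := mle y l; lra.
- move=> l; apply: le_lt_trans (ler_normB _ _) _.
  by have := mle x l; have := mle y l; lra.
- apply: le_trans (edist_ge x y i); rewrite -/d.
  have : d^-1 < 2 ^+ N by lra.
  rewrite /side exprVn => h.
  have : (2 ^+ N)^-1 < d by rewrite -[d]invrK ltf_pV2 ?posrE ?exprn_gt0.
  have : 0 < (2 ^+ N)^-1 :> R by rewrite invr_gt0 exprn_gt0.
  lra.
Qed.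

End kernel.

(** * The model operator on one grid *)

Section grid_operator.
Context (R : realType) (n : nat).
Local Notation E := (Rn R n).
Local Notation mu := (lebesgue_Rn R n).
Hypothesis n0 : (0 < n)%N.
Variables (v : E -> R) (al p q r s : R).
Hypotheses (mv : measurable_fun setT v) (v0 : forall x, 0 < v x).
Let a := al / n%:R.
Hypotheses (a01 : 0 < a < 1) (p1 : 1 < p) (q1 : 1 < q) (r1 : 1 < r) (s1 : 1 < s).
Hypotheses (pr : p^-1 + r^-1 = 1) (qs : q^-1 + s^-1 = 1) (apq : a = p^-1 - q^-1).
Local Notation sg := (dual_weight v q r).
Local Notation sv := (1 + q / r).
Local Notation ssg := (1 + r / q).
Hypothesis fin : (A_const sv (EFin \o v) < +oo)%E.

Let q0 : 0 < q. Proof. exact: lt_trans q1. Qed.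
Let r0 : 0 < r. Proof. exact: lt_trans r1. Qed.
Let p0 : 0 < p. Proof. exact: lt_trans p1. Qed.
Let msg := measurable_dual_weight q r mv.
Let sg0 := dual_weight_gt0 q r v0.
Let sg0' x : 0 <= sg x. Proof. exact: ltW (sg0 x). Qed.
Let v0' x : 0 <= v x. Proof. exact: ltW. Qed.

(** This is w^p when v = w^q. *)
Definition pweight x : R := v x `^ (p / q).
Local Notation up := pweight.

Variable g : E -> R.
Hypotheses (mg : measurable_fun setT g) (g0 : forall x, 0 <= g x).
Hypothesis gfin : (\int[mu]_x (g x `^ p * up x)%:E < +oo)%E.

Let mgp : measurable_fun setT (fun x => g x `^ p * up x).
Proof.
apply: measurable_funM; first exact: (measurableT_comp (measurable_powR _) mg).
exact: (measurableT_comp (measurable_powR _) mv).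
Qed.

Let gp0 x : 0 <= g x `^ p * up x. Proof. by rewrite mulr_ge0 ?powR_ge0. Qed.

Let Fp : R := fine (\int[mu]_x (g x `^ p * up x)%:E)%E.
Let FpE : (\int[mu]_x (g x `^ p * up x)%:E = Fp%:E)%E.
Proof.
rewrite /Fp fineK// ge0_fin_numE//.
by apply: integral_ge0 => x _; rewrite lee_fin.
Qed.

(** Hoelder for g = (g w) w^-1, where w = v^(1/q). *)
Lemma integral_g_le (D : set E) : measurable D ->
  (\int[mu]_(x in D) (g x)%:E <=
   (\int[mu]_(x in D) (g x `^ p * up x)%:E) `^ p^-1 *
   (\int[mu]_(x in D) (sg x)%:E) `^ r^-1)%E.
Proof.
move=> mD; have h := @hoelder_set _ _ _ mu D (fun x => g x * v x `^ q^-1)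
  (fun x => v x `^ (- q^-1)) p r mD.
have m1 : measurable_fun setT (fun x => g x * v x `^ q^-1).
  by apply: measurable_funM => //; exact: (measurableT_comp (measurable_powR _) mv).
have m2 : measurable_fun setT (fun x => v x `^ (- q^-1)).
  exact: (measurableT_comp (measurable_powR _) mv).
have {}h := h m1 m2 (fun x => mulr_ge0 (g0 x) (powR_ge0 _ _))
  (fun x => powR_ge0 _ _) p0 r0 pr.
have e1 : (\int[mu]_(x in D) (g x * v x `^ q^-1 * v x `^ (- q^-1))%:E =
    \int[mu]_(x in D) (g x)%:E)%E.
  apply: eq_integral => x _; rewrite -mulrA -powRD_gt0// subrr powRr0 mulr1//.
have e2 : (\int[mu]_(x in D) ((g x * v x `^ q^-1) `^ p)%:E =
    \int[mu]_(x in D) (g x `^ p * up x)%:E)%E.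
  by apply: eq_integral => x _; rewrite powRM ?powR_ge0// -(powRrM (v x)) /pweight (mulrC p).
have e3 : (\int[mu]_(x in D) ((v x `^ (- q^-1)) `^ r)%:E =
    \int[mu]_(x in D) (sg x)%:E)%E.
  by apply: eq_integral => x _; rewrite /dual_weight -powRrM mulNr (mulrC r).
by rewrite e1 e2 e3 in h.
Qed.

Lemma g_cube_finite c l : 0 < l -> (\int[mu]_(x in cube c l) (g x)%:E < +oo)%E.
Proof.
move=> l0; apply: le_lt_trans (integral_g_le (measurable_cube c l)) _.
have [_ hs] := cube_finite mv v0 q0 r0 fin c l0.
apply: lte_mul_pinfty; first exact: poweR_ge0.
- apply: fin_num_poweR; rewrite ge0_fin_numE.
    apply: le_lt_trans gfin; apply: ge0_subset_integral_any; [by move=> x; rewrite lee_fin|by []].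
  by apply: integral_ge0 => x _; rewrite lee_fin.
- exact: poweR_lty.
Qed.

Section one_grid.
Variables (N : nat) (o : E).
Local Notation Om := (Om n N).
Local Notation S := (dcubes n N).
Local Notation vol := (@vol R n N).

Let vfin c l (l0 : 0 < l) := (cube_finite mv v0 q0 r0 fin c l0).1.
Let sfin c l (l0 : 0 < l) := (cube_finite mv v0 q0 r0 fin c l0).2.

Let H := cellint (N := N) o g.
Let Sg := cellint (N := N) o sg.
Let Vg := cellint (N := N) o v.
Let H0 w : 0 <= H w.
Proof. by rewrite fine_ge0// integral_ge0// => x _; rewrite lee_fin. Qed.
Let Sg0 w : 0 < Sg w. Proof. exact: (cellint_gt0 o msg sg0' sfin w sg0). Qed.
Let Vg0 w : 0 < Vg w. Proof. exact: (cellint_gt0 o mv v0' vfin w v0). Qed.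

Definition grid_op (w : Om) : R := dyadic_op S (riesz_coef a vol) H w.

Lemma grid_op_ge0 w : 0 <= grid_op w.
Proof. by apply: dyadic_op_ge0 => // P; exact: powR_ge0. Qed.

(* The finite theorem is stated for f sg; here f is the ratio of the masses of g and
   sg in a cell. *)
Let fh w := H w / Sg w.
Let fh0 w : 0 <= fh w. Proof. by rewrite divr_ge0// ltW. Qed.
Let fhE : (fun w => fh w * Sg w) = H.
Proof. by apply/funext => w; rewrite /fh divfK// gt_eqF. Qed.

(* By Hoelder in each cell, averaging in this way does not increase the norm. *)
Let fh_sum : \sum_w fh w `^ p * Sg w <= Fp.
Proof.
have rp : - (r^-1 * p) = - p + 1.
  have -> : r^-1 = 1 - p^-1 by have h' := pr; lra.
  by field; rewrite gt_eqF.
have mG (w : Om) : measurable (fcube o w) by exact: measurable_gcube.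
pose Fw (w : Om) : R := fine (\int[mu]_(x in fcube o w) (g x `^ p * up x)%:E)%E.
have FwE (w : Om) : (\int[mu]_(x in fcube o w) (g x `^ p * up x)%:E = (Fw w)%:E)%E.
  rewrite /Fw fineK// ge0_fin_numE.
    apply: le_lt_trans gfin; apply: ge0_subset_integral_any; [by move=> x; rewrite lee_fin|by []].
  by apply: integral_ge0 => x _; rewrite lee_fin.
have Fw0 w : 0 <= Fw w by rewrite fine_ge0// integral_ge0// => x _; rewrite lee_fin.
have loc w : fh w `^ p * Sg w <= Fw w.
  have := integral_g_le (mG w); rewrite FwE (cellintE o sg0' sfin w).
  rewrite (cellintE o g0 g_cube_finite w) !poweR_EFin -EFinM lee_fin -/(H w) -/(Sg w) => h.
  have {}h := powR_le (ltW p0) (H0 w) h.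
  rewrite powRM ?powR_ge0// -(powRrM (Fw w)) -(powRrM (Sg w)) mulVf ?gt_eqF// powRr1// in h.
  rewrite /fh powRM ?invr_ge0 ?(ltW (Sg0 w))// -mulrA.
  have e : (Sg w)^-1 `^ p * Sg w = Sg w `^ (- (r^-1 * p)).
    have S0 := Sg0 w; move: (Sg w) S0 => y y0.
    by rewrite -powR_inv1 ?(ltW y0)// -powRrM mulN1r rp powRD_gt0// powRr1// ltW.
  rewrite e powRN ler_pdivrMr// powR_gt0//.
apply: le_trans (ler_sum _ (fun w _ => loc w)) _.
rewrite -lee_fin -FpE -sumEFin.
under eq_bigr do rewrite -FwE.
have -> : (\sum_(w : Om) (\int[mu]_(x in fcube o w) (g x `^ p * up x)%:E) =
    \int[mu]_(x in region o [set: Om]%SET) (g x `^ p * up x)%:E)%E.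
  rewrite [RHS]integral_region; first by apply: eq_bigl => w; rewrite inE.
  - exact/measurable_EFinP.
  - by move=> x; rewrite lee_fin.
by apply: ge0_subset_integral_any; [move=> x; rewrite lee_fin|].
Qed.

Variable B : R.
Hypotheses (B0 : 0 < B) (BE : mixed_const sv q^-1 r^-1 (EFin \o v) = B%:E).
Let A := fine (A_const sv (EFin \o v)).
Let A1 : 1 <= A.
Proof.
have [P PS] := dcubes_exists n N.
by have /andP[h1 h2] := muckenhoupt_bounds o mv v0 q0 r0 fin PS; exact: le_trans h2.
Qed.

Lemma grid_weak t : 0 < t ->
  (\int[mu]_x (stepf o (fun w : Om => (t < grid_op w)%R%:R) x * v x)%:E <=
   ((finite_weak_const a q r * ((1 + ln A) `^ r^-1 * B)) `^ q * Fp `^ (q / p) * t `^ (- q))%:E)%E.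
Proof.
move=> t0; rewrite integral_stepf//.
under eq_bigr do rewrite (cellintE o v0' vfin) -EFinM.
rewrite sumEFin lee_fin.
rewrite (eq_bigr (fun w => if t < grid_op w then Vg w else 0)); last first.
  by move=> w _; case: ifP; rewrite ?mul1r ?mul0r.
rewrite -big_mkcond/= powRN ler_pdivlMr ?powR_gt0// mulrC.
have := finite_weak (@dcubes_laminar n N) (@dcubes_doubling R n N o n0) (@vol_gt0 R n N)
  Sg0 Vg0 (@dcubes_nonempty n N) a01 p1 q1 r1 pr apq A1 B0
  (muckenhoupt_bounds o mv v0 q0 r0 fin) (fun P => muckenhoupt_mixed o mv v0 q0 r0 fin BE) fh0 t0.
rewrite -/Sg -/Vg fhE => h; apply: le_trans h _.
rewrite ler_wpM2l ?powR_ge0//; apply: powR_le => //.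
  by rewrite divr_ge0 ?(ltW q0)// ltW.
by apply: sumr_ge0 => w _; rewrite mulr_ge0 ?powR_ge0// ltW.
Qed.

Variable B' : R.
Hypothesis fin' : (A_const ssg (EFin \o sg) < +oo)%E.
Hypotheses (B'0 : 0 < B') (BE' : mixed_const ssg r^-1 q^-1 (EFin \o sg) = B'%:E).
Let A' := fine (A_const ssg (EFin \o sg)).

Lemma grid_strong :
  (\int[mu]_x (stepf o (fun w : Om => (grid_op w) `^ q) x * v x)%:E <=
   ((finite_strong_const a q r s * ((1 + ln A) `^ r^-1 * B) +
     finite_strong_const' a p q r * ((1 + ln A') `^ q^-1 * B')) `^ q * Fp `^ (q / p))%:E)%E.
Proof.
rewrite integral_stepf//; last by move=> w; exact: powR_ge0.
under eq_bigr do rewrite (cellintE o v0' vfin) -EFinM.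
rewrite sumEFin lee_fin.
have mb' := muckenhoupt_bounds (N := N) o msg sg0 r0 q0 fin'.
have mm' P := @muckenhoupt_mixed _ _ N o _ _ _ msg sg0 r0 q0 fin' P _ BE'.
rewrite (dual_weightK v0 q0 r0) in mb' mm'.
have A'1 : 1 <= A'.
  have [P PS] := dcubes_exists n N.
  by have /andP[h1 h2] := mb' P PS; exact: le_trans h2.
have h := finite_strong (@dcubes_laminar n N) (@dcubes_doubling R n N o n0) (@vol_gt0 R n N)
  Sg0 Vg0 (@dcubes_nonempty n N) a01 p1 q1 r1 s1 pr qs apq A1 B0
  (muckenhoupt_bounds o mv v0 q0 r0 fin) (fun P => muckenhoupt_mixed o mv v0 q0 r0 fin BE)
  A'1 B'0 mb' mm' fh0.
rewrite fhE in h.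
rewrite (eq_bigr (fun w => Vg w * grid_op w `^ q)); last by move=> w _; rewrite mulrC.
apply: le_trans h _.
rewrite ler_wpM2l ?powR_ge0//; apply: powR_le => //.
  by rewrite divr_ge0 ?(ltW q0)// ltW.
by apply: sumr_ge0 => w _; rewrite mulr_ge0 ?powR_ge0// ltW.
Qed.

End one_grid.
End grid_operator.

(** * The Riesz potential is dominated by the grid operators *)

Section pointwise.
Context (R : realType) (n : nat).
Local Notation E := (Rn R n).
Local Notation mu := (lebesgue_Rn R n).
Hypothesis n0 : (0 < n)%N.
Variables (al : R) (g : E -> R).
Hypotheses (al_n : al < n%:R).
Hypotheses (mg : measurable_fun setT g) (g0 : forall x, 0 <= g x).
Hypothesis gfin : forall c l, 0 < l -> (\int[mu]_(x in cube c l) (g x)%:E < +oo)%E.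

Local Notation be := (n%:R - al).
Let be0 : 0 < be. Proof. by rewrite subr_gt0. Qed.

Definition potential x : \bar R :=
  (\int[mu]_y (g y / Defs.edist x y `^ be)%:E)%E.

Definition grid_op_sum N x : R :=
  \sum_(e : {ffun 'I_n -> bool}) stepf (orig R N e) (grid_op al g (N := N) (orig R N e)) x.

Lemma riesz_coef_ccube N (o : E) j (w : Om n N) : (j <= 2 * N)%N ->
  riesz_coef (al / n%:R) (@vol R n N) (ccube j w) = kside R N j `^ (- be).
Proof.
move=> jN; rewrite /riesz_coef (mass_vol o)// -/(kside R N j).
have k0 := kside_gt0 R N j.
rewrite -powR_mulrn ?(ltW k0)// -powRrM; congr (_ `^ _).
by field; rewrite pnatr_eq0 -lt0n.
Qed.

Let dk N (e : {ffun 'I_n -> bool}) x :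
  \sum_(j < (2 * N).+1) \1_(box N (orig R N e)) x * kside R N j `^ (- be) *
     wint g (gcube (orig R N e) j (idx N (orig R N e) x)) =
  stepf (orig R N e) (grid_op al g (N := N) (orig R N e)) x.
Proof.
set o := orig R N e.
have [bx|bx] := pselect (box N o x); last first.
  rewrite stepf_out// big1// => j _; rewrite indicE memNset ?mul0r//.
have xf : fcube o (idx N o x) x by apply/fcubeP.
rewrite (stepf_in _ xf) /grid_op /dyadic_op.
rewrite -(dcubes_sum o n0 (fun P => riesz_coef _ _ P * mass _ P) (idx N o x)).
apply: eq_bigr => j _; have jN : (j <= 2 * N)%N by rewrite -ltnS.
by rewrite (riesz_coef_ccube o)// (mass_cellint o mg g0 gfin)// indicE mem_set// mul1r.
Qed.

Lemma integral_dkernel N x :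
  (\int[mu]_y (6 `^ be * dkernel be N x y * g y)%:E = (6 `^ be * grid_op_sum N x)%:E)%E.
Proof.
pose IJ := ({ffun 'I_n -> bool} * 'I_(2 * N).+1)%type.
pose c (i : IJ) := 6 `^ be * (\1_(box N (orig R N i.1)) x * kside R N i.2 `^ (- be)).
pose D (i : IJ) := gcube (orig R N i.1) i.2 (idx N (orig R N i.1) x).
have c0 i : 0 <= c i by rewrite !mulr_ge0 ?powR_ge0// indicE.
have mD i : measurable (D i) by exact: measurable_gcube.
transitivity (\int[mu]_y ((\sum_i c i * \1_(D i) y) * g y)%:E)%E.
  apply: eq_integral => y _; congr (_ * _)%:E; rewrite /dkernel big_distrr/=.
  rewrite -(pair_bigA _ (fun e j => c (e, j) * \1_(D (e, j)) y))/=.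
  apply: eq_bigr => e _; rewrite big_distrr/=; apply: eq_bigr => j _.
  by rewrite /c /D /= !mulrA.
rewrite integral_sum_indic//.
have gE i : (\int[mu]_(y in D i) (g y)%:E = (wint g (D i))%:E)%E.
  have k0 := kside_gt0 R N i.2.
  exact: (wint_sub k0 g0 (gfin _ k0) (@hcube_sub _ _ _ _)).
under eq_bigr do rewrite gE -EFinM.
rewrite sumEFin; congr EFin; rewrite /grid_op_sum big_distrr/=.
rewrite -(pair_bigA _ (fun e j => c (e, j) * wint g (D (e, j))))/=.
apply: eq_bigr => e _; rewrite -dk big_distrr/=; apply: eq_bigr => j _.
by rewrite /c /D /= !mulrA.
Qed.

(** Off the diagonal, [kernel_le] holds for all large N, and Fatou gives the
    integral; on the diagonal the kernel is 0. *)
Lemma potential_le x :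
  (potential x <= limn_einf (fun N => (6 `^ be * grid_op_sum N x)%:E))%E.
Proof.
have dk0 N y : 0 <= dkernel be N x y.
  apply: sumr_ge0 => e _; apply: sumr_ge0 => j _.
  by rewrite !mulr_ge0 ?powR_ge0// indicE.
rewrite [X in (_ <= limn_einf X)%E](_ : _ = (fun N =>
    \int[mu]_y (6 `^ be * dkernel be N x y * g y)%:E)%E); last first.
  by apply/funext => N; rewrite integral_dkernel.
apply: fatou_bound.
- move=> N; apply/measurable_EFinP; apply: measurable_funM => //.
  apply: measurable_funM => //; apply: measurable_sum => e; apply: measurable_sum => j.
  apply: measurable_funM => //; apply: measurable_funM => //.
  by apply: measurable_indic; exact: measurable_gcube.
- by move=> N y; rewrite lee_fin !mulr_ge0 ?powR_ge0.
- by move=> y; rewrite lee_fin mulr_ge0// invr_ge0 powR_ge0.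
move=> y; have [->|xy] := eqVneq x y.
  have -> : Defs.edist y y = 0.
    by rewrite /Defs.edist big1 ?sqrtr0// => i _; rewrite subrr expr0n.
  rewrite powR0 ?gt_eqF// invr0 mulr0; apply: (@limn_einf_ge _ _ 0 0%N) => N _.
  have h : 0 <= dkernel be N y y.
    apply: sumr_ge0 => e _; apply: sumr_ge0 => j _.
    by rewrite !mulr_ge0 ?powR_ge0// indicE.
  by rewrite lee_fin !mulr_ge0 ?powR_ge0.
have [N0 hN] := eventually_near xy.
apply: (@limn_einf_ge _ _ _ N0) => N NN; rewrite lee_fin mulrC ler_wpM2r//.
exact: (kernel_le be0 (hN _ NN)).
Qed.

End pointwise.

(** * From the grids to the Riesz potential *)

(** Without measurability or integrability: if both parts have infinite integral, so
    has the modulus. *)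
Lemma abse_integral_le d (T : measurableType d) (R : realType)
    (mu : {measure set T -> \bar R}) (f : T -> \bar R) :
  (`|\int[mu]_x f x| <= \int[mu]_x `|f x|)%E.
Proof.
have h0 : (forall x, 0 <= `|f x|)%E by move=> x; exact: abse_ge0.
have P0 : (0 <= \int[mu]_x (f ^\+ x))%E by apply: integral_ge0 => x _; exact: funepos_ge0.
have N0 : (0 <= \int[mu]_x (f ^\- x))%E by apply: integral_ge0 => x _; exact: funeneg_ge0.
have Pl : (\int[mu]_x (f ^\+ x) <= \int[mu]_x `|f x|)%E.
  apply: ge0_le_integral_any => // x _.
  by rewrite funeposE ge_max lee_abs abse_ge0.
have Nl : (\int[mu]_x (f ^\- x) <= \int[mu]_x `|f x|)%E.
  apply: ge0_le_integral_any => // x _.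
  by rewrite funenegE ge_max -abseN lee_abs abse_ge0.
rewrite integralE; move: P0 N0 Pl Nl.
move: (\int[mu]_x (f ^\+ x))%E (\int[mu]_x (f ^\- x))%E (\int[mu]_x `|f x|)%E.
move=> [a| |] [b| |] [c| |]//=; rewrite ?lee_fin => h1 h2 h3 h4; rewrite ?leey//.
by rewrite ler_norml; apply/andP; split; lra.
Qed.

Section norm_bounds.
Context (R : realType) (n : nat).
Local Notation E := (Rn R n).
Local Notation mu := (lebesgue_Rn R n).
Hypothesis n0 : (0 < n)%N.
Variables (al : R) (g v : E -> R).
Hypotheses (al_n : al < n%:R).
Hypotheses (mg : measurable_fun setT g) (g0 : forall x, 0 <= g x).
Hypothesis gfin : forall c l, 0 < l -> (\int[mu]_(x in cube c l) (g x)%:E < +oo)%E.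
Hypotheses (mv : measurable_fun setT v) (v0 : forall x, 0 < v x).

Definition ngrids : R := #|{ffun 'I_n -> bool}|%:R.
Definition potential_const : R := 6 `^ (n%:R - al) * ngrids.

Lemma ngrids_gt0 : 0 < ngrids.
Proof. by rewrite ltr0n; apply/card_gt0P; exists [ffun=> true]. Qed.

Lemma potential_const_gt0 : 0 < potential_const.
Proof. by rewrite mulr_gt0 ?ngrids_gt0// powR_gt0. Qed.

Local Notation gs N e x := (stepf (orig R N e) (grid_op al g (N := N) (orig R N e)) x).

Let gs0 N e x : 0 <= gs N e x.
Proof. by apply: stepf_ge0 => w; exact: grid_op_ge0. Qed.

(** One of the 2^n grids carries at least the average share of the sum. *)
Lemma grid_op_sum_max N x : exists e, 6 `^ (n%:R - al) * grid_op_sum al g N x <= potential_const * gs N e x.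
Proof.
pose e0 : {ffun 'I_n -> bool} := [ffun=> true].
case: (@arg_maxP _ _ _ e0 xpredT (fun e => gs N e x) isT) => e _ he.
exists e; rewrite /potential_const -mulrA ler_wpM2l ?powR_ge0//.
rewrite /grid_op_sum /ngrids mulr_natl -sumr_const.
by apply: ler_sum => e' _; exact: he.
Qed.

Variable q : R.
Hypothesis q0 : 0 < q.

Lemma potential_ge0 x : (0 <= potential al g x)%E.
Proof. by apply: integral_ge0 => y _; rewrite lee_fin mulr_ge0// invr_ge0 powR_ge0. Qed.

Let stepf_map N (o : E) x (c : Om n N -> R) (f : R -> R) : f 0 = 0 ->
  stepf o (fun w => f (c w)) x = f (stepf o c x).
Proof.
move=> f0; have [bx|bx] := pselect (box N o x); last by rewrite !stepf_out.
have xf : fcube o (idx N o x) x by apply/fcubeP.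
by rewrite !(stepf_in _ xf).
Qed.

(** Where the potential exceeds t, for all large N some grid operator exceeds
    t / [potential_const]; Fatou applies to the sum over the grids of the indicators. *)
Lemma potential_weak (K t : R) : 0 < t ->
  (forall N (o : E) (t' : R), (0 < t')%R ->
    \int[mu]_x (stepf o (fun w : Om n N => (t' < grid_op al g o w)%R%:R) x * v x)%:E
     <= (K * t' `^ (- q))%:E)%E ->
  (wmeas (EFin \o v) [set x | t%:E < potential al g x]
   <= (ngrids * (K * (t / potential_const) `^ (- q)))%:E)%E.
Proof.
move=> t0 hK; have c0 := potential_const_gt0.
set t' := t / potential_const; have t'0 : 0 < t' by rewrite divr_gt0.
pose F N x : \bar R := (\sum_e (stepf (orig R N e)
  (fun w => (t' < grid_op al g (N := N) (orig R N e) w)%R%:R) x * v x)%:E)%E.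
have F0 N e x : (0 <= (stepf (orig R N e)
    (fun w => (t' < grid_op al g (N := N) (orig R N e) w)%R%:R) x * v x)%:E)%E.
  by rewrite lee_fin mulr_ge0 ?(ltW (v0 x))//; exact: stepf_ge0.
have mF N e : measurable_fun setT (fun x => (stepf (orig R N e)
    (fun w => (t' < grid_op al g (N := N) (orig R N e) w)%R%:R) x * v x)%:E).
  by apply/measurable_EFinP; apply: measurable_funM => //; exact: measurable_stepf.
rewrite /wmeas integral_mkcond.
apply: (@le_trans _ _ (limn_einf (fun N => \int[mu]_x F N x)))%E; last first.
  apply: limn_einf_le => N; rewrite ge0_integral_sum//.
  apply: (@le_trans _ _ (\sum_(e : {ffun 'I_n -> bool}) (K * t' `^ (- q))%:E)%E).
    by apply: lee_sum => e _; exact: hK.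
  by rewrite sumEFin sumr_const -mulr_natl.
apply: fatou_bound.
- by move=> N; apply: emeasurable_sum => e; exact: mF.
- by move=> N x; apply: sume_ge0 => e _; exact: F0.
- by move=> x; rewrite patchE; case: ifP => //= _; rewrite lee_fin ltW.
move=> x; rewrite patchE; case: ifPn => [/set_mem /= tp|_]; last first.
  by apply: (@limn_einf_ge _ _ _ 0%N) => N _; apply: sume_ge0.
have [N0 hN] := lt_limn_einf (lt_le_trans tp (potential_le n0 al_n mg g0 gfin x)).
apply: (@limn_einf_ge _ _ _ N0) => N NN; have := hN N NN; rewrite lte_fin => h.
have [e he] := grid_op_sum_max N x.
have {}he : t' < gs N e x.
  by rewrite /t' ltr_pdivrMr// mulrC; exact: lt_le_trans he.
rewrite /F (bigD1 e)//= -[leLHS]adde0; apply: leeD; last exact: sume_ge0.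
rewrite (@stepf_map N (orig R N e) x (grid_op al g (orig R N e)) (fun y => (t' < y)%R%:R)).
  by rewrite he mul1r.
by rewrite ltNge (ltW t'0).
Qed.

Lemma potential_strong (K : R) :
  (forall N (o : E),
    \int[mu]_x (stepf o (fun w : Om n N => grid_op al g o w `^ q) x * v x)%:E <= K%:E)%E ->
  (\int[mu]_x (potential al g x `^ q * (v x)%:E) <= (potential_const `^ q * (ngrids * K))%:E)%E.
Proof.
move=> hK; have c0 := potential_const_gt0.
pose G N e x : \bar R := (stepf (orig R N e)
  (fun w => grid_op al g (N := N) (orig R N e) w `^ q) x * v x)%:E.
pose F N x : \bar R := ((potential_const `^ q)%:E * \sum_e G N e x)%E.
have F0 N e x : (0 <= G N e x)%E.
  by rewrite lee_fin mulr_ge0 ?(ltW (v0 x))//; apply: stepf_ge0 => w; exact: powR_ge0.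
have mF N e : measurable_fun setT (G N e).
  by apply/measurable_EFinP; apply: measurable_funM => //; exact: measurable_stepf.
apply: (@le_trans _ _ (limn_einf (fun N => \int[mu]_x F N x)))%E; last first.
  apply: limn_einf_le => N; rewrite ge0_integralZl_EFin ?powR_ge0//; last 2 first.
  - by move=> x _; exact: sume_ge0.
  - by apply: emeasurable_sum => e; exact: mF.
  rewrite EFinM lee_wpmul2l ?lee_fin ?powR_ge0// ge0_integral_sum//.
  apply: (@le_trans _ _ (\sum_(e : {ffun 'I_n -> bool}) K%:E)%E).
    by apply: lee_sum => e _; exact: hK.
  by rewrite sumEFin sumr_const -mulr_natl.
apply: fatou_bound.
- by move=> N; apply: measurable_funeM; apply: emeasurable_sum => e; exact: mF.
- by move=> N x; rewrite mule_ge0 ?lee_fin ?powR_ge0//; exact: sume_ge0.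
- by move=> x; rewrite mule_ge0 ?poweR_ge0// lee_fin ltW.
move=> x.
have gs_ge0 N : 0 <= 6 `^ (n%:R - al) * grid_op_sum al g N x.
  by rewrite mulr_ge0 ?powR_ge0//; apply: sumr_ge0 => e _; exact: gs0.
apply: le_trans (limn_einf_powM q0 (v0 x) gs_ge0 (potential_ge0 x)
  (potential_le n0 al_n mg g0 gfin x)) _.
rewrite !limn_einfE; apply: ge_ereal_sup => _ [N0 _ <-]; apply: ereal_sup_ge.
exists (einfs (F ^~ x) N0); first by exists N0.
apply: le_ereal_inf_tmp => _ [N /= NN <-].
apply: (@le_trans _ _ ((6 `^ (n%:R - al) * grid_op_sum al g N x) `^ q * v x)%:E).
  by apply: ereal_inf_lbound; exists N.
have [e he] := grid_op_sum_max N x.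
apply: (@le_trans _ _ ((potential_const `^ q)%:E * G N e x)%E); last first.
  rewrite lee_wpmul2l ?lee_fin ?powR_ge0//.
  by rewrite (bigD1 e)//= -[leLHS]adde0; apply: leeD => //; exact: sume_ge0.
rewrite /G (@stepf_map N (orig R N e) x (grid_op al g (orig R N e)) (fun y => y `^ q)); last first.
  by rewrite powR0 ?gt_eqF.
rewrite -EFinM lee_fin mulrA ler_wpM2r ?(ltW (v0 x))// -powRM ?(ltW c0)//.
by apply: powR_le => //; exact: ltW.
Qed.

End norm_bounds.

(** * Lower bounds and duality for the constants *)

Section constants.
Context (R : realType) (n : nat).
Local Notation E := (Rn R n).
Local Notation mu := (lebesgue_Rn R n).
Variables (v : E -> R) (q r : R).
Hypotheses (mv : measurable_fun setT v) (v0 : forall x, 0 < v x).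
Hypotheses (q0 : 0 < q) (r0 : 0 < r).
Local Notation s := (1 + q / r).
Hypothesis fin : (A_const s (EFin \o v) < +oo)%E.

Let v0' x : (0 <= (EFin \o v) x)%E. Proof. by rewrite lee_fin ltW. Qed.

Lemma A_const_ge1 : (1 <= A_const s (EFin \o v))%E.
Proof.
apply: ereal_sup_ge; eexists; first by eexists; [exact: cubes_unit|].
exact: (A_loc_ge1 mv v0 q0 r0 fin _ ltr01).
Qed.

(** At each point of Q the maximal function is at least the average over Q. *)
Lemma AMinf_loc_ge1 c l : 0 < l -> (1 <= AMinf_loc (EFin \o v) (cube c l))%E.
Proof.
move=> l0; set Q := cube c l.
have [hv _] := cube_finite mv v0 q0 r0 fin c l0.
have ln0 : 0 < l ^+ n by exact: exprn_gt0.
have mQ : measurable Q := measurable_cube c l.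
have muQ : mu Q = (l ^+ n)%:E by exact: volume_cube.
have Q0 : mu Q != 0%E by rewrite muQ eqe gt_eqF.
have : (0 < wmeas (EFin \o v) Q)%E.
  exact: (integral_pos mQ Q0 mv v0).
have [V VE] : exists V : R, wmeas (EFin \o v) Q = V%:E.
  exists (fine (wmeas (EFin \o v) Q)); rewrite fineK// ge0_fin_numE//.
  by apply: integral_ge0 => x _; exact: v0'.
rewrite /AMinf_loc VE lte_fin => V0; rewrite inver gt_eqF//.
rewrite -(@lee_pmul2l _ V%:E)// mule1 muleA -EFinM divff ?gt_eqF// mul1e.
have dmax x : Q x -> ((V / l ^+ n)%:E <= maximal ((EFin \o v) \_ Q) x)%E.
  move=> Qx; apply: ereal_sup_ge; exists (avg (abse \o ((EFin \o v) \_ Q)) Q).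
    by exists Q => //; split=> //; exact: cubes_cube.
  rewrite /avg muQ inver gt_eqF// EFinM lee_wpmul2r ?lee_fin ?invr_ge0 ?(ltW ln0)//.
  rewrite -VE /wmeas; apply: le_of_eq; apply: eq_integral => y yQ.
  by rewrite /= patchE yQ /= ger0_norm// ltW.
have -> : V%:E = (\int[mu]_(x in Q) (cst (V / l ^+ n)%:E x))%E.
  rewrite integral_cst//; transitivity ((V / l ^+ n)%:E * mu Q)%E => //.
  by rewrite muQ -EFinM divfK// gt_eqF.
rewrite !(integral_mkcond Q); apply: ge0_le_integral_any => [x|x|x _].
- by apply: erestrict_ge0 => y _; rewrite lee_fin divr_ge0 ?ltW.
- rewrite patchE; case: ifPn => [/set_mem Qx|//].
  by apply: le_trans (dmax x Qx); rewrite lee_fin divr_ge0 ?ltW.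
- by rewrite !patchE; case: ifPn => [/set_mem|//]; exact: dmax.
Qed.

Lemma mixed_const_ge1 b c : 0 <= b -> 0 <= c ->
  (1 <= mixed_const s b c (EFin \o v))%E.
Proof.
move=> b0 c0; apply: ereal_sup_ge; eexists; first by eexists; [exact: cubes_unit|].
have h (x : \bar R) d : 0 <= d -> (1 <= x)%E -> (1 <= epow x d)%E.
  by move=> d0 x1; rewrite epow_nneg// -(poweR1r d); exact: poweR_le.
apply: le_trans (lee_pmul _ _ (h _ _ b0 (A_loc_ge1 mv v0 q0 r0 fin _ ltr01))
  (h _ _ c0 (AMinf_loc_ge1 _ ltr01))) => //.
by rewrite mule1.
Qed.

(** Cube by cube, the quantity for the dual weight is the power r/q of that for v. *)
Lemma A_const_dual : (A_const (1 + r / q) (EFin \o dual_weight v q r) < +oo)%E.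
Proof.
set sg := dual_weight v q r.
have sg0 : forall x, 0 < sg x by exact: dual_weight_gt0.
have qr0 : 0 < q / r by exact: divr_gt0.
have rq0 : 0 < r / q by exact: divr_gt0.
have sgK : dual_weight sg r q = v := dual_weightK v0 q0 r0.
have A0 := le_trans lee01 A_const_ge1.
have AE : A_const s (EFin \o v) = (fine (A_const s (EFin \o v)))%:E.
  by rewrite fineK// ge0_fin_numE.
apply: (@le_lt_trans _ _ ((A_const s (EFin \o v)) `^ (r / q))%E); last first.
  by rewrite poweR_lty.
apply: ge_ereal_sup => _ [Q [c [l [l0 QE]]] <-]; subst Q.
have : (A_loc s (EFin \o v) (cube c l) <= A_const s (EFin \o v))%E.
  by apply: ereal_sup_ubound; exists (cube c l) => //; exact: cubes_cube.
rewrite (A_loc_dualE v0 q0 r0) (A_loc_dualE sg0 r0 q0) sgK -/sg => h.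
have [hv hs] := cube_finite mv v0 q0 r0 fin c l0.
have muQ : mu (cube c l) = (l ^+ n)%:E by exact: volume_cube.
have ln0 : 0 < l ^+ n by exact: exprn_gt0.
have av (g : E -> R) : (forall x, 0 < g x) ->
    (\int[mu]_(x in cube c l) (g x)%:E < +oo)%E ->
    exists2 y : R, 0 <= y & avg (EFin \o g) (cube c l) = y%:E.
  move=> g0 gf; have ag : (0 <= avg (EFin \o g) (cube c l))%E.
    by apply: avg_ge0 => x; rewrite lee_fin ltW.
  exists (fine (avg (EFin \o g) (cube c l))); first exact: fine_ge0.
  rewrite fineK// ge0_fin_numE// /avg muQ inver gt_eqF//.
  by apply: lte_mul_pinfty => //; [rewrite integral_ge0// => x _; rewrite lee_fin ltW|
    rewrite ge0_fin_numE// integral_ge0// => x _; rewrite lee_fin ltW|rewrite ltry].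
have [x x0 xE] := av v v0 hv.
have [y y0 yE] := av sg sg0 hs.
move: h; rewrite xE yE AE !poweR_EFin -!EFinM !lee_fin => h.
have -> : y * x `^ (r / q) = (x * y `^ (q / r)) `^ (r / q).
  rewrite powRM ?powR_ge0// -powRrM.
  have -> : q / r * (r / q) = 1 by field; rewrite !gt_eqF.
  by rewrite powRr1// mulrC.
by apply: powR_le => //; [exact: ltW|rewrite mulr_ge0 ?powR_ge0].
Qed.

End constants.

(** * Bounds for a positive weight *)

Section operator_bounds.
Context (R : realType) (n : nat).
Local Notation E := (Rn R n).
Local Notation mu := (lebesgue_Rn R n).
Hypothesis n0 : (0 < n)%N.
Variables (v : E -> R) (al p q r s : R).
Hypotheses (mv : measurable_fun setT v) (v0 : forall x, 0 < v x).
Local Notation a := (al / n%:R).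
Hypotheses (a01 : 0 < a < 1) (p1 : 1 < p) (q1 : 1 < q) (r1 : 1 < r) (s1 : 1 < s).
Hypotheses (pr : p^-1 + r^-1 = 1) (qs : q^-1 + s^-1 = 1) (apq : a = p^-1 - q^-1).
Local Notation sg := (dual_weight v q r).
Local Notation sv := (1 + q / r).
Local Notation ssg := (1 + r / q).
Hypothesis fin : (A_const sv (EFin \o v) < +oo)%E.
Local Notation up := (pweight v p q).

Let q0 : 0 < q. Proof. exact: lt_trans q1. Qed.
Let r0 : 0 < r. Proof. exact: lt_trans r1. Qed.
Let p0 : 0 < p. Proof. exact: lt_trans p1. Qed.
Let aln : al < n%:R.
Proof. by have /andP[_] := a01; rewrite ltr_pdivrMr ?ltr0n// mul1r. Qed.
Let up0 x : 0 <= up x. Proof. exact: powR_ge0. Qed.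

Lemma riesz_le_potential (f : E -> R) x :
  (`|riesz al f x| <= potential al (fun y => `|f y|%R) x)%E.
Proof.
apply: le_trans (abse_integral_le _ _) _; apply: le_of_eq.
apply: eq_integral => y _.
by rewrite abse_EFin normrM [X in _ * X]ger0_norm// invr_ge0 powR_ge0.
Qed.

(** The modulus of a Borel version of f has the same norm, and its potential
    dominates that of f. *)
Lemma in_Lp_Borel (f : E -> R) : in_Lp p (EFin \o up) f ->
  exists g : E -> R, [/\ measurable_fun setT g, forall x, 0 <= g x,
    (\int[mu]_x (g x `^ p * up x)%:E < +oo)%E,
    forall x, (`|riesz al f x| <= potential al g x)%E &
    strong_norm p (EFin \o up) (EFin \o f) =
      ((fine (\int[mu]_x (g x `^ p * up x)%:E)%E) `^ p^-1)%:E].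
Proof.
move=> [[g mg fg] fin_f]; exists (fun x => `|g x|).
have sE : strong_norm p (EFin \o up) (EFin \o f) =
    ((\int[mu]_x (`|g x| `^ p * up x)%:E) `^ p^-1)%E.
  rewrite (strong_norm_ae p _ fg); last by move=> x; rewrite lee_fin.
  rewrite /strong_norm epow_nneg ?invr_ge0 ?(ltW p0)//; congr poweR.
  by apply: eq_integral => x _; rewrite /= epow_nneg ?(ltW p0)// poweR_EFin EFinM.
have gf : (\int[mu]_x (`|g x| `^ p * up x)%:E < +oo)%E.
  by apply: (@lty_poweRy _ _ p^-1); rewrite ?invr_eq0 ?gt_eqF// -sE.
split => //; first exact: (measurableT_comp (@normr_measurable _ _) mg).
  by move=> x; rewrite (riesz_ae al x fg); exact: riesz_le_potential.
rewrite sE -poweR_EFin fineK// ge0_fin_numE//.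
by apply: integral_ge0 => x _; rewrite lee_fin mulr_ge0 ?powR_ge0.
Qed.

Variable B : R.
Hypotheses (B0 : 0 < B) (BE : mixed_const sv q^-1 r^-1 (EFin \o v) = B%:E).
Local Notation A := (fine (A_const sv (EFin \o v))).

Definition weak_const : R := ngrids R n `^ q^-1 * potential_const n al * finite_weak_const a q r.

Lemma riesz_weak (f : E -> R) : in_Lp p (EFin \o up) f ->
  (weak_norm q (EFin \o v) (riesz al f) <=
   (weak_const * ((1 + ln A) `^ r^-1 * B))%:E * strong_norm p (EFin \o up) (EFin \o f))%E.
Proof.
move=> /in_Lp_Borel[g [mg g0 gf rg ->]].
set F := fine (integral _ _ _); have F0 : 0 <= F.
  by apply: fine_ge0; apply: integral_ge0 => x _; rewrite lee_fin mulr_ge0 ?powR_ge0.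
have gc := g_cube_finite mv v0 p1 q1 r1 pr fin mg g0 gf.
set X := _ `^ _ * B; set W := finite_weak_const a q r * X.
have c0 := potential_const_gt0 n al.
have weak_bd N (o : E) t :=
  @grid_weak _ _ n0 _ _ _ _ _ mv v0 a01 p1 q1 r1 pr apq fin _ mg g0 gf N o _ B0 BE t.
apply: ge_ereal_sup => _ [t /= t0 <-].
have h := potential_weak n0 aln mg g0 gc mv v0 t0 (fun N o => weak_bd N o).
have sub : [set x | t%:E < `|riesz al f x|]%E `<=` [set x | t%:E < potential al g x]%E.
  by move=> x /= tx; exact: lt_le_trans (rg x).
have vv x : (0 <= (EFin \o v) x)%E by rewrite lee_fin ltW.
have {}h := le_trans (ge0_subset_integral_any mu vv sub) h.
have w0 : (0 <= wmeas (EFin \o v) [set x | t%:E < `|riesz al f x|])%E by exact: integral_ge0.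
have qi0 : 0 <= q^-1 by rewrite invr_ge0 ltW.
have := poweR_le qi0 w0 h; rewrite epow_nneg// poweR_EFin => {}h.
have t0' : (0 <= t%:E)%E by rewrite lee_fin ltW.
apply: le_trans (lee_wpmul2l t0' h) _.
have tc0 : 0 <= t / potential_const n al by rewrite divr_ge0 ?ltW.
rewrite -!EFinM lee_fin; apply: le_of_eq.
have Wge0 : 0 <= W by rewrite mulr_ge0 ?powR_ge0 // mulr_ge0 ?powR_ge0// ltW.
rewrite powRM ?(ltW (ngrids_gt0 R n)) ?mulr_ge0 ?powR_ge0//.
rewrite powRM ?mulr_ge0 ?powR_ge0// powRM ?powR_ge0//.
rewrite -!powRrM divff ?gt_eqF// powRr1//.
have -> : - q / q = - 1 by rewrite mulNr divff ?gt_eqF.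
have -> : q / p / q = p^-1 by field; rewrite !gt_eqF.
rewrite powRN powRr1// invf_div /weak_const /W.
rewrite -/F -/X; by field; rewrite gt_eqF.
Qed.

Variable B' : R.
Hypotheses (B'0 : 0 < B') (BE' : mixed_const ssg r^-1 q^-1 (EFin \o sg) = B'%:E).
Local Notation A' := (fine (A_const ssg (EFin \o sg))).

Definition strong_const : R := ngrids R n `^ q^-1 * potential_const n al * finite_strong_const a q r s.
Definition strong_const' : R := ngrids R n `^ q^-1 * potential_const n al * finite_strong_const' a p q r.

Lemma riesz_strong (f : E -> R) : in_Lp p (EFin \o up) f ->
  (strong_norm q (EFin \o v) (riesz al f) <=
   (strong_const * ((1 + ln A) `^ r^-1 * B) + strong_const' * ((1 + ln A') `^ q^-1 * B'))%:E
   * strong_norm p (EFin \o up) (EFin \o f))%E.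
Proof.
move=> /in_Lp_Borel[g [mg g0 gf rg ->]].
set F := fine (integral _ _ _); have F0 : 0 <= F.
  by apply: fine_ge0; apply: integral_ge0 => x _; rewrite lee_fin mulr_ge0 ?powR_ge0.
have gc := g_cube_finite mv v0 p1 q1 r1 pr fin mg g0 gf.
pose X := (1 + ln A) `^ r^-1 * B; pose X' := (1 + ln A') `^ q^-1 * B'.
change (strong_norm q (EFin \o v) (riesz al f) <= (strong_const * X + strong_const' * X')%:E * (F `^ p^-1)%:E)%E.
pose W := finite_strong_const a q r s * X + finite_strong_const' a p q r * X'.
have c0 := potential_const_gt0 n al.
have fin' := A_const_dual mv v0 q0 r0 fin.
have strong_bd N (o : E) :=
  @grid_strong _ _ n0 _ _ _ _ _ _ mv v0 a01 p1 q1 r1 s1 pr qs apq fin _ mg g0 gf N o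
    _ B0 BE _ fin' B'0 BE'.
have h := potential_strong n0 aln mg g0 gc mv v0 q0 (fun N o => strong_bd N o).
have vv x : (0 <= (v x)%:E)%E by rewrite lee_fin ltW.
have {}h : (\int[mu]_x (epow `|riesz al f x| q * (EFin \o v) x) <=
    (potential_const n al `^ q * (ngrids R n * (W `^ q * F `^ (q / p))))%:E)%E.
  apply: le_trans h; apply: ge0_le_integral_any => [x|x|x _].
  - exact: mule_ge0 (epow_ge0 _ _) (vv x).
  - exact: mule_ge0 (poweR_ge0 _ _) (vv x).
  apply: lee_wpmul2r (vv x) _ _ _; rewrite epow_nneg ?(ltW q0)//.
  by apply: poweR_le (rg x); [exact: ltW|exact: abse_ge0].
have qi0 : 0 <= q^-1 by rewrite invr_ge0 ltW.
have i0 : (0 <= \int[mu]_x (epow `|riesz al f x| q * (EFin \o v) x))%E.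
  by apply: integral_ge0 => x _; exact: mule_ge0 (epow_ge0 _ _) (vv x).
rewrite /strong_norm epow_nneg//.
apply: le_trans (poweR_le qi0 i0 h) _.
rewrite poweR_EFin -EFinM lee_fin; apply: le_of_eq.
have X0 : 0 <= X := mulr_ge0 (powR_ge0 _ _) (ltW B0).
have X'0 : 0 <= X' := mulr_ge0 (powR_ge0 _ _) (ltW B'0).
have s0 : 0 <= finite_strong_const a q r s := mulr_ge0 (ltW (half_const_gt0 s1)) (powR_ge0 _ _).
have s'0 : 0 <= finite_strong_const' a p q r := mulr_ge0 (ltW (half_const_gt0 p1)) (powR_ge0 _ _).
have Wge0 : 0 <= W := addr_ge0 (mulr_ge0 s0 X0) (mulr_ge0 s'0 X'0).
rewrite powRM ?mulr_ge0 ?powR_ge0 ?(ltW (ngrids_gt0 R n))//.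
rewrite powRM ?(ltW (ngrids_gt0 R n)) ?mulr_ge0 ?powR_ge0//.
rewrite powRM ?powR_ge0//.
rewrite -!powRrM divff ?gt_eqF// !powRr1 ?(ltW c0)//.
have -> : q / p / q = p^-1 by field; rewrite !gt_eqF.
by rewrite /strong_const /strong_const' /W; ring.
Qed.

End operator_bounds.

(** * Operator norms, and the theorem *)

Section operator_norm.
Context (R : realType) (n : nat).
Local Notation E := (Rn R n).
Local Notation mu := (lebesgue_Rn R n).

Lemma riesz_norm_le al p (u : E -> \bar R) N (K : \bar R) : (0 <= K)%E ->
  (forall f : E -> R, in_Lp p u f -> N (riesz al f) <= K * strong_norm p u (EFin \o f))%E ->
  (riesz_norm al p u N <= K)%E.
Proof. by move=> K0 h; apply: ereal_inf_lbound. Qed.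

Lemma riesz_norm_ae al p (u v : E -> \bar R) N :
  (forall x, 0 <= u x)%E -> (forall x, 0 <= v x)%E ->
  {ae mu, forall x, u x = v x} -> riesz_norm al p u N = riesz_norm al p v N.
Proof.
move=> u0 v0 uv; have e : strong_norm p u = strong_norm p v.
  by apply/funext => g; exact: strong_norm_ae_weight.
by rewrite /riesz_norm /in_Lp e.
Qed.

Section dichotomy.
Variables (v : E -> R) (q r : R).
Hypotheses (mv : measurable_fun setT v) (v0 : forall x, 0 < v x).
Hypotheses (q0 : 0 < q) (r0 : 0 < r).
Local Notation s := (1 + q / r).
Hypothesis fin : (A_const s (EFin \o v) < +oo)%E.
Local Notation A := (fine (A_const s (EFin \o v))).

(** Since A and the mixed constant are at least 1, their product makes sense in ]0, +oo],
    and it is infinite only if the mixed constant is; the bounds of the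
    previous part cover the finite case, and there is nothing to prove in the other. *)
Lemma log_mixed_const_dichotomy (X : \bar R) :
  X = (epow (Phi (A_const s (EFin \o v))) r^-1 *
       mixed_const s q^-1 r^-1 (EFin \o v))%E ->
  X = +oo%E \/ exists b : R, [/\ 0 < b,
    mixed_const s q^-1 r^-1 (EFin \o v) = b%:E & X = ((1 + ln A) `^ r^-1 * b)%:E].
Proof.
have A1 := A_const_ge1 mv v0 q0 r0 fin.
have AE : A_const s (EFin \o v) = A%:E.
  by rewrite fineK// ge0_fin_numE//; exact: le_trans A1.
have := A1; rewrite {1}AE lee_fin => A1'.
have PE : epow (Phi (A_const s (EFin \o v))) r^-1 = ((1 + ln A) `^ r^-1)%:E.
  rewrite epow_nneg ?invr_ge0 ?(ltW r0)// {1}AE /Phi lne_EFin ?(lt_le_trans ltr01)//.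
have PE0 : 0 < (1 + ln A) `^ r^-1 by rewrite powR_gt0// addr1_ln_gt0.
have m1 := mixed_const_ge1 mv v0 q0 r0 fin (b := q^-1) (c := r^-1).
rewrite !invr_ge0 (ltW q0) (ltW r0) in m1; have {}m1 := m1 isT isT.
move=> ->; rewrite PE; move: m1; case: mixed_const => [b| |]//.
  rewrite lee_fin => b1; right; exists b; split => //.
  exact: lt_le_trans b1.
by left; rewrite gt0_muley.
Qed.

End dichotomy.

Lemma zero_weight_norms al p q (u v : E -> \bar R) : (0 < q) ->
  (forall x, 0 <= v x)%E -> {ae mu, forall x, v x = 0%E} ->
  (riesz_norm al p u (weak_norm q v) <= 0)%E /\ (riesz_norm al p u (strong_norm q v) <= 0)%E.
Proof.
move=> q0 v0 vz; have z0 (x : E) : (0 <= cst 0 x :> \bar R)%E by [].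
have qi : 0 <= q^-1 by rewrite invr_ge0 ltW.
split; apply: riesz_norm_le => // f _; rewrite mul0e.
  rewrite (weak_norm_ae_weight v0 z0 vz); apply: ge_ereal_sup => _ [t _ <-].
  rewrite /wmeas integral0_eq// epow_nneg// poweR0r ?mule0//.
  by rewrite invr_eq0 gt_eqF.
rewrite (strong_norm_ae_weight v0 z0 vz) /strong_norm integral0_eq.
  by rewrite epow_nneg// poweR0r// invr_eq0 gt_eqF.
by move=> x _; rewrite mule0.
Qed.

Section positive_weight.
Hypothesis n0 : (0 < n)%N.
Variables (w : E -> R) (al p q r s : R).
Hypotheses (mw : measurable_fun setT w) (w0 : forall x, 0 < w x).
Local Notation a := (al / n%:R).
Hypotheses (a01 : 0 < a < 1) (p1 : 1 < p) (q1 : 1 < q) (r1 : 1 < r) (s1 : 1 < s).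
Hypotheses (pr : p^-1 + r^-1 = 1) (qs : q^-1 + s^-1 = 1) (apq : a = p^-1 - q^-1).
Local Notation v := (fun x => w x `^ q).

Let q0 : 0 < q. Proof. exact: lt_trans q1. Qed.
Let r0 : 0 < r. Proof. exact: lt_trans r1. Qed.
Let p0 : 0 < p. Proof. exact: lt_trans p1. Qed.

Lemma wpow_q : wpow w q = EFin \o v.
Proof. by apply/funext => x; rewrite /wpow epow_nneg ?(ltW q0)// poweR_EFin. Qed.

Lemma wpow_p : wpow w p = EFin \o pweight v p q.
Proof.
apply/funext => x; rewrite /wpow epow_nneg ?(ltW p0)// poweR_EFin /= /pweight -powRrM.
by congr (_ `^ _)%:E; field; rewrite gt_eqF.
Qed.

Lemma wpow_dual : wpow w (- r) = EFin \o dual_weight v q r.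
Proof.
apply/funext => x; rewrite /wpow /epow oppr_lt0 r0 opprK poweR_EFin.
rewrite inver gt_eqF ?powR_gt0// /= /dual_weight -powRrM -powRN.
by congr (_ `^ _)%:E; field; rewrite gt_eqF.
Qed.

Variable c : R.
Hypotheses (c0 : 0 < c) (cw : weak_const n al q r <= c).
Hypotheses (cs : strong_const n al q r s <= c) (cs' : strong_const' n al p q r <= c).

Lemma positive_weight_bounds : (A_const (1 + q / r) (wpow w q) < +oo)%E ->
  let B := (epow (Phi (A_const (1 + q / r) (wpow w q))) (r^-1)
            * mixed_const (1 + q / r) (q^-1) (r^-1) (wpow w q))%E in
  let B' := (epow (Phi (A_const (1 + r / q) (wpow w (- r)))) (q^-1)
            * mixed_const (1 + r / q) (r^-1) (q^-1) (wpow w (- r)))%E in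
  (riesz_norm al p (wpow w p) (weak_norm q (wpow w q)) <= c%:E * B)%E /\
  (riesz_norm al p (wpow w p) (strong_norm q (wpow w q)) <= c%:E * (B + B'))%E.
Proof.
rewrite wpow_q wpow_p wpow_dual => fin.
have mv : measurable_fun setT v by apply: (measurableT_comp (measurable_powR _) mw).
have v0 x : 0 < v x by exact: powR_gt0.
have fin' := A_const_dual mv v0 q0 r0 fin.
have msg := measurable_dual_weight q r mv.
have sg0 := dual_weight_gt0 q r v0.
set B := (epow (Phi (A_const (1 + q / r) _)) _ * _)%E.
set B' := (epow (Phi (A_const (1 + r / q) _)) _ * _)%E.
move=> /=.
have B0 : (0 <= B)%E by rewrite /B mule_ge0 ?epow_ge0// mixed_const_ge0.
have B'0 : (0 <= B')%E by rewrite /B' mule_ge0 ?epow_ge0// mixed_const_ge0.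
have c0' : (0 < c%:E)%E by rewrite lte_fin.
case: (log_mixed_const_dichotomy mv v0 q0 r0 fin (erefl B)) => [->|[b [b0 bE BE]]].
  by rewrite addye ?gt0_muley ?leey//; apply/eqP => h; move: B'0; rewrite h.
split.
  rewrite BE -EFinM; apply: riesz_norm_le => [|f fL].
    by rewrite lee_fin mulr_ge0 ?(ltW c0)// mulr_ge0 ?powR_ge0// ltW.
  apply: le_trans (riesz_weak n0 mv v0 a01 p1 q1 r1 pr apq fin b0 bE fL) _.
  apply: lee_wpmul2r; first exact: epow_ge0.
  by rewrite lee_fin; apply: ler_wpM2r cw; rewrite mulr_ge0 ?powR_ge0// ltW.
case: (log_mixed_const_dichotomy msg sg0 r0 q0 fin' (erefl B')) => [->|[b' [b'0 b'E BE']]].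
  by rewrite BE gt0_muley ?leey.
pose X := (1 + ln (fine (A_const (1 + q / r) (EFin \o v)))) `^ r^-1 * b.
pose X' := (1 + ln (fine (A_const (1 + r / q) (EFin \o dual_weight v q r)))) `^ q^-1 * b'.
have BX : B = X%:E := BE.
have BX' : B' = X'%:E := BE'.
rewrite BX BX' -EFinD -EFinM.
have X0 : 0 <= X := mulr_ge0 (powR_ge0 _ _) (ltW b0).
have X'0 : 0 <= X' := mulr_ge0 (powR_ge0 _ _) (ltW b'0).
apply: riesz_norm_le => [|f fL]; first by rewrite lee_fin mulr_ge0 ?(ltW c0)// addr_ge0.
apply: le_trans (riesz_strong n0 mv v0 a01 p1 q1 r1 s1 pr qs apq fin b0 bE b'0 b'E fL) _.
apply: lee_wpmul2r; first exact: epow_ge0.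
by rewrite lee_fin (mulrDr c X X'); exact: lerD (ler_wpM2r X0 cs) (ler_wpM2r X'0 cs').
Qed.
End positive_weight.

End operator_norm.

Lemma common_bound (R : realDomainType) (x y z : R) :
  exists c, [/\ 0 < c, x <= c, y <= c & z <= c].
Proof.
have [[h1 h2] h3] := (ler_norm x, ler_norm y, ler_norm z).
have := (normr_ge0 x, normr_ge0 y, normr_ge0 z) => -[[g1 g2] g3].
by exists (`|x| + `|y| + `|z| + 1); split; lra.
Qed.

Theorem theorem2p7 (R : realType) (n : nat) (alpha p q : R)
    (alpha_bounds : 0 < alpha < n%:R)
    (p_bounds : 1 < p < n%:R / alpha)
    (q_def : p^-1 - q^-1 = alpha / n%:R) :
  let p' := conj_exp p in
  let s := 1 + q / p' in
  let s' := 1 + p' / q in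
  exists c : R, 0 < c /\
    forall w : Rn R n -> R, weight w ->
      (A_const s (wpow w q) < +oo)%E ->
      let B := (epow (Phi (A_const s (wpow w q))) (p'^-1)
                * mixed_const s (q^-1) (p'^-1) (wpow w q))%E in
      let B' := (epow (Phi (A_const s' (wpow w (- p')))) (q^-1)
                * mixed_const s' (p'^-1) (q^-1) (wpow w (- p')))%E in
      (riesz_norm alpha p (wpow w p) (weak_norm q (wpow w q)) <= c%:E * B)%E /\
      (riesz_norm alpha p (wpow w p) (strong_norm q (wpow w q))
         <= c%:E * (B + B'))%E.
Proof.
have /andP[al0 aln] := alpha_bounds; have /andP[p1 pn] := p_bounds.
have n0' : 0 < n%:R :> R by exact: lt_trans aln.
have n0 : (0 < n)%N by rewrite -(ltr0n R).
have p0 : 0 < p by exact: lt_trans p1.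
have a01 : 0 < alpha / n%:R < 1 by rewrite divr_gt0//= ltr_pdivrMr// mul1r.
have ap : alpha / n%:R < p^-1.
  by rewrite -[alpha / _]invf_div ltf_pV2// posrE// divr_gt0.
have qi0 : 0 < q^-1 by lra.
have q0 : 0 < q by rewrite -invr_gt0.
have pi1 : p^-1 < 1 by rewrite invf_lt1.
have q1 : 1 < q.
  have /andP[a0 _] := a01; rewrite -invf_lt1//; lra.
move=> r s s'.
have conj (x : R) : 1 < x -> 1 < conj_exp x /\ x^-1 + (conj_exp x)^-1 = 1.
  move=> x1; have x0 : 0 < x - 1 by rewrite subr_gt0.
  split; first by rewrite /conj_exp ltr_pdivlMr// mul1r; lra.
  by rewrite /conj_exp; field; rewrite !gt_eqF//; exact: lt_trans x1.
have [r1 pr] := conj p p1; have [t1 qt] := conj q q1.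
have r0 : 0 < r by exact: lt_trans r1.
have [c [c0 cw cs cs']] := common_bound (weak_const n alpha q r)
  (strong_const n alpha q r (conj_exp q)) (strong_const' n alpha p q r).
exists c; split => // w [[g mg wg] w0 _] fin B B'.
have s1 : 1 < s by rewrite /s ltrDl divr_gt0.
(* Two Borel versions of w: u is nonnegative, and z, used when w > 0 almost
   everywhere, is positive. *)
pose u x := Num.max (g x) 0.
have mu_ : measurable_fun setT u by apply: measurable_maxr.
have u0 x : 0 <= u x by rewrite /u le_max lexx orbT.
have wu : {ae lebesgue_Rn R n, forall x, w x = u x}.
  by apply: filterS wg => x gx; rewrite /u -gx max_l.
have pos (f : Rn R n -> R) e x : (0 <= wpow f e x)%E by exact: epow_ge0.
have B0 : (0 <= B)%E by rewrite /B mule_ge0 ?epow_ge0// mixed_const_ge0.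
have B'0 : (0 <= B')%E by rewrite /B' mule_ge0 ?epow_ge0// mixed_const_ge0.
have ae_wpow (f : Rn R n -> R) e : {ae lebesgue_Rn R n, forall x, w x = f x} ->
    {ae lebesgue_Rn R n, forall x, wpow w e x = wpow f e x}.
  by apply: filterS => x wf; rewrite /wpow wf.
have finu : (A_const s (wpow u q) < +oo)%E.
  by rewrite -(A_const_ae (pos w q) (pos u q) (ae_wpow u q wu)).
have [uz|up] := weight_dichotomy mu_ u0 q0 s1 finu.
  have wz : {ae lebesgue_Rn R n, forall x, wpow w q x = 0%E}.
    apply: filterS2 wu uz => x wx ux.
    by rewrite /wpow wx ux epow_nneg ?(ltW q0)// poweR0r ?gt_eqF.
  have [hw hs] := zero_weight_norms alpha p (wpow w p) q0 (pos w q) wz.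
  split; [apply: le_trans hw _|apply: le_trans hs _].
    by rewrite mule_ge0// lee_fin ltW.
  by rewrite mule_ge0 ?adde_ge0// lee_fin ltW.
pose z x := if 0 < u x then u x else 1.
have z0 x : 0 < z x by rewrite /z; case: ifP.
have mz : measurable_fun setT z.
  apply: measurable_fun_ifT => //.
  by apply: measurable_fun_ltr.
have wz : {ae lebesgue_Rn R n, forall x, w x = z x}.
  by apply: filterS2 wu up => x -> ux; rewrite /z ux.
have e t := ae_wpow z t wz.
have finz : (A_const s (wpow z q) < +oo)%E.
  by rewrite -(A_const_ae (pos w q) (pos z q) (e q)).
have := @positive_weight_bounds R n n0 z alpha p q r (conj_exp q) mz z0 a01 p1 q1 r1 t1 pr qt
  (esym q_def) c c0 cw cs cs' finz.
rewrite -(A_const_ae (pos w q) (pos z q) (e q)).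
rewrite -(A_const_ae (pos w (- r)) (pos z (- r)) (e (- r))).
rewrite -(mixed_const_ae (pos w q) (pos z q) (e q)).
rewrite -(mixed_const_ae (pos w (- r)) (pos z (- r)) (e (- r))).
rewrite -!(riesz_norm_ae _ _ _ (pos w p) (pos z p) (e p)).
have -> : weak_norm q (wpow z q) = weak_norm q (wpow w q).
  by apply/funext => h; rewrite (weak_norm_ae_weight (pos w q) (pos z q) (e q)).
have -> : strong_norm q (wpow z q) = strong_norm q (wpow w q).
  by apply/funext => h; rewrite (strong_norm_ae_weight (pos w q) (pos z q) (e q)).
by [].
Qed.
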